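(* Let $\omega>0$, $r\in\mathbb R$, $r\notin\mathbb Z$. The set $L_{<r>}\cap(\mathbb R^2\setminus\Sigma_{<r>})$ is defined by the following equation in the variables $(B,A)\in\mathbb R^2\setminus\Sigma_{<r>}$, where $B=l\omega$, $A=2\mu\omega$, $\lambda+\mu^2=\frac1{4\omega^2}$: $$\Big(\frac{r-l}2+1\Big)\Big(\frac{r+l}2-1\Big)R_{1,11}T_{0,11}+\mu^2R_{1,21}T_{0,21}=0 .$$
   Context: Fix $\omega>0$. For $(B,A)\in\mathbb R^2$ put $l=\frac B\omega$, $\mu=\frac A{2\omega}$, $\lambda=\frac1{4\omega^2}-\mu^2$ and consider the vector field $$\dot\phi=-\frac{\sin\phi}{\omega}+l+2\mu\cos\tau,\qquad \dot\tau=1$$ on the two-torus $\mathbb T^2=\mathbb R^2/2\pi\mathbb Z^2$. Its rotation number is $\rho(B,A)=\lim_{k\to+\infty}\frac{\phi(2\pi k)}{2\pi k}$, where $\phi(\tau)$ is an arbitrary real-valued solution of $\frac{d\phi}{d\tau}=-\frac{\sin\phi}\omega+l+2\mu\cos\tau$ (the limit does not depend on the solution). For $v\in\mathbb R$ let $L_v=\{(B,A)\in\mathbb R^2\mid\rho(B,A)=v\}$, and set $$L_{<r>}=\bigsqcup_{v\equiv\pm r\,(\mathrm{mod}\,2\mathbb Z)}L_v,\qquad \Sigma_{<r>}=\Big\{(B,A)\in\mathbb R^2\;\Big|\; \tfrac B\omega\equiv r \text{ or } \tfrac B\omega\equiv -r\ (\mathrm{mod}\ 2\mathbb Z)\Big\}.$$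 The matrices are $$M_k=\begin{pmatrix}1+\frac{\lambda}{(k+\frac r2)^2-\frac{l^2}4} & \frac{\mu^2}{(k+\frac r2)^2-\frac{l^2}4}\\ 1&0\end{pmatrix},\qquad R_k=M_kM_{k+1}\cdots,$$ $$S_m=\begin{pmatrix}1+\frac{\lambda-l+1}{(\frac{r-l}2-m+1)(\frac{r+l}2-m-1)} & \frac{\mu^2(\frac{r+l}2-m)}{(\frac{r-l}2-m+1)(\frac{r+l}2-m-1)(\frac{r+l}2-m-2)}\\ 1&0\end{pmatrix},\qquad T_m=S_mS_{m+1}\cdots$$ (the infinite products converge), and $R_{k,ij}$, $T_{m,ij}$ denote the matrix elements of $R_k$, $T_m$. *)

(* Defs.v *)
From Stdlib Require Import Reals.
From Coquelicot Require Import Coquelicot.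
Open Scope R_scope.

Definition ell (omega B : R) : R := B / omega.
Definition mu (omega A : R) : R := A / (2 * omega).
Definition lambda (omega A : R) : R :=
  1 / (4 * omega ^ 2) - mu omega A ^ 2.

(* [phi] is a global real-valued solution, i.e. a lift to the line of an
   orbit on the torus parametrized by [tau]. *)
Definition is_solution (omega B A : R) (phi : R -> R) : Prop :=
  forall tau : R,
    is_derive phi tau
      (- sin (phi tau) / omega + ell omega B + 2 * mu omega A * cos tau).

(* rho(B,A) = v: the limit exists and equals [v] along every solution.
   The first conjunct keeps the second one from holding vacuously. *)
Definition is_rotation_number (omega B A v : R) : Prop :=
  (exists phi : R -> R, is_solution omega B A phi) /\
  (forall phi : R -> R, is_solution omega B A phi ->
     is_lim_seq (fun k : nat => phi (2 * PI * INR k) / (2 * PI * INR k)) v).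

Definition eq_mod_2Z (x y : R) : Prop := exists n : Z, x = y + 2 * IZR n.

Definition L (omega v : R) (p : R * R) : Prop :=
  is_rotation_number omega (fst p) (snd p) v.

Definition L_pm (omega r : R) (p : R * R) : Prop :=
  exists v : R, (eq_mod_2Z v r \/ eq_mod_2Z v (- r)) /\ L omega v p.

Definition Sigma_pm (omega r : R) (p : R * R) : Prop :=
  eq_mod_2Z (fst p / omega) r \/ eq_mod_2Z (fst p / omega) (- r).

Definition Mmat (r l mu lambda : R) (k : nat) : @matrix R 2 2 :=
  [[ 1 + lambda / ((INR k + r / 2) ^ 2 - l ^ 2 / 4),
     mu ^ 2 / ((INR k + r / 2) ^ 2 - l ^ 2 / 4) ],
   [ 1, 0 ]].

Definition Smat (r l mu lambda : R) (m : nat) : @matrix R 2 2 :=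
  [[ 1 + (lambda - l + 1)
         / (((r - l) / 2 - INR m + 1) * ((r + l) / 2 - INR m - 1)),
     mu ^ 2 * ((r + l) / 2 - INR m)
         / (((r - l) / 2 - INR m + 1) * ((r + l) / 2 - INR m - 1)
            * ((r + l) / 2 - INR m - 2)) ],
   [ 1, 0 ]].

(* X k * X (k+1) * ... * X (k+n-1) *)
Fixpoint partial_prod (X : nat -> @matrix R 2 2) (k n : nat) : @matrix R 2 2 :=
  match n with
  | O => @Mone R_Ring 2
  | S n' => @Mmult R_Ring 2 2 2 (partial_prod X k n') (X (k + n')%nat)
  end.

(* Entrywise limit of the partial products.  [Lim_seq] is total; its value is
   meaningful only when the product converges, as it does for [Mmat] and [Smat]
   whenever no denominator vanishes. *)
Definition inf_prod (X : nat -> @matrix R 2 2) (k : nat) : @matrix R 2 2 :=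
  mk_matrix 2 2 (fun i j =>
    real (Lim_seq (fun n : nat => coeff_mat 0 (partial_prod X k n) i j))).

Definition Rmat (r l mu lambda : R) (k : nat) : @matrix R 2 2 :=
  inf_prod (Mmat r l mu lambda) k.

Definition Tmat (r l mu lambda : R) (m : nat) : @matrix R 2 2 :=
  inf_prod (Smat r l mu lambda) m.

(* Indices of [entry] start at 1. *)
Definition entry (X : @matrix R 2 2) (i j : nat) : R :=
  coeff_mat 0 X (pred i) (pred j).

(* Main.v *)
Require Import Defs.
From Stdlib Require Import Reals Lra Lia Psatz ZArith Classical.
From Coquelicot Require Import Coquelicot.
Open Scope R_scope.

(** Writing [phi / 2] as the polar angle of a real vector [(x, y)] linearises the equation to a
    trace-free 2x2 system with 2 PI-periodic coefficients, whose monodromy [P] lies in SL(2, R).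
    If [tr P = 2 cos alpha] with [sin alpha <> 0], the angle of [P^k] stays within [PI] of
    [k alpha'] for one [alpha' = +-alpha mod 2 PI], so [rho = alpha' / PI]; if [|tr P| >= 2], a
    real eigenvector makes [rho] an integer.  As [r] is not an integer, [L_pm] is therefore the
    set where [tr P = 2 cos (PI r)], that is, where [exp (i PI r)] is an eigenvalue of [P].

    After the gauge factor [exp (mu cos t)], the Fourier coefficients of a solution multiplied
    by [exp (i PI r)] over a period satisfy the three-term recurrence of the Heun equation.
    The products [R_k] and [T_m] are the solutions of that recurrence recessive at [+oo] and at
    [-oo], every bounded solution is proportional to both, and the equation of the theorem says
    that the two are proportional.  If they are not, a Floquet solution has only zero Fourier
    coefficients, which is absurd.  If they are, the recurrence with a suitable unit source
    [delta_k0] has no bounded solution; but were [exp (i PI r)] not an eigenvalue, the forced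
    system would have a quasi-periodic solution whose coefficients are one.  *)

(** * Global solutions of scalar equations *)

(** Both directions pass only from the differential equation to the recurrence: Fourier coefficients
    of given functions are computed, and no series is ever summed into a solution. This is the
    reason for the unit source in the converse: the forced system is solved quasi-periodically by
    inverting [zeta - P], [zeta = exp (i PI r)], and boundedness of its coefficients is all that the
    growth arguments ask for. Outside [Sigma_pm] neither [(r - l) / 2] nor [(r + l) / 2] is an
    integer, so no denominator of the matrices vanishes. The entries of the products may still
    vanish; every relation is therefore kept free of quotients, and degenerate zeros are treated by
    cases, as is [mu = 0], where the recurrence decouples. The linear system is never solved
    directly: the phase equation has a bounded Lipschitz right side, so Picard iteration converges
    on the whole line, and linear solutions are rebuilt from phases. Complex quantities are split
    into pairs of reals. *)

Definition cont (f : R -> R) : Prop := forall t, continuous f t.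

Lemma cont_of_derive (f df : R -> R) : (forall t, is_derive f t (df t)) -> cont f.
Proof.
  intros H t. apply (ex_derive_continuous f t). exists (df t). apply H.
Qed.

Lemma cont_ext (f g : R -> R) : (forall t, f t = g t) -> cont f -> cont g.
Proof. intros H Hf t. apply (continuous_ext f); auto. Qed.

Lemma cont_const (k : R) : cont (fun _ => k).
Proof. intros t. apply continuous_const. Qed.

Lemma cont_id : cont (fun t => t).
Proof. intros t. apply continuous_id. Qed.

Lemma cont_plus (f g : R -> R) : cont f -> cont g -> cont (fun t => f t + g t).
Proof. intros Hf Hg t. apply (continuous_plus f g); auto. Qed.

Lemma cont_mult (f g : R -> R) : cont f -> cont g -> cont (fun t => f t * g t).
Proof. intros Hf Hg t. apply (continuous_mult f g); auto. Qed.

Lemma cont_opp (f : R -> R) : cont f -> cont (fun t => - f t).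
Proof. intros Hf t. apply (continuous_opp f); auto. Qed.

Lemma cont_minus (f g : R -> R) : cont f -> cont g -> cont (fun t => f t - g t).
Proof. intros Hf Hg t. apply (continuous_minus f g); auto. Qed.

Lemma cont_comp (g f : R -> R) : cont g -> cont f -> cont (fun t => g (f t)).
Proof. intros Hg Hf t. apply (continuous_comp f g); auto. Qed.

Lemma cont_sin : cont sin.
Proof. intros t. apply continuous_sin. Qed.

Lemma cont_cos : cont cos.
Proof. intros t. apply continuous_cos. Qed.

Lemma cont_exp : cont exp.
Proof. intros t. apply continuous_exp. Qed.

Lemma cont_pow (f : R -> R) (n : nat) : cont f -> cont (fun t => f t ^ n).
Proof.
  intros Hf. induction n as [|n IH]; simpl.
  - apply cont_const.
  - now apply cont_mult.
Qed.

Ltac cont_tac :=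
  lazymatch goal with
  | |- cont (fun _ => ?k) => apply cont_const
  | |- cont (fun t => t) => apply cont_id
  | |- cont (fun t => sin (@?f t)) => apply (cont_comp sin f cont_sin); cont_tac
  | |- cont (fun t => cos (@?f t)) => apply (cont_comp cos f cont_cos); cont_tac
  | |- cont (fun t => exp (@?f t)) => apply (cont_comp exp f cont_exp); cont_tac
  | |- cont (fun t => @?f t + @?g t) => apply (cont_plus f g); cont_tac
  | |- cont (fun t => @?f t - @?g t) => apply (cont_minus f g); cont_tac
  | |- cont (fun t => @?f t * @?g t) => apply (cont_mult f g); cont_tac
  | |- cont (fun t => @?f t / ?k) => apply (cont_mult f (fun _ => / k)); cont_tac
  | |- cont (fun t => - @?f t) => apply (cont_opp f); cont_tac
  | |- cont (fun t => @?f t ^ ?n) => apply (cont_pow f n); cont_tac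
  | |- cont (fun t => ?f (@?g t)) =>
      first [assumption | apply (cont_comp f g); [assumption | cont_tac]]
  | |- _ => assumption
  end.

Lemma cont_ex_RInt (f : R -> R) (a b : R) : cont f -> ex_RInt f a b.
Proof. intros Hf. apply (ex_RInt_continuous (V := R_CompleteNormedModule)). intros z _. apply Hf. Qed.

Lemma cont_RInt_derive (g : R -> R) (a : R) :
  cont g -> forall t, is_derive (fun s => RInt g a s) t (g t).
Proof.
  intros Hg t. apply (is_derive_RInt g _ a).
  - exists (mkposreal 1 Rlt_0_1). intros y _. apply (RInt_correct g).
    now apply cont_ex_RInt.
  - apply Hg.
Qed.

Lemma derive_zero_const (f : R -> R) :
  (forall t, is_derive f t 0) -> forall s t, f s = f t.
Proof.
  intros H s t.
  destruct (Rtotal_order s t) as [h|[h|h]].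
  - apply (eq_is_derive f s t); auto.
  - now rewrite h.
  - symmetry. apply (eq_is_derive f t s); auto.
Qed.

Lemma mean_value_bound_le (d dd g dg : R -> R) (t : R) :
  0 <= t -> (forall s, is_derive d s (dd s)) -> (forall s, is_derive g s (dg s)) ->
  d 0 = 0 -> g 0 = 0 -> (forall s, 0 <= s <= t -> dd s <= dg s) -> d t <= g t.
Proof.
  intros Ht Hd Hg d0 g0 H.
  assert (HD : forall s, is_derive (fun s => g s - d s) s (dg s - dd s)).
  { intros s. apply (is_derive_minus g d s _ _ (Hg s) (Hd s)). }
  destruct (MVT_gen (fun s => g s - d s) 0 t (fun s => dg s - dd s)) as [c [Hc E]].
  - intros x _. apply HD.
  - intros x _. apply continuity_pt_filterlim. apply (cont_of_derive _ _ HD).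
  - rewrite Rmin_left, Rmax_right in Hc by lra. rewrite d0, g0 in E.
    specialize (H c Hc). nra.
Qed.

Lemma monomial_growth (d dd : R -> R) (K : R) (n : nat) :
  (forall t, is_derive d t (dd t)) -> d 0 = 0 ->
  (forall t, Rabs (dd t) <= K * (Rabs t ^ n / INR (fact n))) ->
  forall t, Rabs (d t) <= K * (Rabs t ^ S n / INR (fact (S n))).
Proof.
  (* Only an upper bound for [t >= 0] is proved directly; applied to [d], [- d] and their time
     reversals, it covers both signs of the value and of the time. *)
  assert (main : forall d dd : R -> R,
    (forall t, is_derive d t (dd t)) -> d 0 = 0 ->
    (forall t, Rabs (dd t) <= K * (Rabs t ^ n / INR (fact n))) ->
    forall t, 0 <= t -> d t <= K * (t ^ S n / INR (fact (S n)))).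
  { clear d dd. intros d dd Hd d0 B t Ht.
    apply (mean_value_bound_le d dd (fun s => K * (s ^ S n / INR (fact (S n))))
             (fun s => K * (s ^ n / INR (fact n)))); auto.
    - intros s. auto_derive; auto.
      replace (match n with O => 1 | S _ => INR n + 1 end) with (INR (S n)) by
        (destruct n; simpl; auto).
      assert (INR (fact n) <> 0) by apply INR_fact_neq_0.
      change (fact n + n * fact n)%nat with (S n * fact n)%nat. rewrite mult_INR.
      assert (INR (S n) <> 0) by (apply not_0_INR; lia).
      field. auto.
    - simpl. unfold Rdiv. ring.
    - intros s [hs _]. specialize (B s). rewrite (Rabs_right s) in B by lra.
      apply Rle_trans with (2 := B). apply Rle_abs. }
  intros Hd d0 B t.
  assert (Hopp : forall f df : R -> R, (forall t, is_derive f t (df t)) ->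
     forall s, is_derive (fun s => - f s) s (- df s)).
  { intros f df H s. apply (is_derive_opp f s _ (H s)). }
  destruct (Rle_dec 0 t) as [h|h].
  - rewrite (Rabs_right t) by lra. apply Rabs_le. split.
    + enough (- d t <= K * (t ^ S n / INR (fact (S n)))) by lra.
      apply (main (fun s => - d s) (fun s => - dd s)); auto.
      * lra.
      * intros s. rewrite Rabs_Ropp. apply B.
    + now apply (main d dd).
  - assert (Hrev : forall s, is_derive (fun s => d (- s)) s (- dd (- s))).
    { intros s. assert (H := Hd (- s)).
      replace (- dd (- s)) with (-1 * dd (- s)) by ring.
      apply (is_derive_comp d Ropp s (dd (- s)) (-1)); auto.
      auto_derive; auto. }
    replace t with (- (- t)) by lra. set (u := - t). assert (0 <= u) by (unfold u; lra).
    rewrite Rabs_Ropp, (Rabs_right u) by lra. apply Rabs_le. split.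
    + enough (- d (- u) <= K * (u ^ S n / INR (fact (S n)))) by lra.
      apply (main (fun s => - d (- s)) (fun s => - (- dd (- s)))); auto.
      * apply (Hopp _ _ Hrev).
      * rewrite Ropp_0. lra.
      * intros s. rewrite !Rabs_Ropp. rewrite <- (Rabs_Ropp s). apply B.
    + apply (main (fun s => d (- s)) (fun s => - dd (- s))); auto.
      * now rewrite Ropp_0.
      * intros s. rewrite !Rabs_Ropp. rewrite <- (Rabs_Ropp s). apply B.
Qed.

Fixpoint picard (F : R -> R -> R) (y0 : R) (n : nat) : R -> R :=
  match n with
  | O => fun _ => y0
  | S n' => fun t => y0 + RInt (fun s => F s (picard F y0 n' s)) 0 t
  end.

Lemma picard_cont (F : R -> R -> R) (y0 : R) (n : nat) :
  (forall y, cont y -> cont (fun t => F t (y t))) -> cont (picard F y0 n).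
Proof.
  intros HF. induction n as [|n IH]; simpl.
  - apply cont_const.
  - apply cont_plus; [apply cont_const|].
    apply (cont_of_derive _ (fun s => F s (picard F y0 n s))).
    intros t. apply (cont_RInt_derive (fun s => F s (picard F y0 n s))). now apply (HF (picard F y0 n)).
Qed.

Lemma picard_derive (F : R -> R -> R) (y0 : R) (n : nat) (t : R) :
  (forall y, cont y -> cont (fun t => F t (y t))) ->
  is_derive (picard F y0 (S n)) t (F t (picard F y0 n t)).
Proof.
  intros HF. simpl.
  replace (F t (picard F y0 n t)) with (0 + F t (picard F y0 n t)) by ring.
  apply (is_derive_plus (fun _ => y0)).
  - apply (is_derive_const y0 t).
  - apply (cont_RInt_derive (fun s => F s (picard F y0 n s))).
    apply (HF (picard F y0 n)). now apply picard_cont.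
Qed.

(** The Lipschitz bound turns the estimate on one difference of iterates into an estimate on the
    derivative of the next difference; [monomial_growth] integrates it, raising the power and the
    factorial by one. *)
Lemma picard_step (F : R -> R -> R) (M K y0 : R) (n : nat) (t : R) :
  0 <= K ->
  (forall y, cont y -> cont (fun t => F t (y t))) ->
  (forall t y, Rabs (F t y) <= M) ->
  (forall t y z, Rabs (F t y - F t z) <= K * Rabs (y - z)) ->
  Rabs (picard F y0 (S n) t - picard F y0 n t) <=
    M * K ^ n * (Rabs t ^ S n / INR (fact (S n))).
Proof.
  intros HK Hc HM HL. revert t. induction n as [|n IH].
  - apply (monomial_growth _ (fun t => F t y0)).
    + intros t.
      replace (F t y0) with (F t (picard F y0 0 t) - 0) by (simpl; ring).
      apply (is_derive_minus (picard F y0 1) (fun _ => y0)).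
      * now apply picard_derive.
      * apply (is_derive_const y0 t).
    + simpl. rewrite RInt_point. unfold zero; simpl. ring.
    + intros t. simpl. rewrite Rmult_1_r. unfold Rdiv. rewrite Rinv_1, !Rmult_1_r.
      apply HM.
  - apply (monomial_growth _
      (fun t => F t (picard F y0 (S n) t) - F t (picard F y0 n t))).
    + intros t. apply (is_derive_minus (picard F y0 (S (S n))) (picard F y0 (S n)));
      now apply picard_derive.
    + simpl. rewrite !RInt_point. unfold zero; simpl. ring.
    + intros t. eapply Rle_trans; [apply HL|].
      simpl (K ^ S n). replace (M * (K * K ^ n)) with (K * (M * K ^ n)) by ring.
      rewrite Rmult_assoc. apply Rmult_le_compat_l; auto.
Qed.

(** The constant does not depend on [n], so it survives the limit and gives continuity of the limit
    without an argument on uniform convergence. *)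
Lemma picard_lipschitz (F : R -> R -> R) (M y0 : R) (n : nat) (s t : R) :
  (forall y, cont y -> cont (fun t => F t (y t))) ->
  (forall t y, Rabs (F t y) <= M) ->
  Rabs (picard F y0 n t - picard F y0 n s) <= M * Rabs (t - s).
Proof.
  intros Hc HM. destruct n as [|n].
  - simpl. rewrite Rminus_diag, Rabs_R0.
    apply Rmult_le_pos; [|apply Rabs_pos].
    apply Rle_trans with (2 := HM 0 0). apply Rabs_pos.
  - apply (bounded_variation _ (fun t => F t (picard F y0 n t))).
    intros u _. split; [now apply picard_derive|apply HM].
Qed.

(** Comparison with the exponential series at [|K T|], after enlarging [1 / (n + 1)!] to
    [1 / n!]. *)
Lemma exp_majorant_series (M K T : R) :
  ex_series (fun n => M * K ^ n * (T ^ S n / INR (fact (S n)))).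
Proof.
  assert (E2 : ex_series (fun n => Rabs M * Rabs T * (Rabs (K * T) ^ n / INR (fact n)))).
  { apply (ex_series_scal_l (Rabs M * Rabs T) (fun n => Rabs (K * T) ^ n / INR (fact n))).
    exists (exp (Rabs (K * T))). generalize (is_exp_Reals (Rabs (K * T))).
    apply is_series_ext. intros n. rewrite pow_n_pow.
    unfold scal; simpl; unfold mult; simpl. unfold Rdiv. ring. }
  apply (ex_series_le (V := R_CompleteNormedModule) _ _) with (2 := E2).
  intros n. unfold norm; simpl; unfold abs; simpl.
  assert (Hn : 0 < INR (fact n)) by apply INR_fact_lt_0.
  assert (Hs : 0 < INR (fact (S n))) by apply INR_fact_lt_0.
  change (INR (fact n + n * fact n)) with (INR (fact (S n))).
  unfold Rdiv. rewrite !Rabs_mult.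
  rewrite (Rabs_right (/ INR (fact (S n)))) by (apply Rle_ge, Rlt_le, Rinv_0_lt_compat, Hs).
  rewrite Rpow_mult_distr, <- !RPow_abs.
  replace (Rabs M * Rabs K ^ n * (Rabs T * Rabs T ^ n * / INR (fact (S n)))) with
    (Rabs M * Rabs T * (Rabs K ^ n * Rabs T ^ n * / INR (fact (S n)))) by ring.
  apply Rmult_le_compat_l; [apply Rmult_le_pos; apply Rabs_pos|].
  apply Rmult_le_compat_l; [apply Rmult_le_pos; apply pow_le, Rabs_pos|].
  apply Rinv_le_contravar; auto.
  apply le_INR. simpl. lia.
Qed.

Lemma sum_n_diff_telescope (u : nat -> R) (n : nat) :
  sum_n (fun k => u (S k) - u k) n = u (S n) - u O.
Proof.
  induction n as [|n IH].
  - now rewrite sum_O.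
  - rewrite sum_Sn, IH. unfold plus; simpl. ring.
Qed.

Lemma inv_INR_S_lim : is_lim_seq (fun k => / INR (S k)) 0.
Proof.
  apply is_lim_seq_incr_1 with (u := fun k => / INR k).
  replace (Finite 0) with (Rbar_inv p_infty) by reflexivity.
  apply is_lim_seq_inv; [apply is_lim_seq_INR|discriminate].
Qed.

Lemma dominated_limit (u b : nat -> R) :
  (forall n, Rabs (u (S n) - u n) <= b n) -> ex_series b ->
  exists l : R, is_lim_seq u l.
Proof.
  intros H Hb.
  assert (E : ex_series (fun n => u (S n) - u n)).
  { apply (ex_series_le (V := R_CompleteNormedModule) _ b); auto. }
  destruct E as [s Hs]. exists (s + u O).
  apply is_lim_seq_incr_1.
  apply is_lim_seq_ext with (fun n => sum_n (fun k => u (S k) - u k) n + u O).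
  - intros n. rewrite sum_n_diff_telescope. ring.
  - apply is_lim_seq_plus'; [exact Hs|apply is_lim_seq_const].
Qed.

(** The bound depends on the majorant [b] alone, hence is uniform over all sequences sharing it;
    this uniformity lets the limit pass under the integral in [picard_lindelof]. *)
Lemma dominated_limit_error (u b : nat -> R) (l : R) :
  (forall n, Rabs (u (S n) - u n) <= b n) -> ex_series b -> is_lim_seq u l ->
  forall n, Rabs (l - u (S n)) <= Series b - sum_n b n.
Proof.
  intros H Hb Hl n.
  assert (A : forall m, Rabs (u (S (m + n)) - u (S n)) <= sum_n b (m + n) - sum_n b n).
  { induction m as [|m IH].
    - simpl. rewrite !Rminus_diag, Rabs_R0. lra.
    - replace (S m + n)%nat with (S (m + n)) by lia. rewrite sum_Sn.
      unfold plus; simpl. specialize (H (S (m + n))).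
      replace (u (S (S (m + n))) - u (S n)) with
        ((u (S (S (m + n))) - u (S (m + n))) + (u (S (m + n)) - u (S n))) by ring.
      eapply Rle_trans; [apply Rabs_triang|lra]. }
  assert (L1 : is_lim_seq (fun m => Rabs (u (S (m + n)) - u (S n))) (Rabs (l - u (S n)))).
  { apply (is_lim_seq_abs _ (Finite (l - u (S n)))). apply is_lim_seq_minus'; [|apply is_lim_seq_const].
    apply is_lim_seq_ext with (fun m => u (m + S n)%nat).
    - intros m. f_equal. lia.
    - now apply is_lim_seq_incr_n. }
  assert (L2 : is_lim_seq (fun m => sum_n b (m + n) - sum_n b n) (Series b - sum_n b n)).
  { apply is_lim_seq_minus'; [|apply is_lim_seq_const].
    apply (is_lim_seq_incr_n (sum_n b) n). apply (Series_correct b Hb). }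
  exact (is_lim_seq_le _ _ (Finite _) (Finite _) A L1 L2).
Qed.

Lemma picard_lindelof (F : R -> R -> R) (M K y0 : R) :
  0 <= K ->
  (forall y, cont y -> cont (fun t => F t (y t))) ->
  (forall t y, Rabs (F t y) <= M) ->
  (forall t y z, Rabs (F t y - F t z) <= K * Rabs (y - z)) ->
  exists y : R -> R, y 0 = y0 /\ forall t, is_derive y t (F t (y t)).
Proof.
  intros HK Hc HM HL.
  assert (M0 : 0 <= M) by (apply Rle_trans with (2 := HM 0 0); apply Rabs_pos).
  set (p := picard F y0).
  (* [T] bounds the time: the majorant at [T = |t|] serves all times between [0] and [t]. *)
  set (b := fun T n => M * K ^ n * (T ^ S n / INR (fact (S n)))).
  assert (Hb : forall T, ex_series (b T)) by (intros; apply exp_majorant_series).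
  assert (Hstep : forall T t n, Rabs t <= T -> Rabs (p (S n) t - p n t) <= b T n).
  { intros T t n h. eapply Rle_trans; [now apply picard_step with (K := K) (M := M)|].
    unfold b. apply Rmult_le_compat_l; [apply Rmult_le_pos; auto; now apply pow_le|].
    apply Rmult_le_compat_r; [apply Rlt_le, Rinv_0_lt_compat, INR_fact_lt_0|].
    apply pow_incr. split; auto. apply Rabs_pos. }
  assert (Hex : forall t, exists l : R, is_lim_seq (fun n => p n t) l).
  { intros t. apply dominated_limit with (b (Rabs t)); auto.
    intros n. apply Hstep. lra. }
  set (y := fun t => real (Lim_seq (fun n => p n t))).
  assert (Hy : forall t, is_lim_seq (fun n => p n t) (y t)).
  { intros t. destruct (Hex t) as [l Hl]. unfold y.
    now rewrite (is_lim_seq_unique _ _ Hl). }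
  assert (Lip : forall s t, Rabs (y t - y s) <= M * Rabs (t - s)).
  { intros s t.
    refine (is_lim_seq_le (fun n => Rabs (p n t - p n s)) (fun _ => M * Rabs (t - s))
      (Finite (Rabs (y t - y s))) (Finite _) _ _ _).
    - intros n. now apply picard_lipschitz.
    - apply (is_lim_seq_abs _ (Finite (y t - y s))).
      apply is_lim_seq_minus'; apply Hy.
    - apply is_lim_seq_const. }
  assert (Cy : cont y).
  { intros t. apply continuity_pt_filterlim. intros eps He.
    exists (eps / (M + 1)). split; [apply Rdiv_lt_0_compat; lra|].
    intros x [_ Hx]. simpl in *. unfold Rdist in *.
    eapply Rle_lt_trans; [apply Lip|].
    apply Rle_lt_trans with (M * (eps / (M + 1))).
    - apply Rmult_le_compat_l; lra.
    - apply Rmult_lt_reg_r with (M + 1); [lra|].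
      replace (M * (eps / (M + 1)) * (M + 1)) with (M * eps) by (field; lra). nra. }
  assert (CF : cont (fun s => F s (y s))) by now apply (Hc y).
  exists y.
  assert (Fix : forall t, y t = y0 + RInt (fun s => F s (y s)) 0 t).
  { intros t.
    (* Iterate [n + 2] integrates [F] along iterate [n + 1], whose distance to [y] up to time [t] is
       at most the tail [e n]; the error is then at most [|t| K e n]. *)
    assert (L : is_lim_seq (fun n => p (S (S n)) t) (y0 + RInt (fun s => F s (y s)) 0 t)).
    { set (c := Rabs t * K).
      set (e := fun n => Series (b (Rabs t)) - sum_n (b (Rabs t)) n).
      assert (Le : is_lim_seq (fun n => c * e n) 0).
      { replace 0 with (c * 0) by ring. apply is_lim_seq_scal_l with (lu := Finite 0).
        unfold e. replace 0 with (Series (b (Rabs t)) - Series (b (Rabs t))) by ring.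
        apply is_lim_seq_minus'; [apply is_lim_seq_const|].
        apply (Series_correct _ (Hb (Rabs t))). }
      assert (D : forall n, Rabs (p (S (S n)) t - (y0 + RInt (fun s => F s (y s)) 0 t)) <= c * e n).
      { intros n.
        assert (CP : cont (fun s => F s (p (S n) s))) by (apply (Hc (p (S n))); now apply picard_cont).
        assert (B : Rabs (RInt (fun s => F s (p (S n) s)) 0 t - RInt (fun s => F s (y s)) 0 t
            - (RInt (fun s => F s (p (S n) s)) 0 0 - RInt (fun s => F s (y s)) 0 0))
          <= K * e n * Rabs (t - 0)).
        { apply (bounded_variation
            (fun v => RInt (fun s => F s (p (S n) s)) 0 v - RInt (fun s => F s (y s)) 0 v)
            (fun v => F v (p (S n) v) - F v (y v))).
          intros v Hv. rewrite !Rminus_0_r in Hv. split.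
          - apply (is_derive_minus (fun v => RInt (fun s => F s (p (S n) s)) 0 v)
              (fun v => RInt (fun s => F s (y s)) 0 v)).
            + now apply (cont_RInt_derive (fun s => F s (p (S n) s))).
            + now apply (cont_RInt_derive (fun s => F s (y s))).
          - eapply Rle_trans; [apply HL|]. apply Rmult_le_compat_l; auto.
            rewrite Rabs_minus_sym.
            apply (dominated_limit_error (fun n => p n v)); auto. }
        rewrite !RInt_point, Rminus_0_r in B. unfold zero in B; simpl in B.
        change (p (S (S n)) t) with (y0 + RInt (fun s => F s (p (S n) s)) 0 t).
        replace (y0 + RInt (fun s : R => F s (p (S n) s)) 0 t - (y0 + RInt (fun s : R => F s (y s)) 0 t))
          with (RInt (fun s : R => F s (p (S n) s)) 0 t - RInt (fun s : R => F s (y s)) 0 t - 0) by ring.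
        eapply Rle_trans; [exact B|]. rewrite (Rminus_0_r t). unfold c. right. ring. }
      apply is_lim_seq_ext with (fun n => (p (S (S n)) t - (y0 + RInt (fun s => F s (y s)) 0 t))
        + (y0 + RInt (fun s => F s (y s)) 0 t)).
      { intros n. ring. }
      replace (Finite (y0 + RInt (fun s => F s (y s)) 0 t)) with
        (Finite (0 + (y0 + RInt (fun s => F s (y s)) 0 t))) by (f_equal; ring).
      apply is_lim_seq_plus'; [|apply is_lim_seq_const].
      apply is_lim_seq_abs_0.
      apply is_lim_seq_le_le with (fun _ => 0) (fun n => c * e n); auto.
      - intros n. split; [apply Rabs_pos|apply D].
      - apply is_lim_seq_const. }
    assert (L2 : is_lim_seq (fun n => p (S (S n)) t) (y t)).
    { apply is_lim_seq_incr_1 with (u := fun n => p (S n) t).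
      apply is_lim_seq_incr_1 with (u := fun n => p n t). apply Hy. }
    apply is_lim_seq_unique in L. apply is_lim_seq_unique in L2.
    rewrite L in L2. now injection L2. }
  split.
  - rewrite Fix, RInt_point. unfold zero; simpl. ring.
  - intros t. apply is_derive_ext with (fun t => y0 + RInt (fun s => F s (y s)) 0 t).
    + intros s. symmetry. apply Fix.
    + replace (F t (y t)) with (0 + F t (y t)) by ring.
      apply (is_derive_plus (fun _ => y0)).
      * apply (is_derive_const y0 t).
      * now apply (cont_RInt_derive (fun s => F s (y s))).
Qed.

(** * The linear system *)

Lemma is_derive_eq (f : R -> R) (t l l' : R) : is_derive f t l -> l = l' -> is_derive f t l'.
Proof. now intros H <-. Qed.

Lemma D_plus (f g : R -> R) (t df dg : R) :
  is_derive f t df -> is_derive g t dg -> is_derive (fun t => f t + g t) t (df + dg).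
Proof. apply (is_derive_plus f g). Qed.

Lemma D_minus (f g : R -> R) (t df dg : R) :
  is_derive f t df -> is_derive g t dg -> is_derive (fun t => f t - g t) t (df - dg).
Proof. apply (is_derive_minus f g). Qed.

Lemma D_mult (f g : R -> R) (t df dg : R) :
  is_derive f t df -> is_derive g t dg ->
  is_derive (fun t => f t * g t) t (df * g t + f t * dg).
Proof. apply (Derive.is_derive_mult f g). Qed.

Lemma D_opp (f : R -> R) (t df : R) :
  is_derive f t df -> is_derive (fun t => - f t) t (- df).
Proof. apply (is_derive_opp f). Qed.

Lemma D_const (k t : R) : is_derive (fun _ => k) t 0.
Proof. apply (is_derive_const k t). Qed.

Lemma D_id (t : R) : is_derive (fun t => t) t 1.
Proof. apply (is_derive_id t). Qed.

Lemma D_comp (h f : R -> R) (t df dh : R) :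
  is_derive h (f t) dh -> is_derive f t df -> is_derive (fun t => h (f t)) t (df * dh).
Proof. apply (is_derive_comp h f). Qed.

(** The derivative is synthesised as an evar, abstract functions being handled by hypotheses of the
    context; [derive_tac] then leaves an algebraic identity. *)
Ltac derive_rec :=
  lazymatch goal with
  | |- is_derive (fun _ => ?k) _ _ => apply D_const
  | |- is_derive (fun t => t) _ _ => apply D_id
  | |- is_derive (fun t => @?f t + @?g t) _ _ => apply (D_plus f g); derive_rec
  | |- is_derive (fun t => @?f t - @?g t) _ _ => apply (D_minus f g); derive_rec
  | |- is_derive (fun t => @?f t * @?g t) _ _ => apply (D_mult f g); derive_rec
  | |- is_derive (fun t => @?f t / ?k) _ _ => apply (D_mult f (fun _ => / k)); derive_rec
  | |- is_derive (fun t => - @?f t) _ _ => apply (D_opp f); derive_rec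
  | |- is_derive (fun t => sin (@?f t)) _ _ =>
      apply (D_comp sin f); [apply is_derive_sin | derive_rec]
  | |- is_derive (fun t => cos (@?f t)) _ _ =>
      apply (D_comp cos f); [apply is_derive_cos | derive_rec]
  | |- is_derive (fun t => exp (@?f t)) _ _ =>
      apply (D_comp exp f); [apply is_derive_exp | derive_rec]
  | |- is_derive (fun t => ?f t) _ _ => eauto
  | |- is_derive (fun t => ?f (@?g t)) _ _ => apply (D_comp f g); [eauto | derive_rec]
  | |- is_derive _ _ _ => eauto
  end.
Ltac derive_tac := eapply is_derive_eq; [derive_rec | ].

(** The matrix [[[a, -c], [c, -a]]] is trace-free, and the polar angle of a solution satisfies
    [theta' = c - a sin (2 theta)]; doubling the angle gives [phase_sol]. *)
Definition lin_sol (a : R) (c x y : R -> R) : Prop :=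
  forall t, is_derive x t (a * x t - c t * y t) /\ is_derive y t (c t * x t - a * y t).

Definition phase_sol (a : R) (c phi : R -> R) : Prop :=
  forall t, is_derive phi t (2 * c t - 2 * a * sin (phi t)).

Lemma lin_sol_comb (a : R) (c x1 y1 x2 y2 : R -> R) (p q : R) :
  lin_sol a c x1 y1 -> lin_sol a c x2 y2 ->
  lin_sol a c (fun t => p * x1 t + q * x2 t) (fun t => p * y1 t + q * y2 t).
Proof.
  intros H1 H2 t. destruct (H1 t) as [A1 B1], (H2 t) as [A2 B2].
  split; derive_tac; ring.
Qed.

Lemma lin_sol_shift (a T : R) (c x y : R -> R) :
  (forall t, c (t + T) = c t) -> lin_sol a c x y ->
  lin_sol a c (fun t => x (t + T)) (fun t => y (t + T)).
Proof.
  intros Hc H t. destruct (H (t + T)) as [A B].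
  split; derive_tac; rewrite Hc; ring.
Qed.

Lemma wronskian_const (a : R) (c x1 y1 x2 y2 : R -> R) :
  lin_sol a c x1 y1 -> lin_sol a c x2 y2 ->
  forall s t, x1 s * y2 s - y1 s * x2 s = x1 t * y2 t - y1 t * x2 t.
Proof.
  intros H1 H2. apply (derive_zero_const (fun t => x1 t * y2 t - y1 t * x2 t)).
  intros t. destruct (H1 t) as [A1 B1], (H2 t) as [A2 B2].
  derive_tac. ring.
Qed.

(** The modulus has to satisfy [rho' = a cos (phi) rho], which a single integration solves. *)
Lemma phase_to_lin (a : R) (c phi : R -> R) :
  phase_sol a c phi ->
  exists rho : R -> R, (forall t, 0 < rho t) /\ rho 0 = 1 /\
    lin_sol a c (fun t => rho t * cos (phi t / 2)) (fun t => rho t * sin (phi t / 2)).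
Proof.
  intros H.
  assert (Cphi : cont phi) by apply (cont_of_derive _ _ H).
  set (g := fun t => a * cos (phi t)).
  assert (Cg : cont g) by (unfold g; cont_tac).
  assert (Dg := cont_RInt_derive g 0 Cg).
  set (I := fun t => RInt g 0 t) in Dg.
  exists (fun t => exp (I t)). split; [|split].
  - intros t. apply exp_pos.
  - unfold I. rewrite RInt_point. apply exp_0.
  - intros t. assert (Ht := H t). assert (It := Dg t).
    set (th := phi t / 2).
    assert (E : phi t = 2 * th) by (unfold th; field).
    (* Since [phi - th = th] for the half angle [th], the subtraction formulas bring in the terms in
       [phi] that the derivatives contain. *)
    assert (C1 : cos th = cos (phi t) * cos th + sin (phi t) * sin th).
    { rewrite <- cos_minus. f_equal. lra. }
    assert (C2 : sin th = sin (phi t) * cos th - cos (phi t) * sin th).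
    { rewrite <- sin_minus. f_equal. lra. }
    split; derive_tac; fold th; unfold g.
    + replace (a * (exp (I t) * cos th)) with
        (a * (exp (I t) * (cos (phi t) * cos th + sin (phi t) * sin th))) by now rewrite <- C1.
      change (phi t * / 2) with th. field.
    + replace (a * (exp (I t) * sin th)) with
        (a * (exp (I t) * (sin (phi t) * cos th - cos (phi t) * sin th))) by now rewrite <- C2.
      change (phi t * / 2) with th. field.
Qed.

Lemma phase_sol_exists (a M phi0 : R) (c : R -> R) :
  cont c -> (forall t, Rabs (c t) <= M) ->
  exists phi, phi 0 = phi0 /\ phase_sol a c phi.
Proof.
  intros Cc Bc.
  destruct (picard_lindelof (fun t y => 2 * c t - 2 * a * sin y)
    (2 * M + 2 * Rabs a) (2 * Rabs a) phi0) as [phi [E H]].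
  - generalize (Rabs_pos a). lra.
  - intros y Cy. cont_tac.
  - intros t y. unfold Rminus. eapply Rle_trans; [apply Rabs_triang|].
    rewrite Rabs_Ropp, !Rabs_mult, (Rabs_right 2) by lra.
    assert (Rabs (sin y) <= 1) by (apply Rabs_le; generalize (SIN_bound y); lra).
    specialize (Bc t). generalize (Rabs_pos a). nra.
  - intros t y z.
    replace (2 * c t - 2 * a * sin y - (2 * c t - 2 * a * sin z)) with
      (- (2 * a * (sin y - sin z))) by ring.
    rewrite Rabs_Ropp, !Rabs_mult, (Rabs_right 2) by lra.
    apply Rmult_le_compat_l; [generalize (Rabs_pos a); lra|].
    rewrite <- (Rmult_1_l (Rabs (y - z))).
    apply (bounded_variation sin cos). intros u _. split; [apply is_derive_sin|].
    apply Rabs_le. generalize (COS_bound u). lra.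
  - now exists phi.
Qed.

Definition fundamental (a : R) (c x1 y1 x2 y2 : R -> R) : Prop :=
  (lin_sol a c x1 y1 /\ x1 0 = 1 /\ y1 0 = 0) /\
  (lin_sol a c x2 y2 /\ x2 0 = 0 /\ y2 0 = 1).

(** Phases starting at [0] and [PI] have half angles [0] and [PI / 2], which are the two basis
    vectors. *)
Lemma fundamental_exists (a M : R) (c : R -> R) :
  cont c -> (forall t, Rabs (c t) <= M) ->
  exists x1 y1 x2 y2, fundamental a c x1 y1 x2 y2.
Proof.
  intros Cc Bc.
  destruct (phase_sol_exists a M 0 c Cc Bc) as [f [f0 Hf]].
  destruct (phase_sol_exists a M PI c Cc Bc) as [g [g0 Hg]].
  destruct (phase_to_lin a c f Hf) as [p [_ [p0 Lp]]].
  destruct (phase_to_lin a c g Hg) as [q [_ [q0 Lq]]].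
  do 4 eexists. split; [split; [exact Lp|]|split; [exact Lq|]]; cbv beta.
  - rewrite p0, f0. replace (0 / 2) with 0 by field. rewrite cos_0, sin_0. lra.
  - rewrite q0, g0, cos_PI2, sin_PI2. lra.
Qed.

Lemma fundamental_det (a : R) (c x1 y1 x2 y2 : R -> R) :
  fundamental a c x1 y1 x2 y2 -> forall t, x1 t * y2 t - y1 t * x2 t = 1.
Proof.
  intros [[H1 [A B]] [H2 [C D]]] t.
  rewrite (wronskian_const a c x1 y1 x2 y2 H1 H2 t 0), A, B, C, D. ring.
Qed.

(** Cramer's rule with constant Wronskians recovers the coordinates. This is uniqueness for the
    linear system, obtained without a Gronwall estimate. *)
Lemma fundamental_decomp (a : R) (c x1 y1 x2 y2 x y : R -> R) :
  fundamental a c x1 y1 x2 y2 -> lin_sol a c x y ->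
  forall t, x t = x 0 * x1 t + y 0 * x2 t /\ y t = x 0 * y1 t + y 0 * y2 t.
Proof.
  intros HF H t. assert (D := fundamental_det _ _ _ _ _ _ HF t).
  destruct HF as [[H1 [A1 B1]] [H2 [A2 B2]]].
  assert (W2 := wronskian_const a c x y x2 y2 H H2 t 0).
  assert (W1 := wronskian_const a c x1 y1 x y H1 H t 0).
  rewrite A1, B1 in W1. rewrite A2, B2 in W2.
  assert (E2 : x 0 = x t * y2 t - y t * x2 t) by lra.
  assert (E1 : y 0 = x1 t * y t - y1 t * x t) by lra.
  rewrite E1, E2. split.
  - transitivity (x t * (x1 t * y2 t - y1 t * x2 t)); [rewrite D|]; ring.
  - transitivity (y t * (x1 t * y2 t - y1 t * x2 t)); [rewrite D|]; ring.
Qed.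

(* Cayley-Hamilton for the monodromy over one period, which has determinant 1. *)
Lemma period_recurrence (a T : R) (c x1 y1 x2 y2 x y : R -> R) :
  (forall t, c (t + T) = c t) ->
  fundamental a c x1 y1 x2 y2 -> lin_sol a c x y ->
  forall t, x (t + 2 * T) = (x1 T + y2 T) * x (t + T) - x t /\
            y (t + 2 * T) = (x1 T + y2 T) * y (t + T) - y t.
Proof.
  intros Hc HF H t. assert (D := fundamental_det _ _ _ _ _ _ HF T).
  assert (HF' := HF). destruct HF' as [[H1 _] [H2 _]].
  assert (S := lin_sol_shift a T c x y Hc H).
  assert (S1 := lin_sol_shift a T c x1 y1 Hc H1).
  assert (S2 := lin_sol_shift a T c x2 y2 Hc H2).
  destruct (fundamental_decomp _ _ _ _ _ _ _ _ HF S (t + T)) as [X2 Y2].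
  destruct (fundamental_decomp _ _ _ _ _ _ _ _ HF S t) as [X1 Y1].
  destruct (fundamental_decomp _ _ _ _ _ _ _ _ HF S1 t) as [U1 V1].
  destruct (fundamental_decomp _ _ _ _ _ _ _ _ HF S2 t) as [U2 V2].
  destruct (fundamental_decomp _ _ _ _ _ _ _ _ HF H t) as [X0 Y0].
  destruct (fundamental_decomp _ _ _ _ _ _ _ _ HF H T) as [XT YT].
  simpl in *. rewrite !Rplus_0_l in *.
  replace (t + 2 * T) with (t + T + T) by ring.
  rewrite X2, Y2, X1, Y1, U1, V1, U2, V2, X0, Y0, XT, YT.
  split.
  - transitivity ((x1 T + y2 T) *
     ((x 0 * x1 T + y 0 * x2 T) * x1 t + (x 0 * y1 T + y 0 * y2 T) * x2 t) -
     (x1 T * y2 T - y1 T * x2 T) * (x 0 * x1 t + y 0 * x2 t)); [|rewrite D]; ring.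
  - transitivity ((x1 T + y2 T) *
     ((x 0 * x1 T + y 0 * x2 T) * y1 t + (x 0 * y1 T + y 0 * y2 T) * y2 t) -
     (x1 T * y2 T - y1 T * x2 T) * (x 0 * y1 t + y 0 * y2 t)); [|rewrite D]; ring.
Qed.

(** * Rotation numbers *)

Lemma floor_exists (x : R) : exists n : Z, IZR n <= x < IZR n + 1.
Proof.
  exists (up x - 1)%Z. rewrite minus_IZR. destruct (archimed x). lra.
Qed.

Lemma sin_IZR_PI (n : Z) : sin (IZR n * PI) = 0.
Proof. apply sin_eq_0_1. now exists n. Qed.

Lemma cos_IZR_PI_succ (n : Z) : cos ((IZR n + 1) * PI) = - cos (IZR n * PI).
Proof.
  replace ((IZR n + 1) * PI) with (IZR n * PI + PI) by ring. apply neg_cos.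
Qed.

Lemma cos_plus_2kPI (x : R) (m : Z) : cos (x + 2 * IZR m * PI) = cos x.
Proof.
  replace (2 * IZR m * PI) with (2 * (IZR m * PI)) by ring.
  rewrite cos_plus, cos_2a_sin, sin_2a, sin_IZR_PI. ring.
Qed.

(** The factor [cos (IZR n * PI)] stands for the sign [(-1)^n] and avoids case splits on parity. *)
Lemma sin_sign_between (x : R) (n : Z) :
  IZR n * PI < x < (IZR n + 1) * PI -> 0 < sin x * cos (IZR n * PI).
Proof.
  intros H. replace (sin x * cos (IZR n * PI)) with (sin (x - IZR n * PI)).
  - apply sin_gt_0; lra.
  - rewrite sin_minus, sin_IZR_PI. ring.
Qed.

Lemma sin_neq_0_between (x : R) :
  sin x <> 0 -> exists n : Z, IZR n * PI < x < (IZR n + 1) * PI.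
Proof.
  intros H. assert (P := PI_RGT_0). destruct (floor_exists (x / PI)) as [n Hn].
  exists n. assert (E : x = x / PI * PI) by (field; lra).
  split; [|rewrite E; apply Rmult_lt_compat_r; lra].
  destruct (Req_dec (IZR n) (x / PI)) as [h|h].
  - exfalso. apply H. rewrite E, <- h. apply sin_IZR_PI.
  - rewrite E. apply Rmult_lt_compat_r; lra.
Qed.

Lemma cont_IVT (g : R -> R) (s t y : R) :
  cont g -> Rmin (g s) (g t) <= y <= Rmax (g s) (g t) -> exists x, g x = y.
Proof.
  intros Hg H. destruct (IVT_gen_consistent g s t y Hg H) as [x [_ E]]. now exists x.
Qed.

Lemma sin_neq_0_confined (g : R -> R) :
  cont g -> (forall t, sin (g t) <> 0) ->
  exists n : Z, forall t, IZR n * PI < g t < (IZR n + 1) * PI.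
Proof.
  intros Hg H. destruct (sin_neq_0_between (g 0) (H 0)) as [n Hn].
  exists n. intros t.
  assert (N : forall k : Z, ~ Rmin (g 0) (g t) <= IZR k * PI <= Rmax (g 0) (g t)).
  { intros k Hk. destruct (cont_IVT g 0 t _ Hg Hk) as [x Hx].
    apply (H x). rewrite Hx. apply sin_IZR_PI. }
  generalize (N n) (N (n + 1)%Z). rewrite plus_IZR. intros N1 N2.
  split; apply Rnot_le_lt; intros C.
  - apply N1. rewrite Rmin_right, Rmax_left; lra.
  - apply N2. rewrite Rmin_left, Rmax_right; lra.
Qed.

Lemma sin_eq_0_const (g : R -> R) :
  cont g -> (forall t, sin (g t) = 0) -> exists n : Z, forall t, g t = IZR n * PI.
Proof.
  intros Hg H. assert (P := PI_RGT_0).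
  destruct (sin_eq_0_0 (g 0) (H 0)) as [n Hn].
  exists n. intros t.
  assert (N : forall (k : Z) y, Rmin (g 0) (g t) <= y <= Rmax (g 0) (g t) ->
    ~ IZR k * PI < y < (IZR k + 1) * PI).
  { intros k y Hy Hk. destruct (cont_IVT g 0 t _ Hg Hy) as [x Hx].
    apply sin_sign_between in Hk. rewrite <- Hx, H in Hk. lra. }
  destruct (Rtotal_order (g t) (IZR n * PI)) as [h|[h|h]]; auto; exfalso.
  (* [y] lies between [g t] and [g 0] and at most [PI / 2] below [g 0], hence strictly inside an
     interval between consecutive multiples of [PI], where the sine has no zero. *)
  - set (y := Rmax (g t) (IZR n * PI - PI / 2)).
    assert (y <= IZR n * PI - PI / 2 \/ y = g t) by
      (unfold y, Rmax; destruct (Rle_dec _ _); auto; lra).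
    assert (g t <= y) by apply Rmax_l. assert (IZR n * PI - PI / 2 <= y) by apply Rmax_r.
    apply (N (n - 1)%Z y).
    + rewrite Rmin_right, Rmax_left; lra.
    + rewrite minus_IZR. lra.
  - set (y := Rmin (g t) (IZR n * PI + PI / 2)).
    assert (IZR n * PI + PI / 2 <= y \/ y = g t) by
      (unfold y, Rmin; destruct (Rle_dec _ _); auto; lra).
    assert (y <= g t) by apply Rmin_l. assert (y <= IZR n * PI + PI / 2) by apply Rmin_r.
    apply (N n y).
    + rewrite Rmin_left, Rmax_right; lra.
    + lra.
Qed.

(** A window of length [2 PI] consists of two intervals on which the sine has opposite signs,
    separated by a zero; sines of the same sign can only come from the same one of these three
    places. *)
Lemma sin_sign_same_piece (u v p : R) (q : Z) :
  0 < p -> sin u = p * sin v ->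
  IZR q * PI < u < (IZR q + 2) * PI -> IZR q * PI < v < (IZR q + 2) * PI ->
  exists k : Z, (IZR k * PI < u < (IZR k + 1) * PI /\ IZR k * PI < v < (IZR k + 1) * PI)
    \/ (u = IZR k * PI /\ v = IZR k * PI).
Proof.
  intros Hp E Hu Hv.
  assert (S1 := sin_sign_between u q). assert (S2 := sin_sign_between v q).
  assert (T1 := sin_sign_between u (q + 1)). assert (T2 := sin_sign_between v (q + 1)).
  rewrite plus_IZR, cos_IZR_PI_succ in T1, T2.
  assert (Z : forall x, x = (IZR q + 1) * PI -> sin x = 0).
  { intros x ->. rewrite <- plus_IZR. apply sin_IZR_PI. }
  assert (Zu := Z u). assert (Zv := Z v). clear Z.
  set (c := cos (IZR q * PI)) in *.
  assert (E' : sin u * c = p * (sin v * c)) by (rewrite E; ring).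
  assert (Q1 : (IZR q + 1 + 1) * PI = (IZR q + 2) * PI) by ring.
  rewrite Q1 in T1, T2.
  destruct (Rtotal_order u ((IZR q + 1) * PI)) as [a|[a|a]];
  destruct (Rtotal_order v ((IZR q + 1) * PI)) as [b|[b|b]].
  - exists q. left. lra.
  - exfalso. rewrite (Zv b) in E'. assert (0 < sin u * c) by (apply S1; lra). lra.
  - exfalso. assert (0 < sin u * c) by (apply S1; lra).
    assert (0 < sin v * - c) by (apply T2; lra). nra.
  - exfalso. rewrite (Zu a) in E'. assert (0 < sin v * c) by (apply S2; lra). nra.
  - exists (q + 1)%Z. right. rewrite plus_IZR. lra.
  - exfalso. rewrite (Zu a) in E'. assert (0 < sin v * - c) by (apply T2; lra). nra.
  - exfalso. assert (0 < sin v * c) by (apply S2; lra).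
    assert (0 < sin u * - c) by (apply T1; lra). nra.
  - exfalso. rewrite (Zv b) in E'. assert (0 < sin u * - c) by (apply T1; lra). lra.
  - exists (q + 1)%Z. left. rewrite plus_IZR. lra.
Qed.

(* The integer parts of [u k / PI] and [v k / PI] can only differ by one after a
   step, and then the signs of the sines would disagree. *)
Lemma angle_tracking (u v : nat -> R) (n : Z) :
  u O = 0 -> v O = 0 ->
  (forall k, IZR n * PI < u (S k) - u k < (IZR n + 1) * PI) ->
  (forall k, IZR n * PI < v (S k) - v k < (IZR n + 1) * PI) ->
  (forall k, exists p, 0 < p /\ sin (u k) = p * sin (v k)) ->
  forall k, Rabs (u k - v k) <= PI.
Proof.
  intros u0 v0 Hu Hv Hs k. assert (P := PI_RGT_0).
  assert (I : exists q : Z,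
    (IZR q * PI < u k < (IZR q + 1) * PI /\ IZR q * PI < v k < (IZR q + 1) * PI)
    \/ (u k = IZR q * PI /\ v k = IZR q * PI)).
  { induction k as [|k [q IH]].
    - exists 0%Z. right. lra.
    - destruct (Hs (S k)) as [p [Hp E]]. specialize (Hu k). specialize (Hv k).
      apply (sin_sign_same_piece _ _ p (q + n)); auto; rewrite plus_IZR; lra. }
  destruct I as [q [I|I]]; apply Rabs_le; lra.
Qed.

(** Translation by [2 PI] keeps the parity of the interval index, while [al -> - al] sends index [j]
    to [- j - 1] and changes it; so one of the two signs can reach index [n]. *)
Lemma angle_representative (al : R) (n : Z) :
  sin al <> 0 ->
  exists (be : R) (m : Z), (be = al + 2 * IZR m * PI \/ be = - al + 2 * IZR m * PI) /\
    IZR n * PI < be < (IZR n + 1) * PI.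
Proof.
  intros H. destruct (sin_neq_0_between al H) as [j Hj].
  destruct (Z.Even_or_Odd (n - j)) as [[m Hm]|[m Hm]].
  - exists (al + 2 * IZR m * PI), m. split; auto.
    assert (E : IZR n = IZR j + 2 * IZR m).
    { rewrite <- mult_IZR, <- plus_IZR. f_equal. lia. }
    rewrite E. lra.
  - exists (- al + 2 * IZR (j + m + 1) * PI), (j + m + 1)%Z. split; auto.
    assert (E : IZR n = IZR j + (2 * IZR m + 1)).
    { rewrite <- mult_IZR, <- !plus_IZR. f_equal. lia. }
    rewrite E, !plus_IZR. lra.
Qed.

Lemma slope_limit (u : nat -> R) (v C : R) :
  (forall k, Rabs (u k - INR k * v) <= C) ->
  is_lim_seq (fun k => u k / INR k) v.
Proof.
  intros H. apply is_lim_seq_incr_1.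
  apply is_lim_seq_ext with (fun k => (u (S k) - INR (S k) * v) / INR (S k) + v).
  { intros k. field. apply not_0_INR. lia. }
  replace (Finite v) with (Finite (0 + v)) by (f_equal; ring).
  apply is_lim_seq_plus'; [|apply is_lim_seq_const].
  apply is_lim_seq_abs_0.
  apply is_lim_seq_le_le with (fun _ => 0) (fun k => C * / INR (S k)).
  - intros k. split; [apply Rabs_pos|].
    assert (0 < / INR (S k)) by (apply Rinv_0_lt_compat, lt_0_INR; lia).
    unfold Rdiv. rewrite Rabs_mult, (Rabs_right (/ _)) by lra.
    apply Rmult_le_compat_r; [lra|apply H].
  - apply is_lim_seq_const.
  - replace (Finite 0) with (Rbar_mult C 0) by (simpl; f_equal; ring).
    apply is_lim_seq_scal_l, inv_INR_S_lim.
Qed.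

Definition rot_lim (phi : R -> R) (v : R) : Prop :=
  is_lim_seq (fun k : nat => phi (2 * PI * INR k) / (2 * PI * INR k)) v.

Lemma rot_lim_of_bound (phi : R -> R) (v C : R) :
  (forall k, Rabs (phi (2 * PI * INR k) - 2 * PI * INR k * v) <= C) -> rot_lim phi v.
Proof.
  intros H. unfold rot_lim. assert (P := PI_RGT_0).
  apply is_lim_seq_ext with (fun k => phi (2 * PI * INR k) / (2 * PI) / INR k).
  { intros k. unfold Rdiv. rewrite !Rinv_mult. ring. }
  apply slope_limit with (C / (2 * PI)). intros k.
  replace (phi (2 * PI * INR k) / (2 * PI) - INR k * v) with
    ((phi (2 * PI * INR k) - 2 * PI * INR k * v) / (2 * PI)) by (field; lra).
  unfold Rdiv. rewrite Rabs_mult, (Rabs_right (/ _)).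
  - apply Rmult_le_compat_r; auto. apply Rlt_le, Rinv_0_lt_compat. lra.
  - apply Rle_ge, Rlt_le, Rinv_0_lt_compat. lra.
Qed.

Lemma rot_lim_close (phi psi : R -> R) (v C : R) :
  (forall t, Rabs (phi t - psi t) <= C) -> rot_lim phi v -> rot_lim psi v.
Proof.
  intros H L.
  assert (D : rot_lim (fun t => psi t - phi t) 0).
  { apply rot_lim_of_bound with C. intros k.
    rewrite Rmult_0_r, Rminus_0_r, Rabs_minus_sym. apply H. }
  unfold rot_lim in *. replace v with (0 + v) by ring.
  apply is_lim_seq_ext with (fun k =>
    (psi (2 * PI * INR k) - phi (2 * PI * INR k)) / (2 * PI * INR k)
    + phi (2 * PI * INR k) / (2 * PI * INR k)).
  { intros k. unfold Rdiv. ring. }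
  now apply is_lim_seq_plus'.
Qed.

(** The Wronskian of the two linear lifts is constant and equals the product of the moduli times
    [sin ((psi - phi) / 2)]. If it is zero, the half difference is a constant multiple of [PI];
    otherwise it is trapped between two consecutive multiples. *)
Lemma phase_sols_close (a : R) (c phi psi : R -> R) :
  phase_sol a c phi -> phase_sol a c psi ->
  exists C, forall t, Rabs (phi t - psi t) <= C.
Proof.
  intros H1 H2.
  assert (C1 := cont_of_derive _ _ H1). assert (C2 := cont_of_derive _ _ H2).
  destruct (phase_to_lin a c phi H1) as [p [p0 [_ L1]]].
  destruct (phase_to_lin a c psi H2) as [q [q0 [_ L2]]].
  assert (W := wronskian_const a c _ _ _ _ L1 L2). cbv beta in W.
  set (g := fun t => psi t / 2 - phi t / 2).
  assert (Cg : cont g) by (unfold g; cont_tac).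
  set (w := p 0 * q 0 * sin (g 0)).
  assert (Hw : forall t, p t * q t * sin (g t) = w).
  { intros t. unfold w, g. rewrite !sin_minus.
    specialize (W t 0). lra. }
  assert (pq : forall t, 0 < p t * q t) by (intros; apply Rmult_lt_0_compat; auto).
  destruct (Req_dec w 0) as [h|h].
  - destruct (sin_eq_0_const g Cg) as [n Hn].
    + intros t. specialize (Hw t). rewrite h in Hw.
      apply Rmult_integral in Hw. specialize (pq t). destruct Hw; lra.
    + exists (Rabs (2 * (IZR n * PI))). intros t. right.
      rewrite <- (Hn t), <- Rabs_Ropp. f_equal. unfold g. field.
  - destruct (sin_neq_0_confined g Cg) as [n Hn].
    + intros t E. apply h. rewrite <- (Hw t), E. ring.
    + exists (2 * (Rabs (IZR n * PI) + PI)). intros t. specialize (Hn t).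
      assert (P := PI_RGT_0).
      assert (X : phi t - psi t = - (2 * g t)) by (unfold g; field).
      rewrite X. generalize (Rle_abs (IZR n * PI)) (Rle_abs (- (IZR n * PI))).
      rewrite Rabs_Ropp. intros. apply Rabs_le. lra.
Qed.

Lemma rot_lim_transfer (a v : R) (c phi psi : R -> R) :
  phase_sol a c phi -> phase_sol a c psi -> rot_lim phi v -> rot_lim psi v.
Proof.
  intros H1 H2. destruct (phase_sols_close a c phi psi H1 H2) as [C HC].
  now apply rot_lim_close with C.
Qed.

Lemma rot_lim_unique (phi : R -> R) (v w : R) : rot_lim phi v -> rot_lim phi w -> v = w.
Proof.
  intros H1 H2. apply is_lim_seq_unique in H1, H2. rewrite H1 in H2. now injection H2.
Qed.

(** The solution is compared with its translate by one period. Their Wronskian [de] is a nonzero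
    constant, so the half-angle gain [g] over a period stays in one interval [(n PI, (n + 1) PI)];
    the representative of [+-al] in that same interval is the mean gain. *)
Lemma rot_elliptic (a al : R) (c x1 y1 x2 y2 phi : R -> R) :
  (forall t, c (t + 2 * PI) = c t) -> fundamental a c x1 y1 x2 y2 ->
  x1 (2 * PI) + y2 (2 * PI) = 2 * cos al -> sin al <> 0 -> phase_sol a c phi ->
  exists (be : R) (m : Z), (be = al + 2 * IZR m * PI \/ be = - al + 2 * IZR m * PI) /\
    rot_lim phi (be / PI).
Proof.
  intros Hc HF HT Hal H. assert (P := PI_RGT_0).
  assert (Cphi := cont_of_derive _ _ H).
  destruct (phase_to_lin a c phi H) as [p [p0 [_ L]]].
  set (x := fun t => p t * cos (phi t / 2)) in L.
  set (y := fun t => p t * sin (phi t / 2)) in L.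
  set (T := 2 * PI) in *.
  assert (LS := lin_sol_shift a T c x y Hc L).
  assert (W := wronskian_const a c _ _ _ _ L LS). cbv beta in W.
  assert (Rec := period_recurrence a T c _ _ _ _ x y Hc HF L).
  assert (Wsin : forall s t, x s * y t - y s * x t = p s * p t * sin (phi t / 2 - phi s / 2)).
  { intros s t. unfold x, y. rewrite sin_minus. ring. }
  set (de := x 0 * y (0 + T) - y 0 * x (0 + T)).
  assert (Hde : de <> 0).
  (* If [de = 0], the initial vector is an eigenvector with a real eigenvalue [ka], a root of
     [X^2 - 2 cos al X + 1]; but this equals [(X - cos al)^2 + (sin al)^2 > 0]. *)
  { intros E.
    assert (N : 0 < x 0 ^ 2 + y 0 ^ 2).
    { unfold x, y. assert (S := sin2_cos2 (phi 0 / 2)). unfold Rsqr in S.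
      replace (_ + _) with (p 0 ^ 2 * (sin (phi 0 / 2) * sin (phi 0 / 2)
        + cos (phi 0 / 2) * cos (phi 0 / 2))) by ring.
      rewrite S, Rmult_1_r. apply pow_lt, p0. }
    set (ka := (x 0 * x (0 + T) + y 0 * y (0 + T)) / (x 0 ^ 2 + y 0 ^ 2)).
    assert (E' : x 0 * y (0 + T) = y 0 * x (0 + T)) by (unfold de in E; lra).
    assert (KX : x (0 + T) = ka * x 0).
    { apply Rmult_eq_reg_r with (x 0 ^ 2 + y 0 ^ 2); [|lra].
      transitivity (x 0 * x 0 * x (0 + T) + y 0 * (y 0 * x (0 + T))); [ring|].
      rewrite <- E'. unfold ka. field. lra. }
    assert (KY : y (0 + T) = ka * y 0).
    { apply Rmult_eq_reg_r with (x 0 ^ 2 + y 0 ^ 2); [|lra].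
      transitivity (y 0 * y 0 * y (0 + T) + x 0 * (x 0 * y (0 + T))); [ring|].
      rewrite E'. unfold ka. field. lra. }
    assert (K : forall t, x (t + T) = ka * x t /\ y (t + T) = ka * y t).
    { intros t.
      destruct (fundamental_decomp _ _ _ _ _ _ _ _ HF LS t) as [A B].
      destruct (fundamental_decomp _ _ _ _ _ _ _ _ HF L t) as [A' B'].
      cbv beta in A, B. rewrite A, B, A', B', KX, KY. split; ring. }
    destruct (Rec 0) as [RX RY]. rewrite HT in RX, RY.
    replace (0 + 2 * T) with (0 + T + T) in RX, RY by ring.
    rewrite (proj1 (K (0 + T))), KX in RX.
    rewrite (proj2 (K (0 + T))), KY in RY.
    assert (Q : (ka ^ 2 - 2 * cos al * ka + 1) * (x 0 ^ 2 + y 0 ^ 2) = 0).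
    { transitivity (x 0 * (ka * (ka * x 0) - (2 * cos al * (ka * x 0) - x 0)) +
                    y 0 * (ka * (ka * y 0) - (2 * cos al * (ka * y 0) - y 0))); [ring|].
      rewrite RX, RY. ring. }
    apply Rmult_integral in Q. destruct Q as [Q|Q]; [|lra].
    assert (S := sin2_cos2 al). unfold Rsqr in S.
    assert (S2 : 0 < sin al * sin al) by exact (Rsqr_pos_lt _ Hal).
    rewrite <- S in Q. generalize (pow2_ge_0 (ka - cos al)). lra. }
  set (g := fun t => phi (t + T) / 2 - phi t / 2).
  assert (Cg : cont g) by (unfold g; cont_tac).
  assert (Hg : forall t, p t * p (t + T) * sin (g t) = de).
  { intros t. unfold g. rewrite <- Wsin. unfold de. apply W. }
  destruct (sin_neq_0_confined g Cg) as [n Hn].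
  { intros t E. apply Hde. rewrite <- (Hg t), E. ring. }
  destruct (angle_representative al n Hal) as [be [m [Hbe Rbe]]].
  exists be, m. split; auto.
  assert (Cbe : cos be = cos al).
  { destruct Hbe as [-> | ->]; rewrite cos_plus_2kPI; auto. apply cos_neg. }
  set (th := fun k : nat => phi (T * INR k) / 2 - phi (T * INR 0) / 2).
  (* Both sides satisfy [w (k + 2) = 2 cos be w (k + 1) - w k], the left one by Cayley-Hamilton, and
     they agree at [k = 0] and [k = 1]. *)
  assert (Wk : forall k : nat,
    sin be * (x 0 * y (T * INR k) - y 0 * x (T * INR k)) = de * sin (INR k * be)).
  { assert (two : forall k : nat,
      sin be * (x 0 * y (T * INR k) - y 0 * x (T * INR k)) = de * sin (INR k * be) /\
      sin be * (x 0 * y (T * INR (S k)) - y 0 * x (T * INR (S k))) = de * sin (INR (S k) * be)).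
    { induction k as [|k [IH1 IH2]].
      - simpl. rewrite Rmult_0_r, Rmult_0_l, sin_0, Rmult_1_l. split; [ring|].
        unfold de. rewrite Rplus_0_l, Rmult_1_r. ring.
      - split; auto. rewrite !S_INR in *. destruct (Rec (T * INR k)) as [RX RY].
        replace (T * (INR k + 1 + 1)) with (T * INR k + 2 * T) by ring.
        replace (T * (INR k + 1)) with (T * INR k + T) in IH2 by ring.
        rewrite RX, RY, HT, <- Cbe.
        transitivity (2 * cos be * (sin be * (x 0 * y (T * INR k + T) - y 0 * x (T * INR k + T)))
          - sin be * (x 0 * y (T * INR k) - y 0 * x (T * INR k))); [ring|].
        rewrite IH1, IH2.
        replace ((INR k + 1 + 1) * be) with ((INR k + 1) * be + be) by ring.
        replace (INR k * be) with ((INR k + 1) * be - be) by ring.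
        rewrite sin_plus, sin_minus. ring. }
    intros k. apply two. }
  assert (Tr : forall k, Rabs (th k - INR k * be) <= PI).
  { apply angle_tracking with n.
    - unfold th. ring.
    - simpl. ring.
    - intros k. specialize (Hn (T * INR k)). unfold g in Hn. unfold th.
      rewrite S_INR. replace (T * (INR k + 1)) with (T * INR k + T) by ring. lra.
    - intros k. rewrite S_INR. lra.
    - intros k. specialize (Wk k). rewrite Wsin in Wk.
      (* [sin be] and [de] both have the sign [(-1)^n], so the sines of [th k] and [k be] differ by
         a positive factor. *)
      assert (Sn := sin_sign_between be n Rbe).
      assert (Dn : 0 < de * cos (IZR n * PI)).
      { rewrite <- (Hg 0). rewrite Rmult_assoc.
        apply Rmult_lt_0_compat; [apply Rmult_lt_0_compat; auto|].
        apply sin_sign_between, Hn. }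
      assert (pp : 0 < p 0 * p (T * INR k)) by (apply Rmult_lt_0_compat; auto).
      assert (C2 : cos (IZR n * PI) <> 0) by (intros C; rewrite C in Sn; lra).
      assert (Sbe : sin be <> 0) by (intros C; rewrite C in Sn; lra).
      exists (de / (sin be * (p 0 * p (T * INR k)))). split.
      + replace (de / (sin be * (p 0 * p (T * INR k)))) with
          (de * cos (IZR n * PI) / (sin be * cos (IZR n * PI) * (p 0 * p (T * INR k)))).
        * apply Rdiv_lt_0_compat; auto. now apply Rmult_lt_0_compat.
        * field. repeat split; auto; try lra; intros C; rewrite C in pp; lra.
      + unfold th. simpl (INR 0). rewrite Rmult_0_r.
        apply Rmult_eq_reg_l with (sin be * (p 0 * p (T * INR k))).
        * transitivity (de * sin (INR k * be)); [rewrite <- Wk; ring|].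
          field. repeat split; auto; intros C; rewrite C in pp; lra.
        * intros C. apply Rmult_integral in C. destruct C; [contradiction|lra]. }
  (* [th] is half the phase, so tracking within [PI] becomes [2 PI] for [phi]; a half-angle gain of
     [be] per period [2 PI] means the rotation number [be / PI]. *)
  apply rot_lim_of_bound with (2 * PI + Rabs (phi 0)). intros k.
  specialize (Tr k). unfold th in Tr. fold T. simpl (INR 0) in Tr. rewrite Rmult_0_r in Tr.
  replace (phi (T * INR k) - T * INR k * (be / PI)) with
    (2 * (phi (T * INR k) / 2 - phi 0 / 2 - INR k * be) + phi 0) by (unfold T; field; lra).
  eapply Rle_trans; [apply Rabs_triang|].
  rewrite Rabs_mult, (Rabs_right 2) by lra. unfold T in *. lra.
Qed.

(** A solution starting on a real eigenvector of the monodromy stays parallel to its translate, so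
    its phase gains exactly [2 PI n] in each period. One such solution suffices to identify the
    rotation number. *)
Lemma rot_hyperbolic (a M : R) (c x1 y1 x2 y2 : R -> R) :
  cont c -> (forall t, Rabs (c t) <= M) ->
  (forall t, c (t + 2 * PI) = c t) -> fundamental a c x1 y1 x2 y2 ->
  4 <= (x1 (2 * PI) + y2 (2 * PI)) ^ 2 ->
  exists (phi : R -> R) (n : Z), phase_sol a c phi /\ rot_lim phi (IZR n).
Proof.
  intros Cc Bc Hc HF HT. assert (P := PI_RGT_0).
  set (T := 2 * PI) in *.
  assert (D := fundamental_det _ _ _ _ _ _ HF T).
  (* The equation says that the monodromy preserves the direction [th]. The vertical direction works
     if [x2 T = 0]; otherwise the slope [Y] solves [x2 Y^2 - (y2 - x1) Y - y1 = 0], whose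
     discriminant is the squared trace minus four. *)
  assert (E : exists th, cos th * (cos th * y1 T + sin th * y2 T)
     - sin th * (cos th * x1 T + sin th * x2 T) = 0).
  { destruct (Req_dec (x2 T) 0) as [h|h].
    - exists (PI / 2). rewrite cos_PI2, sin_PI2, h. ring.
    - set (disc := (y2 T - x1 T) ^ 2 + 4 * x2 T * y1 T).
      assert (Hd : 0 <= disc) by
        (replace disc with ((x1 T + y2 T) ^ 2 - 4 * (x1 T * y2 T - y1 T * x2 T))
           by (unfold disc; ring); lra).
      assert (Sq := sqrt_sqrt disc Hd).
      set (Y := ((y2 T - x1 T) + sqrt disc) / (2 * x2 T)).
      exists (atan Y).
      assert (Hcos : 0 < cos (atan Y)) by (apply cos_gt_0; generalize (atan_bound Y); lra).
      assert (Hs : sin (atan Y) = Y * cos (atan Y)).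
      { rewrite <- (tan_atan Y) at 2. unfold tan. field. lra. }
      assert (EY : x2 T * Y ^ 2 - (y2 T - x1 T) * Y - y1 T = 0).
      { replace (x2 T * Y ^ 2 - (y2 T - x1 T) * Y - y1 T) with
          ((sqrt disc * sqrt disc - disc) / (4 * x2 T)).
        - rewrite Sq. field. auto.
        - unfold Y, disc. field. auto. }
      rewrite Hs.
      transitivity (- cos (atan Y) ^ 2 * (x2 T * Y ^ 2 - (y2 T - x1 T) * Y - y1 T)); [ring|].
      rewrite EY. ring. }
  destruct E as [th0 E].
  destruct (phase_sol_exists a M (2 * th0) c Cc Bc) as [phi [phi0 H]].
  assert (Cphi := cont_of_derive _ _ H).
  destruct (phase_to_lin a c phi H) as [p [pp [p0 L]]].
  assert (LS := lin_sol_shift a T c _ _ Hc L). cbv beta in LS.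
  assert (W := wronskian_const a c _ _ _ _ L LS). cbv beta in W.
  destruct (fundamental_decomp _ _ _ _ _ _ _ _ HF L T) as [XT YT]. cbv beta in XT, YT.
  set (g := fun t => phi (t + T) / 2 - phi t / 2).
  assert (Cg : cont g) by (unfold g; cont_tac).
  assert (Hg : forall t, p t * p (t + T) * sin (g t) = 0).
  { intros t. specialize (W t 0). unfold g. rewrite sin_minus.
    replace (0 + T) with T in W by ring.
    rewrite p0, phi0, XT, YT, p0, phi0 in W.
    replace (2 * th0 / 2) with th0 in W by field. lra. }
  destruct (sin_eq_0_const g Cg) as [n Hn].
  { intros t. specialize (Hg t). apply Rmult_integral in Hg.
    assert (0 < p t * p (t + T)) by (apply Rmult_lt_0_compat; auto).
    destruct Hg; lra. }
  exists phi, n. split; auto.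
  assert (K : forall k : nat, phi (T * INR k) = phi 0 + T * INR k * IZR n).
  { induction k as [|k IH].
    - simpl. rewrite Rmult_0_r. ring.
    - rewrite S_INR. specialize (Hn (T * INR k)). unfold g in Hn.
      replace (T * (INR k + 1)) with (T * INR k + T) by ring.
      replace (phi (T * INR k + T)) with (phi (T * INR k) + 2 * (IZR n * PI)) by lra.
      rewrite IH. unfold T. ring. }
  apply rot_lim_of_bound with (Rabs (phi 0)). intros k. fold T. rewrite K.
  right. f_equal. ring.
Qed.

(** * The equation of the theorem as a phase equation, and its trace criterion *)

Definition drive (omega B A t : R) : R := ell omega B / 2 + mu omega A * cos t.

Lemma drive_cont (omega B A : R) : cont (drive omega B A).
Proof.
  apply cont_ext with (fun t => ell omega B / 2 + mu omega A * cos t); [reflexivity|].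
  cont_tac.
Qed.

Lemma drive_bounded (omega B A t : R) :
  Rabs (drive omega B A t) <= Rabs (ell omega B / 2) + Rabs (mu omega A).
Proof.
  unfold drive. eapply Rle_trans; [apply Rabs_triang|].
  apply Rplus_le_compat_l. rewrite Rabs_mult.
  rewrite <- (Rmult_1_r (Rabs (mu omega A))) at 2.
  apply Rmult_le_compat_l; [apply Rabs_pos|].
  apply Rabs_le. generalize (COS_bound t). lra.
Qed.

Lemma drive_periodic (omega B A t : R) : drive omega B A (t + 2 * PI) = drive omega B A t.
Proof.
  unfold drive. do 2 f_equal. rewrite <- (cos_plus_2kPI t 1). f_equal. ring.
Qed.

(** Origin of the constants [1 / (2 omega)] and [l / 2 + mu cos t]: the coefficients of the equation
    are halved because [phase_sol] carries a factor two from the half angle. *)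
Lemma is_solution_phase_sol (omega B A : R) (phi : R -> R) :
  0 < omega -> is_solution omega B A phi <-> phase_sol (1 / (2 * omega)) (drive omega B A) phi.
Proof.
  intros Ho.
  assert (E : forall t, - sin (phi t) / omega + ell omega B + 2 * mu omega A * cos t
    = 2 * drive omega B A t - 2 * (1 / (2 * omega)) * sin (phi t)).
  { intros t. unfold drive. field. lra. }
  split; intros H t; specialize (H t); [rewrite <- E|rewrite E]; exact H.
Qed.

(** From left to right, a trace of modulus at least two would make [v] an integer, against
    [cos (v PI) = cos (r PI)] and [sin (r PI) <> 0]; for a smaller trace [rot_elliptic] identifies
    [v]. From right to left, [rot_elliptic] treats one solution and [rot_lim_transfer] the
    others. *)
Lemma L_pm_trace (omega r B A : R) (x1 y1 x2 y2 : R -> R) :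
  0 < omega -> (forall n : Z, r <> IZR n) ->
  fundamental (1 / (2 * omega)) (drive omega B A) x1 y1 x2 y2 ->
  (L_pm omega r (B, A) <-> x1 (2 * PI) + y2 (2 * PI) = 2 * cos (r * PI)).
Proof.
  intros Ho Hr HF. assert (P := PI_RGT_0).
  assert (Hs := fun phi => is_solution_phase_sol omega B A phi Ho).
  assert (Hc := drive_periodic omega B A). assert (Bc := drive_bounded omega B A).
  assert (Cc := drive_cont omega B A).
  assert (Sr : sin (r * PI) <> 0).
  { intros E. destruct (sin_eq_0_0 _ E) as [n Hn]. apply (Hr n). nra. }
  set (Tr := x1 (2 * PI) + y2 (2 * PI)).
  split.
  - intros [v [Hv [_ Hall]]].
    assert (Cv : cos (v * PI) = cos (r * PI)).
    { destruct Hv as [[n ->]|[n ->]].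
      - replace ((r + 2 * IZR n) * PI) with (r * PI + 2 * IZR n * PI) by ring.
        apply cos_plus_2kPI.
      - replace ((- r + 2 * IZR n) * PI) with (- (r * PI) + 2 * IZR n * PI) by ring.
        rewrite cos_plus_2kPI. apply cos_neg. }
    destruct (Rle_dec 4 (Tr ^ 2)) as [h|h].
    + exfalso.
      destruct (rot_hyperbolic _ _ _ _ _ _ _ Cc Bc Hc HF h) as [phi [n [H1 H2]]].
      apply Hs in H1. assert (E : v = IZR n) by exact (rot_lim_unique phi _ _ (Hall phi H1) H2).
      apply Sr. destruct (Rmult_integral (sin (r * PI)) (sin (r * PI))) as [Z|Z]; auto.
      assert (S1 := sin2_cos2 (r * PI)). assert (S2 := sin2_cos2 (v * PI)).
      unfold Rsqr in S1, S2. rewrite Cv in S2. rewrite E, sin_IZR_PI in S2. lra.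
    + set (al := acos (Tr / 2)).
      assert (Ca : cos al = Tr / 2) by (apply cos_acos; nra).
      assert (Sa : sin al <> 0).
      { intros Z. assert (S := sin2_cos2 al). unfold Rsqr in S. rewrite Z, Ca in S. nra. }
      destruct (phase_sol_exists (1 / (2 * omega)) _ 0 _ Cc Bc) as [phi [_ H]].
      assert (HT : Tr = 2 * cos al) by lra.
      destruct (rot_elliptic _ al _ _ _ _ _ phi Hc HF HT Sa H) as [be [m [Hbe L]]].
      apply Hs in H. assert (E : v = be / PI) by exact (rot_lim_unique phi _ _ (Hall phi H) L).
      rewrite HT, <- Cv, E. replace (be / PI * PI) with be by (field; lra).
      destruct Hbe as [-> | ->]; rewrite cos_plus_2kPI; auto. now rewrite cos_neg.
  - intros HT.
    destruct (phase_sol_exists (1 / (2 * omega)) _ 0 _ Cc Bc) as [phi [_ H]].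
    destruct (rot_elliptic _ (r * PI) _ _ _ _ _ phi Hc HF HT Sr H) as [be [m [Hbe L]]].
    exists (be / PI). split.
    + destruct Hbe as [-> | ->]; [left|right]; exists m; field; lra.
    + split.
      * exists phi. now apply Hs.
      * intros psi Hpsi. simpl in Hpsi. apply Hs in Hpsi.
        exact (rot_lim_transfer _ _ _ _ _ H Hpsi L).
Qed.

(** * Infinite products of companion matrices *)

Definition companion (p q : nat -> R) (k : nat) : @matrix R 2 2 :=
  [[ 1 + p k, q k ], [ 1, 0 ]].

Lemma partial_prod_succ (p q : nat -> R) (k n i : nat) :
  (i < 2)%nat ->
  let P := partial_prod (companion p q) k in
  coeff_mat 0 (P (S n)) i 0 =
    coeff_mat 0 (P n) i 0 * (1 + p (k + n)%nat) + coeff_mat 0 (P n) i 1 /\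
  coeff_mat 0 (P (S n)) i 1 = coeff_mat 0 (P n) i 0 * q (k + n)%nat.
Proof.
  intros Hi P. unfold P. clear P. simpl partial_prod. unfold Mmult.
  rewrite !coeff_mat_bij by lia. simpl pred. rewrite !sum_Sn, !sum_O.
  unfold companion, mult, plus, coeff_mat; simpl. unfold mult; simpl. destruct i as [|[|i]]; [| |lia]; split; ring.
Qed.

Lemma partial_prod_O (X : nat -> @matrix R 2 2) (k i j : nat) :
  (i < 2)%nat -> (j < 2)%nat ->
  coeff_mat 0 (partial_prod X k 0) i j = if Nat.eqb i j then 1 else 0.
Proof.
  intros Hi Hj. simpl. unfold Mone. rewrite coeff_mat_bij; auto.
  destruct i as [|[|i]]; destruct j as [|[|j]]; try lia; reflexivity.
Qed.

(** [partial_prod] grows on the right; peeling off the left factor instead yields the recurrence in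
    [k] obeyed by the limits. *)
Lemma partial_prod_shift (p q : nat -> R) (k n j : nat) :
  (j < 2)%nat ->
  let P := partial_prod (companion p q) in
  coeff_mat 0 (P k (S n)) 0 j =
    (1 + p k) * coeff_mat 0 (P (S k) n) 0 j + q k * coeff_mat 0 (P (S k) n) 1 j /\
  coeff_mat 0 (P k (S n)) 1 j = coeff_mat 0 (P (S k) n) 0 j.
Proof.
  intros Hj P. unfold P. clear P. revert j Hj.
  (* Appending a factor mixes the columns, so the induction carries both of them. *)
  assert (both : let P := partial_prod (companion p q) in
    (coeff_mat 0 (P k (S n)) 0 0 =
      (1 + p k) * coeff_mat 0 (P (S k) n) 0 0 + q k * coeff_mat 0 (P (S k) n) 1 0 /\
    coeff_mat 0 (P k (S n)) 1 0 = coeff_mat 0 (P (S k) n) 0 0) /\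
    (coeff_mat 0 (P k (S n)) 0 1 =
      (1 + p k) * coeff_mat 0 (P (S k) n) 0 1 + q k * coeff_mat 0 (P (S k) n) 1 1 /\
    coeff_mat 0 (P k (S n)) 1 1 = coeff_mat 0 (P (S k) n) 0 1)).
  { cbv zeta. induction n as [|n [[A B] [C D]]].
    - destruct (partial_prod_succ p q k 0 0) as [-> ->]; [lia|].
      destruct (partial_prod_succ p q k 0 1) as [-> ->]; [lia|].
      rewrite !partial_prod_O by lia. simpl. rewrite Nat.add_0_r.
      repeat split; ring.
    - destruct (partial_prod_succ p q k (S n) 0) as [-> ->]; [lia|].
      destruct (partial_prod_succ p q k (S n) 1) as [-> ->]; [lia|].
      destruct (partial_prod_succ p q (S k) n 0) as [-> ->]; [lia|].
      destruct (partial_prod_succ p q (S k) n 1) as [-> ->]; [lia|].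
      rewrite A, B, C, D. replace (k + S n)%nat with (S k + n)%nat by lia.
      repeat split; ring. }
  destruct both as [H0 H1].
  intros [|[|j]] Hj; [exact H0|exact H1|lia].
Qed.

Lemma telescoping_tail (K : R) (k n : nat) :
  sum_n (fun j => K / ((INR (k + j) + 1) * (INR (k + j) + 2))) n =
    K / (INR k + 1) - K / (INR (k + n) + 2).
Proof.
  induction n as [|n IH].
  - rewrite sum_O, Nat.add_0_r.
    match goal with |- ?x = ?y => change (@eq R x y) end.
    field. generalize (pos_INR k). lra.
  - rewrite sum_Sn, IH. unfold plus; simpl.
    replace (INR (k + S n)) with (INR (k + n) + 1) by (rewrite <- S_INR; f_equal; lia).
    match goal with |- ?x = ?y => change (@eq R x y) end.
    field. generalize (pos_INR k) (pos_INR (k + n)). lra.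
Qed.

(** The majorant telescopes, so its tail from [k] on sums to [K / (k + 1)]; this is the source of
    the rate at which the limit approaches [1] as [k] grows. *)
Lemma companion_prod_limit (p q : nat -> R) (K : R) (k : nat) :
  (forall n, Rabs (p n) + Rabs (q n) <= K / ((INR n + 1) * (INR n + 2))) ->
  exists F : R,
    is_lim_seq (fun n => coeff_mat 0 (partial_prod (companion p q) k n) 0 0) F /\
    Rabs (F - 1) <= exp K * K / (INR k + 1).
Proof.
  intros H.
  set (e := fun n => K / ((INR (k + n) + 1) * (INR (k + n) + 2))).
  set (G := fun n => coeff_mat 0 (partial_prod (companion p q) k n) 0 0).
  set (I := fun n => coeff_mat 0 (partial_prod (companion p q) k n) 0 1).
  assert (Rec : forall n, G (S n) = G n * (1 + p (k + n)%nat) + I n /\ I (S n) = G n * q (k + n)%nat).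
  { intros n. apply partial_prod_succ. lia. }
  assert (G0 : G O = 1) by (unfold G; now rewrite partial_prod_O by lia).
  assert (I0 : I O = 0) by (unfold I; now rewrite partial_prod_O by lia).
  assert (He : forall n, Rabs (p (k + n)%nat) + Rabs (q (k + n)%nat) <= e n) by (intros; apply H).
  assert (HK : 0 <= K).
  { specialize (H O). simpl in H. generalize (Rabs_pos (p O)) (Rabs_pos (q O)). lra. }
  assert (e0 : forall n, 0 <= e n).
  { intros n. specialize (He n).
    generalize (Rabs_pos (p (k + n)%nat)) (Rabs_pos (q (k + n)%nat)). lra. }
  assert (Kk : forall n, sum_n e n <= K / (INR k + 1)).
  { intros n. unfold e. rewrite telescoping_tail.
    assert (0 <= K / (INR (k + n) + 2)); [|lra].
    apply Rmult_le_pos; auto. apply Rlt_le, Rinv_0_lt_compat.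
    generalize (pos_INR (k + n)). lra. }
  assert (Kk1 : K / (INR k + 1) <= K).
  { assert (Pk := pos_INR k).
    apply Rmult_le_reg_r with (INR k + 1); [lra|].
    unfold Rdiv. rewrite Rmult_assoc, Rinv_l by lra. nra. }
  (* The norm [|G| + |I|] of the first row grows by a factor of at most [1 + e n <= exp (e n)],
     whence the uniform bound [exp K]. *)
  assert (step : forall n, Rabs (G (S n)) + Rabs (I (S n)) <= (Rabs (G n) + Rabs (I n)) * exp (e n)).
  { intros n. destruct (Rec n) as [-> ->]. specialize (He n).
    assert (X : Rabs (G n * (1 + p (k + n)%nat) + I n) <=
      Rabs (G n) * (1 + Rabs (p (k + n)%nat)) + Rabs (I n)).
    { eapply Rle_trans; [apply Rabs_triang|]. rewrite Rabs_mult.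
      apply Rplus_le_compat_r, Rmult_le_compat_l; [apply Rabs_pos|].
      eapply Rle_trans; [apply Rabs_triang|]. rewrite Rabs_R1. lra. }
    rewrite Rabs_mult.
    assert (Y := exp_ineq1_le (e n)). assert (E0 := e0 n).
    generalize (Rabs_pos (G n)) (Rabs_pos (I n)). intros g0 i0.
    assert (Rabs (G n) * (Rabs (p (k + n)%nat) + Rabs (q (k + n)%nat)) <= Rabs (G n) * e n)
      by (apply Rmult_le_compat_l; auto).
    assert ((Rabs (G n) + Rabs (I n)) * (1 + e n) <= (Rabs (G n) + Rabs (I n)) * exp (e n))
      by (apply Rmult_le_compat_l; lra).
    assert (0 <= Rabs (I n) * e n) by (apply Rmult_le_pos; auto). lra. }
  assert (bound : forall n, Rabs (G n) + Rabs (I n) <= exp K).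
  { assert (bs : forall n, Rabs (G (S n)) + Rabs (I (S n)) <= exp (sum_n e n)).
    { induction n as [|n IH].
      - eapply Rle_trans; [apply step|]. rewrite sum_O, G0, I0, Rabs_R0, Rabs_R1. lra.
      - eapply Rle_trans; [apply step|]. rewrite sum_Sn. unfold plus; simpl.
        rewrite exp_plus. apply Rmult_le_compat_r; auto. apply Rlt_le, exp_pos. }
    intros [|n].
    - rewrite G0, I0, Rabs_R0, Rabs_R1. generalize (exp_ineq1_le K). lra.
    - eapply Rle_trans; [apply bs|].
      destruct (Rle_lt_or_eq_dec (sum_n e n) K) as [h|h].
      + eapply Rle_trans; [apply Kk|auto].
      + now apply Rlt_le, exp_increasing.
      + rewrite h. apply Rle_refl. }
  (* The column [(1, 1)] is fixed by the unperturbed factor [[[1, 0], [1, 0]]], so the product [J]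
     of the row with it moves only by [G (p + q)], which is summable; [I] alone tends to zero. *)
  set (J := fun n => G n + I n).
  set (b := fun n => exp K * e n).
  assert (Jstep : forall n, Rabs (J (S n) - J n) <= b n).
  { intros n. unfold J, b. destruct (Rec n) as [-> ->].
    replace (_ - _) with (G n * (p (k + n)%nat + q (k + n)%nat)) by ring.
    rewrite Rabs_mult. apply Rmult_le_compat; try apply Rabs_pos.
    - generalize (bound n) (Rabs_pos (I n)). lra.
    - eapply Rle_trans; [apply Rabs_triang|apply He]. }
  assert (Jdist : forall n, Rabs (J (S n) - 1) <= exp K * K / (INR k + 1)).
  { intros n. apply Rle_trans with (exp K * sum_n e n).
    - induction n as [|n IH].
      + rewrite sum_O. specialize (Jstep O). unfold J at 2 in Jstep.
        rewrite G0, I0, Rplus_0_r in Jstep. exact Jstep.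
      + rewrite sum_Sn. unfold plus; simpl. specialize (Jstep (S n)). unfold b in Jstep.
        replace (J (S (S n)) - 1) with ((J (S (S n)) - J (S n)) + (J (S n) - 1)) by ring.
        eapply Rle_trans; [apply Rabs_triang|lra].
    - unfold Rdiv. rewrite Rmult_assoc.
      apply Rmult_le_compat_l; [apply Rlt_le, exp_pos|apply Kk]. }
  assert (Lim_e : is_lim_seq e 0).
  { apply is_lim_seq_le_le with (fun _ => 0) (fun n => K * / INR (S n)).
    - intros n. split; auto. unfold e, Rdiv. apply Rmult_le_compat_l; auto.
      apply Rinv_le_contravar; [apply lt_0_INR; lia|].
      rewrite S_INR, plus_INR. generalize (pos_INR k) (pos_INR n). nra.
    - apply is_lim_seq_const.
    - replace (Finite 0) with (Rbar_mult K 0) by (simpl; f_equal; ring).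
      apply is_lim_seq_scal_l, inv_INR_S_lim. }
  assert (ex_b : ex_series b).
  { exists (exp K * (K / (INR k + 1))). unfold b.
    apply (is_series_scal_l (exp K) e).
    change (is_lim_seq (sum_n e) (Finite (K / (INR k + 1)))).
    apply is_lim_seq_ext with (fun n => K / (INR k + 1) - K * / INR (S (k + n) + 1)).
    - intros n. unfold e. rewrite telescoping_tail, plus_INR, S_INR. simpl (INR 1).
      unfold Rdiv. do 3 f_equal. ring.
    - replace (K / (INR k + 1)) with (K / (INR k + 1) - K * 0) at 1 by ring.
      apply is_lim_seq_minus'; [apply is_lim_seq_const|].
      apply is_lim_seq_scal_l with (lu := Finite 0).
      apply is_lim_seq_ext with (fun n => / INR (S (n + (k + 1)))).
      + intros n. do 2 f_equal. lia.
      + apply (is_lim_seq_incr_n (fun n => / INR (S n))), inv_INR_S_lim. }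
  destruct (dominated_limit J b Jstep ex_b) as [F HF].
  exists F. split.
  - apply is_lim_seq_incr_1.
    apply is_lim_seq_ext with (fun n => J (S n) - I (S n)).
    { intros n. unfold J, G. ring. }
    replace (Finite F) with (Finite (F - 0)) by (f_equal; ring).
    apply is_lim_seq_minus'; [now apply is_lim_seq_incr_1 with (u := J)|].
    apply is_lim_seq_abs_0.
    apply is_lim_seq_le_le with (fun _ => 0) (fun n => exp K * e n).
    + intros n. split; [apply Rabs_pos|]. destruct (Rec n) as [_ ->].
      rewrite Rabs_mult. apply Rmult_le_compat; try apply Rabs_pos.
      * generalize (bound n) (Rabs_pos (I n)). lra.
      * generalize (He n) (Rabs_pos (p (k + n)%nat)). lra.
    + apply is_lim_seq_const.
    + replace (Finite 0) with (Rbar_mult (exp K) 0) by (simpl; f_equal; ring).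
      now apply is_lim_seq_scal_l.
  - refine (is_lim_seq_le (fun n => Rabs (J (S n) - 1)) (fun _ => exp K * K / (INR k + 1))
      (Finite (Rabs (F - 1))) (Finite _) Jdist _ _).
    + apply (is_lim_seq_abs _ (Finite (F - 1))). apply is_lim_seq_minus'.
      * now apply is_lim_seq_incr_1 with (u := J).
      * apply is_lim_seq_const.
    + apply is_lim_seq_const.
Qed.

(** The second row of a companion matrix only shifts the index, so the entries [11] and [21] belong
    to one sequence [F]; the limit [1] fixes its normalisation. *)
Lemma inf_prod_companion (p q : nat -> R) (K : R) :
  (forall n, Rabs (p n) + Rabs (q n) <= K / ((INR n + 1) * (INR n + 2))) ->
  let F := fun k => entry (inf_prod (companion p q) k) 1 1 in
  (forall k, entry (inf_prod (companion p q) k) 2 1 = F (S k)) /\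
  (forall k, F k = (1 + p k) * F (S k) + q k * F (S (S k))) /\
  is_lim_seq F 1.
Proof.
  intros H F.
  assert (L : forall k, is_lim_seq
     (fun n => coeff_mat 0 (partial_prod (companion p q) k n) 0 0) (F k) /\
     Rabs (F k - 1) <= exp K * K / (INR k + 1)).
  { intros k. destruct (companion_prod_limit p q K k H) as [f [L B]].
    assert (E : F k = f).
    { unfold F, entry, inf_prod. rewrite coeff_mat_bij by (simpl; lia). simpl pred.
      now rewrite (is_lim_seq_unique _ _ L). }
    now rewrite E. }
  assert (L10 : forall k, is_lim_seq
     (fun n => coeff_mat 0 (partial_prod (companion p q) k n) 1 0) (F (S k))).
  { intros k. apply is_lim_seq_incr_1.
    apply is_lim_seq_ext with (fun n => coeff_mat 0 (partial_prod (companion p q) (S k) n) 0 0).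
    - intros n. symmetry. apply (partial_prod_shift p q k n 0). lia.
    - apply L. }
  split; [|split].
  - intros k. unfold entry at 1, inf_prod. rewrite coeff_mat_bij by (simpl; lia). simpl pred.
    now rewrite (is_lim_seq_unique _ _ (L10 k)).
  - intros k.
    assert (A : is_lim_seq (fun n => coeff_mat 0 (partial_prod (companion p q) k (S n)) 0 0) (F k))
      by (apply is_lim_seq_incr_1 with
        (u := fun n => coeff_mat 0 (partial_prod (companion p q) k n) 0 0); apply L).
    assert (B : is_lim_seq (fun n => coeff_mat 0 (partial_prod (companion p q) k (S n)) 0 0)
      ((1 + p k) * F (S k) + q k * F (S (S k)))).
    { apply is_lim_seq_ext with (fun n =>
        (1 + p k) * coeff_mat 0 (partial_prod (companion p q) (S k) n) 0 0 +
        q k * coeff_mat 0 (partial_prod (companion p q) (S k) n) 1 0).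
      - intros n. symmetry. apply (partial_prod_shift p q k n 0). lia.
      - apply is_lim_seq_plus'.
        + apply is_lim_seq_scal_l with (lu := Finite (F (S k))). apply L.
        + apply is_lim_seq_scal_l with (lu := Finite (F (S (S k)))). apply L10. }
    apply is_lim_seq_unique in A, B. rewrite A in B. now injection B.
  - apply is_lim_seq_ext with (fun k => (F k - 1) + 1); [intros; ring|].
    replace (Finite 1) with (Finite (0 + 1)) by (f_equal; ring).
    apply is_lim_seq_plus'; [|apply is_lim_seq_const].
    apply is_lim_seq_abs_0.
    apply is_lim_seq_le_le with (fun _ => 0) (fun k => exp K * K * / INR (S k)).
    + intros k. split; [apply Rabs_pos|]. rewrite S_INR. apply L.
    + apply is_lim_seq_const.
    + replace (Finite 0) with (Rbar_mult (exp K * K) 0) by (simpl; f_equal; ring).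
      apply is_lim_seq_scal_l, inv_INR_S_lim.
Qed.

(** * The three-term recurrence *)

Definition not_int (s : R) : Prop := forall n : Z, s <> IZR n.

Lemma not_int_neq_0 (s : R) (k : Z) : not_int s -> IZR k + s <> 0.
Proof. intros H E. apply (H (- k)%Z). rewrite opp_IZR. lra. Qed.

Lemma backward_denominators (u v : R) (m : nat) :
  not_int u -> not_int v ->
  u - INR m + 1 <> 0 /\ v - INR m - 1 <> 0 /\ v - INR m - 2 <> 0.
Proof.
  intros Hu Hv.
  replace (u - INR m + 1) with (IZR (1 - Z.of_nat m) + u) by
    (rewrite minus_IZR, <- INR_IZR_INZ; ring).
  replace (v - INR m - 1) with (IZR (- Z.of_nat m - 1) + v) by
    (rewrite minus_IZR, opp_IZR, <- INR_IZR_INZ; ring).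
  replace (v - INR m - 2) with (IZR (- Z.of_nat m - 2) + v) by
    (rewrite minus_IZR, opp_IZR, <- INR_IZR_INZ; ring).
  repeat split; now apply not_int_neq_0.
Qed.

(** With [eta] the distance from [s] to the integers, [n + 2 <= |n + s| + |2 - s| <= (1 + |2 - s| /
    eta) |n + s|]. *)
Lemma shifted_lower_bound (s : R) :
  not_int s -> exists d, 0 < d /\ forall n : nat, d * (INR n + 2) <= Rabs (INR n + s).
Proof.
  intros H. destruct (floor_exists s) as [m Hm].
  assert (s <> IZR m) by apply H.
  set (eta := Rmin (s - IZR m) (IZR m + 1 - s)).
  assert (E0 : 0 < eta) by (unfold eta; apply Rmin_pos; lra).
  assert (E1 : eta <= s - IZR m) by apply Rmin_l.
  assert (E2 : eta <= IZR m + 1 - s) by apply Rmin_r.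
  assert (L : forall n : nat, eta <= Rabs (INR n + s)).
  { intros n. rewrite INR_IZR_INZ. set (k := Z.of_nat n).
    destruct (Z_le_gt_dec 0 (k + m)) as [h|h].
    - apply IZR_le in h. rewrite plus_IZR in h.
      rewrite Rabs_right; lra.
    - assert (h' : (k + m <= -1)%Z) by lia. apply IZR_le in h'. rewrite plus_IZR in h'.
      rewrite Rabs_left; lra. }
  set (c := 1 + Rabs (2 - s) / eta).
  assert (Hc : 1 <= c).
  { unfold c. assert (0 <= Rabs (2 - s) / eta); [|lra].
    apply Rmult_le_pos; [apply Rabs_pos|]. apply Rlt_le, Rinv_0_lt_compat, E0. }
  exists (/ c). split; [apply Rinv_0_lt_compat; lra|].
  intros n. specialize (L n).
  apply Rmult_le_reg_l with c; [lra|].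
  rewrite <- Rmult_assoc, Rinv_r, Rmult_1_l by lra.
  apply Rle_trans with (Rabs (INR n + s) + Rabs (2 - s)).
  - replace (INR n + 2) with ((INR n + s) + (2 - s)) by ring.
    eapply Rle_trans; [apply Rle_abs|apply Rabs_triang].
  - unfold c. rewrite Rmult_plus_distr_r, Rmult_1_l.
    apply Rplus_le_compat_l.
    replace (Rabs (2 - s)) with (Rabs (2 - s) / eta * eta) at 1 by (field; lra).
    apply Rmult_le_compat_l; auto.
    apply Rmult_le_pos; [apply Rabs_pos|]. apply Rlt_le, Rinv_0_lt_compat, E0.
Qed.

Lemma quotient_bound (a b M m : R) : Rabs a <= M -> 0 < m -> m <= Rabs b -> Rabs (a / b) <= M / m.
Proof.
  intros Ha Hm Hb.
  assert (b <> 0) by (intros ->; rewrite Rabs_R0 in Hb; lra).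
  rewrite Rabs_div by auto. unfold Rdiv.
  apply Rmult_le_compat; auto; [apply Rabs_pos|apply Rlt_le, Rinv_0_lt_compat; lra|].
  now apply Rinv_le_contravar.
Qed.

Lemma M_bound (u v lam mu : R) :
  not_int u -> not_int v ->
  exists K, forall n : nat,
    Rabs (lam / ((INR n + u) * (INR n + v))) + Rabs (mu ^ 2 / ((INR n + u) * (INR n + v)))
    <= K / ((INR n + 1) * (INR n + 2)).
Proof.
  intros Hu Hv.
  destruct (shifted_lower_bound u Hu) as [d [d0 Hd]].
  destruct (shifted_lower_bound v Hv) as [e [e0 He]].
  exists (Rabs lam / (d * e) + Rabs (mu ^ 2) / (d * e)).
  intros n. specialize (Hd n). specialize (He n). assert (Pn := pos_INR n).
  assert (0 < d * (INR n + 2)) by (apply Rmult_lt_0_compat; lra).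
  assert (0 < e * (INR n + 2)) by (apply Rmult_lt_0_compat; lra).
  assert (B : d * e * ((INR n + 1) * (INR n + 2)) <= Rabs ((INR n + u) * (INR n + v))).
  { rewrite Rabs_mult.
    apply Rle_trans with ((d * (INR n + 2)) * (e * (INR n + 2))); [|apply Rmult_le_compat; lra].
    replace (d * (INR n + 2) * (e * (INR n + 2))) with (d * e * ((INR n + 2) * (INR n + 2))) by ring.
    apply Rmult_le_compat_l; [apply Rmult_le_pos; lra|nra]. }
  assert (0 < d * e * ((INR n + 1) * (INR n + 2))) by (repeat apply Rmult_lt_0_compat; lra).
  apply Rle_trans with (Rabs lam / (d * e * ((INR n + 1) * (INR n + 2))) +
    Rabs (mu ^ 2) / (d * e * ((INR n + 1) * (INR n + 2)))).
  - apply Rplus_le_compat; apply quotient_bound; auto; apply Rle_refl.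
  - right. field. lra.
Qed.

(** The numerator of degree one is divided by three linear factors, so the second term still decays
    like [1 / m^2]. Changing signs puts the factors, which decrease in [m], into the form [m + s] of
    [shifted_lower_bound]. *)
Lemma S_bound (u v kap mu : R) :
  not_int u -> not_int v ->
  exists K, forall m : nat,
    Rabs (kap / ((u - INR m + 1) * (v - INR m - 1))) +
    Rabs (mu ^ 2 * (v - INR m) / ((u - INR m + 1) * (v - INR m - 1) * (v - INR m - 2)))
    <= K / ((INR m + 1) * (INR m + 2)).
Proof.
  intros Hu Hv.
  assert (H1 : not_int (- 1 - u)).
  { intros n E. apply (Hu (- 1 - n)%Z). rewrite minus_IZR. lra. }
  assert (H2 : not_int (1 - v)).
  { intros n E. apply (Hv (1 - n)%Z). rewrite minus_IZR. lra. }
  assert (H3 : not_int (2 - v)).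
  { intros n E. apply (Hv (2 - n)%Z). rewrite minus_IZR. lra. }
  destruct (shifted_lower_bound _ H1) as [d [d0 Hd]].
  destruct (shifted_lower_bound _ H2) as [e [e0 He]].
  destruct (shifted_lower_bound _ H3) as [f [f0 Hf]].
  exists (Rabs kap / (d * e) + mu ^ 2 * (1 + Rabs v) / (d * e * f)).
  intros n. specialize (Hd n). specialize (He n). specialize (Hf n). assert (Pn := pos_INR n).
  assert (0 < d * (INR n + 2)) by (apply Rmult_lt_0_compat; lra).
  assert (0 < e * (INR n + 2)) by (apply Rmult_lt_0_compat; lra).
  assert (0 < f * (INR n + 2)) by (apply Rmult_lt_0_compat; lra).
  assert (B0 : (d * (INR n + 2)) * (e * (INR n + 2)) <= Rabs ((u - INR n + 1) * (v - INR n - 1))).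
  { rewrite Rabs_mult, <- (Rabs_Ropp (u - INR n + 1)), <- (Rabs_Ropp (v - INR n - 1)).
    apply Rmult_le_compat; try lra.
    - replace (- (u - INR n + 1)) with (INR n + (- 1 - u)) by ring. lra.
    - replace (- (v - INR n - 1)) with (INR n + (1 - v)) by ring. lra. }
  assert (B1 : d * e * ((INR n + 1) * (INR n + 2)) <= Rabs ((u - INR n + 1) * (v - INR n - 1))).
  { apply Rle_trans with (2 := B0).
    replace (d * (INR n + 2) * (e * (INR n + 2))) with (d * e * ((INR n + 2) * (INR n + 2))) by ring.
    apply Rmult_le_compat_l; [apply Rmult_le_pos; lra|nra]. }
  assert (B2 : d * e * f * ((INR n + 2) * (INR n + 2) * (INR n + 2)) <=
    Rabs ((u - INR n + 1) * (v - INR n - 1) * (v - INR n - 2))).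
  { rewrite (Rabs_mult (_ * _)), <- (Rabs_Ropp (v - INR n - 2)).
    replace (- (v - INR n - 2)) with (INR n + (2 - v)) by ring.
    replace (d * e * f * ((INR n + 2) * (INR n + 2) * (INR n + 2))) with
      ((d * (INR n + 2)) * (e * (INR n + 2)) * (f * (INR n + 2))) by ring.
    apply Rmult_le_compat; try lra. apply Rmult_le_pos; lra. }
  assert (N : Rabs (mu ^ 2 * (v - INR n)) <= mu ^ 2 * ((1 + Rabs v) * (INR n + 2))).
  { rewrite Rabs_mult, (Rabs_right (mu ^ 2)) by (apply Rle_ge, pow2_ge_0).
    apply Rmult_le_compat_l; [apply pow2_ge_0|].
    unfold Rminus. eapply Rle_trans; [apply Rabs_triang|].
    rewrite Rabs_Ropp, (Rabs_right (INR n)) by lra. generalize (Rabs_pos v). nra. }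
  eapply Rle_trans; [apply Rplus_le_compat; apply quotient_bound; [apply Rle_refl| |exact B1|exact N| |exact B2]|].
  - repeat apply Rmult_lt_0_compat; lra.
  - repeat apply Rmult_lt_0_compat; lra.
  - rewrite Rdiv_plus_distr. apply Rplus_le_compat.
    + right. field. lra.
    + apply Rle_trans with (mu ^ 2 * (1 + Rabs v) / (d * e * f) / ((INR n + 2) * (INR n + 2))).
      * right. field. lra.
      * unfold Rdiv at 1 3. apply Rmult_le_compat_l.
        -- apply Rmult_le_pos.
           ++ apply Rmult_le_pos; [apply pow2_ge_0|generalize (Rabs_pos v); lra].
           ++ apply Rlt_le, Rinv_0_lt_compat. repeat apply Rmult_lt_0_compat; lra.
        -- apply Rinv_le_contravar; [apply Rmult_lt_0_compat; lra|].
           apply Rmult_le_compat_r; lra.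
Qed.

(** After [2 i] steps the growth factor is [4^i >= (i + 1)^2]; the linear bound absorbs one factor
    [i + 1] and the other is left unbounded unless [V N = 0]. *)
Lemma doubling_vanish (V : nat -> R) (C : R) (N : nat) :
  (forall n, (N <= n)%nat -> 2 * Rabs (V n) <= Rabs (V (S n))) ->
  (forall n, Rabs (V n) <= C * (INR n + 1)) -> V N = 0.
Proof.
  intros H B.
  assert (G : forall j, 2 ^ j * Rabs (V N) <= Rabs (V (N + j)%nat)).
  { induction j as [|j IH].
    - rewrite Nat.add_0_r. simpl. lra.
    - rewrite Nat.add_succ_r. specialize (H (N + j)%nat ltac:(lia)). simpl. lra. }
  assert (P : forall i, INR i + 1 <= 2 ^ i).
  { induction i as [|i IH]; [simpl; lra|]. rewrite S_INR. simpl.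
    generalize (pos_INR i). lra. }
  assert (Q : forall i, (INR i + 1) * Rabs (V N) <= C * (INR N + 2)).
  { intros i. specialize (G (i + i)%nat). specialize (B (N + (i + i))%nat).
    rewrite pow_add in G. rewrite !plus_INR in B. specialize (P i).
    assert (Pi := pos_INR i). assert (PN := pos_INR N). assert (PV := Rabs_pos (V N)).
    assert (C0 : 0 <= C).
    { assert (0 <= C * (INR N + (INR i + INR i) + 1)) by
        (apply Rle_trans with (2 := B); apply Rabs_pos). nra. }
    assert (X : (INR i + 1) * (INR i + 1) * Rabs (V N) <= 2 ^ i * 2 ^ i * Rabs (V N)).
    { apply Rmult_le_compat_r; auto. apply Rmult_le_compat; lra. }
    assert (Y : C * (INR N + (INR i + INR i) + 1) <= C * ((INR N + 2) * (INR i + 1))).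
    { apply Rmult_le_compat_l; auto. nra. }
    apply Rmult_le_reg_l with (INR i + 1); lra. }
  destruct (Req_dec (V N) 0) as [h|h]; auto. exfalso.
  assert (PV := Rabs_pos_lt _ h).
  destruct (INR_unbounded (C * (INR N + 2) / Rabs (V N))) as [i Hi].
  specialize (Q i).
  apply (Rmult_lt_compat_r (Rabs (V N))) in Hi; auto.
  unfold Rdiv in Hi. rewrite Rmult_assoc, Rinv_l in Hi by lra. lra.
Qed.

(** A nonzero tail would double at each step, against the linear bound; from the vanishing tail,
    [al n <> 0] carries zero back down to [n0]. *)
Lemma recessive_vanish (V al be : nat -> R) (C : R) (n0 N : nat) :
  (forall n, (n0 <= n)%nat -> al n * V n = be n * V (S n)) ->
  (forall n, al n <> 0) ->
  (forall n, (N <= n)%nat -> 2 * Rabs (be n) <= Rabs (al n)) ->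
  (forall n, Rabs (V n) <= C * (INR n + 1)) ->
  forall n, (n0 <= n)%nat -> V n = 0.
Proof.
  intros H Ha Hb B.
  assert (T : forall n, (n0 <= n)%nat -> (N <= n)%nat -> V n = 0).
  { intros n h1 h2. apply doubling_vanish with C; auto.
    intros m hm. specialize (H m ltac:(lia)). specialize (Hb m ltac:(lia)).
    assert (A := Rabs_pos_lt _ (Ha m)).
    apply (f_equal Rabs) in H. rewrite !Rabs_mult in H.
    generalize (Rabs_pos (V (S m))) (Rabs_pos (V m)). intros.
    apply Rmult_le_reg_l with (Rabs (al m)); auto.
    assert (2 * Rabs (be m) * Rabs (V (S m)) <= Rabs (al m) * Rabs (V (S m)))
      by (apply Rmult_le_compat_r; auto). lra. }
  intros n hn.
  assert (D : forall j n, (n0 <= n)%nat -> (N <= n + j)%nat -> V n = 0).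
  { induction j as [|j IH]; intros m h1 h2.
    - apply T; lia.
    - specialize (H m h1). rewrite (IH (S m)) in H by lia.
      rewrite Rmult_0_r in H. apply Rmult_integral in H. destruct H as [H|H]; auto.
      now elim (Ha m). }
  apply (D N n); lia.
Qed.

Lemma lim_1_bounded (F : nat -> R) : is_lim_seq F 1 -> exists K, forall n, Rabs (F n) <= K.
Proof.
  intros H. destruct (filterlim_bounded F) as [K HK].
  - exists 1. exact H.
  - now exists K.
Qed.

Lemma lim_1_not_eventually_0 (F : nat -> R) (N : nat) :
  is_lim_seq F 1 -> ~ forall n, (N <= n)%nat -> F n = 0.
Proof.
  intros H Z. apply (is_lim_seq_incr_n F N) in H.
  apply (is_lim_seq_ext _ (fun _ => 0)) in H; [|intros n; apply Z; lia].
  apply is_lim_seq_unique in H. rewrite Lim_seq_const in H. injection H. lra.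
Qed.

(* The three-term recurrence satisfied by the coefficients of
   [sum_k A k * z ^ (k + u)] in the double confluent Heun equation. *)
Definition heun_op (u v lam mu : R) (A : Z -> R) (k : Z) : R :=
  ((IZR k + u) * (IZR k + v) + lam) * A k + mu * (IZR k + 1 + u) * A (k + 1)%Z
  - mu * (IZR k + v) * A (k - 1)%Z.

Definition bounded_seq (A : Z -> R) : Prop := exists K, forall k, Rabs (A k) <= K.

(** The relation [F k = (1 + p k) F (k + 1) + q k F (k + 2)] of the products of [Mmat], with the
    denominators cleared. *)
Definition forward_rec (u v lam mu : R) (F : nat -> R) : Prop :=
  is_lim_seq F 1 /\ forall n : nat,
    (INR n + u) * (INR n + v) * F n =
    ((INR n + u) * (INR n + v) + lam) * F (S n) + mu ^ 2 * F (S (S n)).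

(** The same for [Smat]. With [v - u = l] one has [(u - m + 1) (v - m - 1) + lam - l + 1 = (u - m)
    (v - m) + lam], which accounts for the correction [- l + 1] in [Smat]. *)
Definition backward_rec (u v lam mu : R) (T : nat -> R) : Prop :=
  is_lim_seq T 1 /\ forall m : nat,
    (u - INR m + 1) * (v - INR m - 1) * (v - INR m - 2) * T m =
    (v - INR m - 2) * ((u - INR m) * (v - INR m) + lam) * T (S m)
    + mu ^ 2 * (v - INR m) * T (S (S m)).

(* [V] is the Casoratian of [A] with the solution that is recessive at [+oo],
   rescaled so that no infinite product of coefficients appears. *)
Lemma forward_recessive (u v lam mu : R) (A : Z -> R) (F : nat -> R) (n0 : nat) :
  not_int v -> bounded_seq A -> forward_rec u v lam mu F ->
  (forall n, (n0 < n)%nat -> heun_op u v lam mu A (Z.of_nat n) = 0) ->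
  forall n, (n0 <= n)%nat ->
    mu * A (Z.of_nat n) * F (S (S n)) = (INR n + 1 + u) * A (Z.of_nat n + 1)%Z * F (S n).
Proof.
  intros Hv [K HA] [LF HF] H.
  destruct (lim_1_bounded F LF) as [KF BF].
  set (V := fun n : nat => mu * A (Z.of_nat n) * F (S (S n))
     - (INR n + 1 + u) * A (Z.of_nat n + 1)%Z * F (S n)).
  assert (K0 : 0 <= K) by (apply Rle_trans with (2 := HA 0%Z); apply Rabs_pos).
  assert (KF0 : 0 <= KF) by (apply Rle_trans with (2 := BF O); apply Rabs_pos).
  destruct (INR_unbounded (2 * Rabs mu + Rabs v)) as [N HN].
  enough (forall n, (n0 <= n)%nat -> V n = 0) as E.
  { intros n hn. specialize (E n hn). unfold V in E. lra. }
  (* [(n + 1 + v) V n = - mu V (n + 1)] follows from the equation at index [n + 1], hence the strict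
     inequality in the hypothesis on [A]. [V] grows at most linearly because [A] and [F] are
     bounded. *)
  apply (recessive_vanish V (fun n => INR n + 1 + v) (fun _ => - mu)
    ((Rabs mu + 1 + Rabs u) * (K * KF)) n0 N).
  - intros n hn. specialize (H (S n) ltac:(lia)). specialize (HF (S n)).
    unfold heun_op in H. unfold V.
    replace (Z.of_nat (S n)) with (Z.of_nat n + 1)%Z in * by lia.
    replace (Z.of_nat n + 1 - 1)%Z with (Z.of_nat n) in H by lia.
    rewrite plus_IZR, <- INR_IZR_INZ in H. rewrite S_INR in *.
    set (a0 := A (Z.of_nat n)) in *. set (a1 := A (Z.of_nat n + 1)%Z) in *.
    set (a2 := A (Z.of_nat n + 1 + 1)%Z) in *. set (x := INR n + 1) in *.
    transitivity (mu * (x + v) * a0 * F (S (S n)) - a1 * ((x + u) * (x + v) * F (S n))); [ring|].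
    rewrite HF.
    replace (mu * (x + v) * a0) with (((x + u) * (x + v) + lam) * a1 + mu * (x + 1 + u) * a2) by lra.
    ring.
  - intros n. replace (INR n + 1 + v) with (IZR (Z.of_nat n + 1) + v) by
      (rewrite plus_IZR, <- INR_IZR_INZ; ring).
    now apply not_int_neq_0.
  - intros n hn. rewrite Rabs_Ropp. apply le_INR in hn.
    apply Rle_trans with (INR n + 1 + v); [|apply Rle_abs].
    generalize (Rle_abs (- v)). rewrite Rabs_Ropp. lra.
  - intros n. unfold V, Rminus. eapply Rle_trans; [apply Rabs_triang|].
    rewrite Rabs_Ropp, !Rabs_mult. assert (Pn := pos_INR n).
    assert (KK : forall i j, Rabs (A i) * Rabs (F j) <= K * KF) by
      (intros; apply Rmult_le_compat; auto using Rabs_pos).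
    assert (K1 : 0 <= K * KF) by (apply Rmult_le_pos; auto).
    assert (M0 := Rabs_pos mu). assert (U0 := Rabs_pos u).
    assert (X1 : Rabs (INR n + 1 + u) <= INR n + 1 + Rabs u).
    { eapply Rle_trans; [apply Rabs_triang|]. rewrite (Rabs_right (INR n + 1)); lra. }
    rewrite !Rmult_assoc.
    apply Rle_trans with (Rabs mu * (K * KF) + (INR n + 1 + Rabs u) * (K * KF)).
    + apply Rplus_le_compat; apply Rmult_le_compat; auto using Rabs_pos;
        try apply Rmult_le_pos; auto using Rabs_pos; lra.
    + assert (X2 : Rabs mu + (INR n + 1 + Rabs u) <= (Rabs mu + 1 + Rabs u) * (INR n + 1)) by nra.
      apply (Rmult_le_compat_r (K * KF)) in X2; auto. lra.
Qed.

(** Counterpart of [forward_recessive]: the left side [U m] satisfies [(u - m + 1) (v - m - 2) U m =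
    mu (v - m) U (m + 1)], where the left coefficient outgrows the right one, and [U] is at most
    linear. Here the equation at [- m] itself is used, hence the weak inequality. *)
Lemma backward_recessive (u v lam mu : R) (A : Z -> R) (T : nat -> R) (m0 : nat) :
  not_int u -> not_int v -> bounded_seq A -> backward_rec u v lam mu T ->
  (forall m, (m0 <= m)%nat -> heun_op u v lam mu A (- Z.of_nat m) = 0) ->
  forall m, (m0 <= m)%nat ->
    (v - INR m - 1) * A (- Z.of_nat m)%Z * T m + mu * A (1 - Z.of_nat m)%Z * T (S m) = 0.
Proof.
  intros Hu Hv [K HA] [LT HT] H.
  destruct (lim_1_bounded T LT) as [KT BT].
  set (U := fun m : nat => (v - INR m - 1) * A (- Z.of_nat m)%Z * T m
     + mu * A (1 - Z.of_nat m)%Z * T (S m)).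
  assert (K0 : 0 <= K) by (apply Rle_trans with (2 := HA 0%Z); apply Rabs_pos).
  assert (KT0 : 0 <= KT) by (apply Rle_trans with (2 := BT O); apply Rabs_pos).
  destruct (INR_unbounded (2 * Rabs mu + Rabs v + Rabs u + 1)) as [N HN].
  change (forall m, (m0 <= m)%nat -> U m = 0).
  apply (recessive_vanish U (fun m => (u - INR m + 1) * (v - INR m - 2))
    (fun m => mu * (v - INR m)) ((Rabs mu + 1 + Rabs v) * (K * KT)) m0 N).
  - intros m hm. specialize (H m ltac:(lia)). specialize (HT m).
    unfold heun_op in H. unfold U.
    replace (- Z.of_nat (S m))%Z with (- Z.of_nat m - 1)%Z by lia.
    replace (1 - Z.of_nat (S m))%Z with (- Z.of_nat m)%Z by lia.
    replace (- Z.of_nat m + 1)%Z with (1 - Z.of_nat m)%Z in H by lia.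
    rewrite opp_IZR, <- INR_IZR_INZ in H. rewrite S_INR.
    set (a0 := A (- Z.of_nat m)%Z) in *. set (a1 := A (1 - Z.of_nat m)%Z) in *.
    set (a2 := A (- Z.of_nat m - 1)%Z) in *. set (x := INR m) in *.
    transitivity (a0 * ((u - x + 1) * (v - x - 1) * (v - x - 2) * T m)
      + (v - x - 2) * (mu * (- x + 1 + u) * a1) * T (S m)); [ring|].
    rewrite HT.
    replace (mu * (- x + 1 + u) * a1) with
      (mu * (- x + v) * a2 - ((- x + u) * (- x + v) + lam) * a0) by lra.
    ring.
  - intros m. destruct (backward_denominators u v m Hu Hv) as [N1 [_ N3]].
    now apply Rmult_integral_contrapositive_currified.
  - intros m hm. apply le_INR in hm. rewrite !Rabs_mult.
    generalize (Rle_abs v) (Rle_abs u) (Rle_abs (- v)) (Rle_abs (- u)) (Rabs_pos mu).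
    rewrite !Rabs_Ropp. intros.
    rewrite (Rabs_left (v - INR m)), (Rabs_left (v - INR m - 2)), (Rabs_left (u - INR m + 1)) by lra.
    rewrite <- Rmult_assoc. apply Rmult_le_compat; lra.
  - intros m. unfold U. eapply Rle_trans; [apply Rabs_triang|].
    rewrite !Rabs_mult. assert (Pn := pos_INR m).
    assert (KK : forall i j, Rabs (A i) * Rabs (T j) <= K * KT) by
      (intros; apply Rmult_le_compat; auto using Rabs_pos).
    assert (K1 : 0 <= K * KT) by (apply Rmult_le_pos; auto).
    assert (M0 := Rabs_pos mu). assert (V0 := Rabs_pos v).
    assert (X1 : Rabs (v - INR m - 1) <= INR m + 1 + Rabs v).
    { replace (v - INR m - 1) with (v + - (INR m + 1)) by ring.
      eapply Rle_trans; [apply Rabs_triang|]. rewrite Rabs_Ropp, (Rabs_right (INR m + 1)); lra. }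
    rewrite !Rmult_assoc.
    apply Rle_trans with ((INR m + 1 + Rabs v) * (K * KT) + Rabs mu * (K * KT)).
    + apply Rplus_le_compat; apply Rmult_le_compat; auto using Rabs_pos;
        try apply Rmult_le_pos; auto using Rabs_pos; lra.
    + assert (X2 : Rabs mu + (INR m + 1 + Rabs v) <= (Rabs mu + 1 + Rabs v) * (INR m + 1)) by nra.
      apply (Rmult_le_compat_r (K * KT)) in X2; auto. lra.
Qed.

(** Two consecutive zeros propagate through the recurrence to all larger indices, against the limit
    [1]. *)
Lemma forward_no_double_zero (u v lam mu : R) (F : nat -> R) (n : nat) :
  mu <> 0 -> forward_rec u v lam mu F -> F n = 0 -> F (S n) = 0 -> False.
Proof.
  intros Hm [LF HF] E1 E2. apply (lim_1_not_eventually_0 F n LF).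
  assert (P : forall j, F (n + j)%nat = 0 /\ F (S (n + j)) = 0).
  { induction j as [|j [A B]].
    - rewrite Nat.add_0_r. auto.
    - rewrite Nat.add_succ_r. split; auto. specialize (HF (n + j)%nat).
      rewrite A, B, !Rmult_0_r, Rplus_0_l in HF. symmetry in HF.
      apply Rmult_integral in HF. destruct HF as [HF|HF]; auto.
      apply pow_nonzero with (n := 2%nat) in Hm. contradiction. }
  intros k hk. replace k with (n + (k - n))%nat by lia. apply P.
Qed.

Lemma backward_no_double_zero (u v lam mu : R) (T : nat -> R) (m : nat) :
  mu <> 0 -> not_int v -> backward_rec u v lam mu T -> T m = 0 -> T (S m) = 0 -> False.
Proof.
  intros Hm Hv [LT HT] E1 E2. apply (lim_1_not_eventually_0 T m LT).
  assert (P : forall j, T (m + j)%nat = 0 /\ T (S (m + j)) = 0).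
  { induction j as [|j [A B]].
    - rewrite Nat.add_0_r. auto.
    - rewrite Nat.add_succ_r. split; auto. specialize (HT (m + j)%nat).
      rewrite A, B, !Rmult_0_r, Rplus_0_l in HT. symmetry in HT.
      apply Rmult_integral in HT. destruct HT as [HT|HT]; auto.
      apply Rmult_integral in HT. destruct HT as [HT|HT].
      + apply pow_nonzero with (n := 2%nat) in Hm. contradiction.
      + exfalso. apply (Hv (Z.of_nat (m + j))). rewrite <- INR_IZR_INZ. lra. }
  intros k hk. replace k with (m + (k - m))%nat by lia. apply P.
Qed.

(** At index zero the two recessive relations read [mu F2 A0 - (1 + u) F1 A1 = 0] and
    [(v - 1) T0 A0 + mu T1 A1 = 0]; this is the determinant of that linear system in [A0], [A1]. *)
Definition matching (u v mu : R) (F T : nat -> R) : R :=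
  (u + 1) * (v - 1) * F 1%nat * T 0%nat + mu ^ 2 * F 2%nat * T 1%nat.

Lemma matching_neq_0_unique (u v lam mu : R) (A : Z -> R) (F T : nat -> R) :
  not_int u -> not_int v -> forward_rec u v lam mu F -> backward_rec u v lam mu T ->
  matching u v mu F T <> 0 -> bounded_seq A ->
  (forall k, heun_op u v lam mu A k = 0) -> forall k, A k = 0.
Proof.
  intros Hu Hv HF HT HD BA H.
  destruct (Req_dec mu 0) as [h|Hm].
  (* For [mu = 0] the recurrence is diagonal. Nonvanishing of [F 1] and of [T 0], pushed along their
     recurrences, excludes zeros of [(k + u) (k + v) + lam] for [k >= 1] and for [k <= 0]
     respectively. *)
  - subst mu. unfold matching in HD. unfold heun_op in H.
    assert (F1 : F 1%nat <> 0) by (intros E; apply HD; rewrite E; ring).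
    assert (T0 : T 0%nat <> 0) by (intros E; apply HD; rewrite E; ring).
    assert (ZF : forall n, F (S n) <> 0 /\ (INR (S n) + u) * (INR (S n) + v) + lam <> 0).
    { assert (S1 : forall n, F (S n) <> 0 ->
        F (S (S n)) <> 0 /\ (INR (S n) + u) * (INR (S n) + v) + lam <> 0).
      { intros n En. destruct HF as [_ HF]. specialize (HF (S n)).
        assert (E1 : (INR (S n) + u) * (INR (S n) + v) * F (S n) <> 0).
        { rewrite INR_IZR_INZ.
          apply Rmult_integral_contrapositive_currified; auto.
          apply Rmult_integral_contrapositive_currified; now apply not_int_neq_0. }
        split; intros E; apply E1; rewrite HF, E; ring. }
      assert (NZ : forall n, F (S n) <> 0) by (induction n as [|n IH]; [auto|exact (proj1 (S1 n IH))]).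
      intros n. split; [apply NZ|exact (proj2 (S1 n (NZ n)))]. }
    assert (ZT : forall m, T m <> 0 /\ (u - INR m) * (v - INR m) + lam <> 0).
    { assert (S1 : forall m, T m <> 0 ->
        T (S m) <> 0 /\ (u - INR m) * (v - INR m) + lam <> 0).
      { intros m Em. destruct HT as [_ HT]. specialize (HT m).
        assert (E1 : (u - INR m + 1) * (v - INR m - 1) * (v - INR m - 2) * T m <> 0).
        { destruct (backward_denominators u v m Hu Hv) as [N1 [N2 N3]].
          repeat apply Rmult_integral_contrapositive_currified; auto. }
        split; intros E; apply E1; rewrite HT, E; ring. }
      assert (NZ : forall m, T m <> 0) by (induction m as [|m IH]; [auto|exact (proj1 (S1 m IH))]).
      intros m. split; [apply NZ|exact (proj2 (S1 m (NZ m)))]. }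
    intros k. specialize (H k).
    assert (Z : (IZR k + u) * (IZR k + v) + lam <> 0).
    { destruct (Z_le_gt_dec k 0) as [hk|hk].
      - destruct (ZT (Z.to_nat (- k))) as [_ Z]. rewrite INR_IZR_INZ, Z2Nat.id, opp_IZR in Z by lia.
        intros E. apply Z. rewrite <- E. ring.
      - destruct (ZF (Z.to_nat (k - 1))) as [_ Z].
        replace (S (Z.to_nat (k - 1))) with (Z.to_nat k) in Z by lia.
        rewrite INR_IZR_INZ, Z2Nat.id in Z by lia. exact Z. }
    apply Rmult_eq_reg_l with (2 := Z). lra.
  (* Cramer's rule with determinant [matching] gives [A 0 = A 1 = 0]; the outer coefficients of the
     recurrence are nonzero, so zero spreads in both directions. *)
  - assert (EV := forward_recessive u v lam mu A F 0 Hv BA HF (fun n _ => H _) 0 (le_n _)).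
    assert (EU := backward_recessive u v lam mu A T 0 Hu Hv BA HT (fun n _ => H _) 0 (le_n _)).
    simpl in EV, EU.
    assert (A0 : A 0%Z = 0).
    { apply Rmult_eq_reg_l with (2 := HD). unfold matching.
      transitivity ((u + 1) * F 1%nat * ((v - 0 - 1) * A 0%Z * T 0%nat + mu * A 1%Z * T 1%nat)
        + mu * T 1%nat * (mu * A 0%Z * F 2%nat - (0 + 1 + u) * A 1%Z * F 1%nat)); [ring|].
      rewrite EU, EV. ring. }
    assert (A1 : A 1%Z = 0).
    { apply Rmult_eq_reg_l with (2 := HD). unfold matching.
      transitivity (mu * F 2%nat * ((v - 0 - 1) * A 0%Z * T 0%nat + mu * A 1%Z * T 1%nat)
        - (v - 1) * T 0%nat * (mu * A 0%Z * F 2%nat - (0 + 1 + u) * A 1%Z * F 1%nat)); [ring|].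
      rewrite EU, EV. ring. }
    assert (Pos : forall n : nat, A (Z.of_nat n) = 0 /\ A (Z.of_nat n + 1)%Z = 0).
    { induction n as [|n [I1 I2]]; [auto|].
      replace (Z.of_nat (S n)) with (Z.of_nat n + 1)%Z by lia. split; auto.
      specialize (H (Z.of_nat n + 1)%Z). unfold heun_op in H.
      replace (Z.of_nat n + 1 - 1)%Z with (Z.of_nat n) in H by lia.
      rewrite I1, I2 in H.
      assert (E : mu * (IZR (Z.of_nat n + 1) + 1 + u) * A (Z.of_nat n + 1 + 1)%Z = 0) by lra.
      apply Rmult_integral in E. destruct E as [E|E]; auto.
      apply Rmult_integral in E. destruct E as [E|E]; [contradiction|].
      exfalso. apply (not_int_neq_0 u (Z.of_nat n + 1 + 1) Hu). rewrite (plus_IZR _ 1). exact E. }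
    assert (Neg : forall n : nat, A (- Z.of_nat n)%Z = 0 /\ A (- Z.of_nat n + 1)%Z = 0).
    { induction n as [|n [I1 I2]]; [auto|].
      replace (- Z.of_nat (S n))%Z with (- Z.of_nat n - 1)%Z by lia.
      replace (- Z.of_nat n - 1 + 1)%Z with (- Z.of_nat n)%Z by lia. split; auto.
      specialize (H (- Z.of_nat n)%Z). unfold heun_op in H. rewrite I1, I2 in H.
      assert (E : mu * (IZR (- Z.of_nat n) + v) * A (- Z.of_nat n - 1)%Z = 0) by lra.
      apply Rmult_integral in E. destruct E as [E|E]; auto.
      apply Rmult_integral in E. destruct E as [E|E]; [contradiction|].
      exfalso. now apply (not_int_neq_0 v (- Z.of_nat n) Hv). }
    intros k. destruct (Z_le_gt_dec 0 k) as [hk|hk].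
    + rewrite <- (Z2Nat.id k hk). apply Pos.
    + replace k with (- Z.of_nat (Z.to_nat (- k)))%Z by lia. apply Neg.
Qed.

(** Away from [k0] the equation is homogeneous, so a bounded [A] obeys the recessive relation on
    each side. If the two relations are compatible, the equation at [k0] is satisfied with right
    side zero, and one is impossible there. *)
Lemma matching_eq_0_obstruction (u v lam mu : R) (F T : nat -> R) :
  not_int u -> not_int v -> forward_rec u v lam mu F -> backward_rec u v lam mu T ->
  matching u v mu F T = 0 ->
  exists k0 : Z, forall A, bounded_seq A ->
    ~ forall k, heun_op u v lam mu A k = if Z.eqb k k0 then 1 else 0.
Proof.
  intros Hu Hv HF HT HD. unfold matching in HD.
  assert (U1 : u + 1 <> 0) by (rewrite Rplus_comm; now apply (not_int_neq_0 u 1)).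
  assert (V1 : v - 1 <> 0).
  { replace (v - 1) with (IZR (-1) + v) by ring. now apply not_int_neq_0. }
  destruct (Req_dec mu 0) as [h|Hm].
  - subst mu.
    (* For [mu = 0] the source is put at a zero of the diagonal coefficient. If there were none,
       [F 1 = 0] or [T 0 = 0] would spread along the whole sequence, against its limit [1]. *)
    assert (E : exists k : Z, (IZR k + u) * (IZR k + v) + lam = 0).
    { apply NNPP. intros C.
      assert (C' : forall k : Z, (IZR k + u) * (IZR k + v) + lam <> 0).
      { intros k E. apply C. now exists k. }
      assert (FT : F 1%nat = 0 \/ T 0%nat = 0).
      { apply Rmult_integral. apply Rmult_eq_reg_l with ((u + 1) * (v - 1)).
        - rewrite Rmult_0_r, <- HD. ring.
        - now apply Rmult_integral_contrapositive_currified. }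
      destruct FT as [F1|T0].
      - destruct HF as [LF HF]. apply (lim_1_not_eventually_0 F 1 LF).
        intros n hn. replace n with (S (n - 1)) by lia.
        induction (n - 1)%nat as [|j IH]; auto.
        specialize (HF (S j)). rewrite IH in HF. rewrite INR_IZR_INZ in HF.
        apply Rmult_eq_reg_l with (2 := C' (Z.of_nat (S j))). lra.
      - destruct HT as [LT HT]. apply (lim_1_not_eventually_0 T 0 LT).
        intros m _. induction m as [|m IH]; auto.
        specialize (HT m). rewrite IH, INR_IZR_INZ in HT.
        apply Rmult_eq_reg_l with
          ((v - IZR (Z.of_nat m) - 2) * ((u - IZR (Z.of_nat m)) * (v - IZR (Z.of_nat m)) + lam)).
        + lra.
        + apply Rmult_integral_contrapositive_currified.
          * replace (v - IZR (Z.of_nat m) - 2) with (IZR (- Z.of_nat m - 2) + v) by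
              (rewrite minus_IZR, opp_IZR; ring).
            now apply not_int_neq_0.
          * specialize (C' (- Z.of_nat m)%Z). rewrite opp_IZR in C'.
            intros E. apply C'. rewrite <- E. ring. }
    destruct E as [k E]. exists k. intros A _ H. specialize (H k).
    rewrite Z.eqb_refl in H. unfold heun_op in H. rewrite E in H. lra.
  (* A source at [0] leads to [F 1 * T 1 = 0], which says nothing when [T 1 = 0]. In that case
     [F 1 = 0] as well, and the source is moved to [1]. *)
  - destruct (Req_dec (T 1%nat) 0) as [T1|T1].
    + exists 1%Z. intros A BA H.
      assert (T0 : T 0%nat <> 0) by
        (intros T0; exact (backward_no_double_zero u v lam mu T 0 Hm Hv HT T0 T1)).
      assert (F1 : F 1%nat = 0).
      { apply Rmult_eq_reg_l with ((u + 1) * (v - 1) * T 0%nat).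
        - rewrite T1 in HD. lra.
        - repeat apply Rmult_integral_contrapositive_currified; auto. }
      assert (F2 : F 2%nat <> 0) by
        (intros F2; exact (forward_no_double_zero u v lam mu F 1 Hm HF F1 F2)).
      assert (EU : (v - INR 0 - 1) * A 0%Z * T 0%nat + mu * A 1%Z * T 1%nat = 0).
      { apply (backward_recessive u v lam mu A T 0 Hu Hv BA HT); auto.
        intros m _. rewrite H. now destruct m. }
      assert (EV : mu * A 1%Z * F 3%nat = (INR 1 + 1 + u) * A 2%Z * F 2%nat).
      { apply (forward_recessive u v lam mu A F 1 Hv BA HF) with (n := 1%nat); auto.
        intros n hn. rewrite H. destruct (Z.eqb_spec (Z.of_nat n) 1); auto. lia. }
      assert (A0 : A 0%Z = 0).
      { apply Rmult_eq_reg_l with ((v - 1) * T 0%nat).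
        - rewrite T1 in EU. simpl in EU. lra.
        - now apply Rmult_integral_contrapositive_currified. }
      specialize (H 1%Z). unfold heun_op in H. simpl in H. rewrite A0 in H.
      (* With [F 1 = 0] the recurrence of [F] at [1], together with [EV], annihilates the left side
         of the equation at [1] multiplied by [F 2]; what remains is [F 2 = 0]. *)
      destruct HF as [_ HF]. specialize (HF 1%nat). rewrite F1 in HF. simpl in EV, HF.
      apply F2.
      transitivity (F 2%nat * (((1 + u) * (1 + v) + lam) * A 1%Z + mu * (1 + 1 + u) * A 2%Z - mu * (1 + v) * 0));
        [rewrite H; ring|].
      transitivity (A 1%Z * (((1 + u) * (1 + v) + lam) * F 2%nat) + mu * ((1 + 1 + u) * A 2%Z * F 2%nat));
        [ring|].
      rewrite <- EV.
      transitivity (A 1%Z * (((1 + u) * (1 + v) + lam) * F 2%nat + mu * (mu * 1) * F 3%nat)); [ring|].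
      rewrite <- HF. ring.
    + exists 0%Z. intros A BA H.
      assert (EV : mu * A 0%Z * F 2%nat = (INR 0 + 1 + u) * A 1%Z * F 1%nat).
      { apply (forward_recessive u v lam mu A F 0 Hv BA HF) with (n := 0%nat); auto.
        intros n hn. rewrite H. destruct (Z.eqb_spec (Z.of_nat n) 0); auto. lia. }
      assert (EU : (v - INR 1 - 1) * A (-1)%Z * T 1%nat + mu * A 0%Z * T 2%nat = 0).
      { apply (backward_recessive u v lam mu A T 1 Hu Hv BA HT) with (m := 1%nat); auto.
        intros m hm. rewrite H. destruct (Z.eqb_spec (- Z.of_nat m) 0); auto. lia. }
      specialize (H 0%Z). unfold heun_op in H. simpl in H, EV, EU.
      destruct HT as [_ HT]. specialize (HT 0%nat). simpl in HT.
      set (U0 := (v - 1) * A 0%Z * T 0%nat + mu * A 1%Z * T 1%nat).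
      assert (V2 : v - 2 <> 0).
      { replace (v - 2) with (IZR (-2) + v) by ring. now apply not_int_neq_0. }
      (* The backward relation fails at [m = 0] because of the source; its defect is computed
         exactly. *)
      assert (EU0 : (u + 1) * U0 = T 1%nat).
      { apply Rmult_eq_reg_l with (2 := V2). unfold U0.
        transitivity (A 0%Z * ((u - 0 + 1) * (v - 0 - 1) * (v - 0 - 2) * T 0%nat)
          + (v - 2) * (mu * (0 + 1 + u) * A 1%Z) * T 1%nat); [ring|].
        rewrite HT.
        replace (mu * (0 + 1 + u) * A 1%Z) with
          (1 + mu * (0 + v) * A (-1)%Z - ((0 + u) * (0 + v) + lam) * A 0%Z) by lra.
        transitivity ((v - 2) * T 1%nat
          + mu * v * ((v - 1 - 1) * A (-1)%Z * T 1%nat + mu * A 0%Z * T 2%nat)); [ring|].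
        rewrite EU. ring. }
      assert (FT : F 1%nat * T 1%nat = 0).
      { rewrite <- EU0. unfold U0.
        transitivity (A 0%Z * ((u + 1) * (v - 1) * F 1%nat * T 0%nat)
          + mu * T 1%nat * ((0 + 1 + u) * A 1%Z * F 1%nat)); [ring|].
        rewrite <- EV.
        transitivity (A 0%Z * ((u + 1) * (v - 1) * F 1%nat * T 0%nat + mu ^ 2 * F 2%nat * T 1%nat));
          [ring|].
        rewrite HD. ring. }
      apply Rmult_integral in FT. destruct FT as [F1|]; [|contradiction].
      assert (F2 : F 2%nat <> 0) by
        (intros F2; exact (forward_no_double_zero u v lam mu F 1 Hm HF F1 F2)).
      rewrite F1 in HD.
      assert (Q : mu ^ 2 * F 2%nat * T 1%nat <> 0).
      { repeat apply Rmult_integral_contrapositive_currified; auto. }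
      apply Q. lra.
Qed.

(** * Fourier coefficients *)

(** Restates an equality in the carrier of a normed module as one in [R], where [ring] and [field]
    apply. *)
Ltac real_eq := match goal with |- @eq _ ?x ?y => change (@eq R x y) end.

Lemma RInt_lin (u v : R -> R) (p q a b : R) :
  cont u -> cont v ->
  RInt (fun t => p * u t + q * v t) a b = p * RInt u a b + q * RInt v a b.
Proof.
  intros Hu Hv. apply is_RInt_unique.
  apply (is_RInt_plus (V := R_NormedModule) (fun t => p * u t) (fun t => q * v t)).
  - apply (is_RInt_scal (V := R_NormedModule) u a b p).
    apply (RInt_correct (V := R_CompleteNormedModule)). now apply cont_ex_RInt.
  - apply (is_RInt_scal (V := R_NormedModule) v a b q).
    apply (RInt_correct (V := R_CompleteNormedModule)). now apply cont_ex_RInt.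
Qed.

Lemma RInt_of_derive (f df : R -> R) (a b : R) :
  cont df -> (forall t, is_derive f t (df t)) -> RInt df a b = f b - f a.
Proof.
  intros Hc H. apply is_RInt_unique.
  apply (is_RInt_derive (V := R_CompleteNormedModule) f df); auto.
Qed.

Lemma RInt_eq (f g : R -> R) (a b : R) : (forall t, f t = g t) -> RInt f a b = RInt g a b.
Proof. intros H. apply RInt_ext. intros t _. apply H. Qed.

Lemma RInt_constant (k a b : R) : RInt (fun _ => k) a b = (b - a) * k.
Proof. apply (RInt_const (V := R_CompleteNormedModule)). Qed.

Lemma RInt_split (g : R -> R) (a b c : R) :
  cont g -> RInt g a c = RInt g a b + RInt g b c.
Proof.
  intros Hg. symmetry.
  apply (RInt_Chasles (V := R_CompleteNormedModule)); now apply cont_ex_RInt.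
Qed.

Lemma cont_bounded (f : R -> R) (a b : R) :
  a <= b -> cont f -> exists M, forall t, a <= t <= b -> Rabs (f t) <= M.
Proof.
  intros Hab Hf.
  assert (Hc : cont (fun t => Rabs (f t))).
  { intros t. apply (continuous_comp f Rabs); [apply Hf|].
    apply continuity_pt_filterlim. apply Rcontinuity_abs. }
  destruct (continuity_ab_maj (fun t => Rabs (f t)) a b Hab) as [x [Hx _]].
  - intros t _. apply continuity_pt_filterlim. apply Hc.
  - exists (Rabs (f x)). exact Hx.
Qed.

(** By the product-to-sum formula, a factor [cos t] turns the moment [k] into the mean of the
    moments [k + 1] and [k - 1], so all of them stay zero. *)
Lemma cos_moments_kernel (f : R -> R) (ka : R) :
  cont f -> (forall k : Z, RInt (fun t => f t * cos (IZR k * t)) 0 (2 * PI) = 0) ->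
  forall (n : nat) (k : Z),
    RInt (fun t => f t * (ka - cos t) ^ n * cos (IZR k * t)) 0 (2 * PI) = 0.
Proof.
  intros Hf H. induction n as [|n IH]; intros k.
  - eapply eq_trans; [|exact (H k)]. apply RInt_eq. intros t. simpl. ring.
  - set (g := fun (j : Z) t => f t * (ka - cos t) ^ n * cos (IZR j * t)).
    assert (Cg : forall j, cont (g j)) by (intros j; unfold g; cont_tac).
    assert (C2 : cont (fun t => 1 * g (k + 1)%Z t + 1 * g (k - 1)%Z t)).
    { assert (C3 := Cg (k + 1)%Z). assert (C4 := Cg (k - 1)%Z). cont_tac. }
    transitivity (RInt (fun t => ka * g k t + (- / 2) *
      (1 * g (k + 1)%Z t + 1 * g (k - 1)%Z t)) 0 (2 * PI)).
    + apply RInt_eq. intros t. unfold g. rewrite plus_IZR, minus_IZR.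
      replace ((IZR k + 1) * t) with (IZR k * t + t) by ring.
      replace ((IZR k - 1) * t) with (IZR k * t - t) by ring.
      rewrite cos_plus, cos_minus. simpl. field.
    + rewrite (RInt_lin (g k) _ _ _ _ _ (Cg k) C2).
      rewrite (RInt_lin (g (k + 1)%Z) (g (k - 1)%Z)) by auto.
      unfold g. rewrite !IH. real_eq. ring.
Qed.

(* Integrating [f] against even powers of [1 - cos t - cos d], a kernel which exceeds 1
   exactly for [|t - PI| < d]. *)
Lemma cos_moments_nonpos (f : R -> R) :
  cont f -> (forall k : Z, RInt (fun t => f t * cos (IZR k * t)) 0 (2 * PI) = 0) ->
  f PI <= 0.
Proof.
  intros Hf H. apply Rnot_lt_le. intros Hpos. assert (P := PI_RGT_0).
  set (m := f PI / 2). assert (Hm : 0 < m) by (unfold m; lra).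
  assert (Hd : exists d, 0 < d /\ d <= PI / 2 /\ forall t, Rabs (t - PI) < d -> m <= f t).
  { assert (Cp : continuity_pt f PI) by (apply continuity_pt_filterlim, Hf).
    destruct (Cp m Hm) as [d [d0 Hd]]. simpl in Hd. unfold Rdist in Hd.
    exists (Rmin d (PI / 2)). split; [apply Rmin_pos; lra|]. split; [apply Rmin_r|].
    intros t Ht. destruct (Req_dec t PI) as [->|ne]; [unfold m; lra|].
    assert (A : Rabs (f t - f PI) < m).
    { apply Hd. split.
      - split; [exact I|auto].
      - eapply Rlt_le_trans; [exact Ht|apply Rmin_l]. }
    apply Rabs_lt_between in A. unfold m in *. lra. }
  destruct Hd as [d [d0 [d1 Hd]]].
  destruct (cont_bounded f 0 (2 * PI)) as [M HM]; auto; [lra|].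
  set (Q := fun t => 1 - cos d - cos t).
  set (eta := cos (d / 2) - cos d).
  assert (He : 0 < eta).
  { unfold eta. generalize (cos_decreasing_1 (d / 2) d). intros X.
    assert (cos d < cos (d / 2)) by (apply X; lra). lra. }
  assert (cosd : 0 <= cos d) by (apply cos_ge_0; lra).
  assert (Cos : forall t, cos t = - cos (Rabs (t - PI))).
  { intros t. unfold Rabs. destruct (Rcase_abs _).
    - rewrite cos_neg, cos_minus, cos_PI, sin_PI. ring.
    - rewrite cos_minus, cos_PI, sin_PI. ring. }
  assert (Qn : forall n t, 0 <= Q t ^ (2 * n)).
  { intros n t. rewrite pow_mult. apply pow_le, pow2_ge_0. }
  assert (CQ1 : cont Q) by (unfold Q; cont_tac).
  assert (CQ : forall n, cont (fun t => Q t ^ n)) by (intros n; cont_tac).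
  (* For [|t - PI| <= d / 2] one has [Q t >= 1 + eta], so the mass of the kernel is unbounded in
     [n]; the even exponent keeps the remaining part nonnegative. *)
  assert (Low : forall n, 2 * (d / 2) * (1 + eta) ^ (2 * n) <= RInt (fun t => Q t ^ (2 * n)) 0 (2 * PI)).
  { intros n. set (g := fun t => Q t ^ (2 * n)).
    assert (Eg : forall a b, ex_RInt g a b) by (intros; apply cont_ex_RInt, CQ).
    rewrite (RInt_split g 0 (PI - d / 2) (2 * PI)) by apply CQ.
    rewrite (RInt_split g (PI - d / 2) (PI + d / 2) (2 * PI)) by apply CQ.
    assert (0 <= RInt g 0 (PI - d / 2)) by (apply RInt_ge_0; auto; [lra|intros; apply Qn]).
    assert (0 <= RInt g (PI + d / 2) (2 * PI)) by (apply RInt_ge_0; auto; [lra|intros; apply Qn]).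
    assert (X : RInt (fun _ => (1 + eta) ^ (2 * n)) (PI - d / 2) (PI + d / 2) <=
      RInt g (PI - d / 2) (PI + d / 2)).
    { apply RInt_le; auto; [lra|apply ex_RInt_const|].
      intros t Ht. apply pow_incr. split; [lra|]. unfold Q, eta. rewrite (Cos t).
      assert (Y : Rabs (t - PI) <= d / 2) by (apply Rabs_le; lra).
      assert (cos (d / 2) <= cos (Rabs (t - PI))); [|lra].
      apply cos_decr_1; try lra. apply Rabs_pos. }
    rewrite RInt_constant in X.
    replace (PI + d / 2 - (PI - d / 2)) with (2 * (d / 2)) in X by ring. lra. }
  (* Everywhere [f Q^(2 n) >= m Q^(2 n) - (m + M)]: near [PI] because [f >= m], elsewhere because
     [|Q| <= 1]. The left side integrates to zero, so the mass is bounded. *)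
  assert (Up : forall n, m * RInt (fun t => Q t ^ (2 * n)) 0 (2 * PI) <= (m + M) * (2 * PI)).
  { intros n.
    assert (Z : RInt (fun t => f t * Q t ^ (2 * n)) 0 (2 * PI) = 0).
    { eapply eq_trans; [|exact (cos_moments_kernel f (1 - cos d) Hf H (2 * n) 0)].
      apply RInt_eq. intros t. rewrite Rmult_0_l, cos_0. unfold Q. ring. }
    assert (Cm : cont (fun t => m * Q t ^ (2 * n) + - (m + M) * 1)).
    { cont_tac. }
    assert (Le : RInt (fun t => m * Q t ^ (2 * n) + - (m + M) * 1) 0 (2 * PI) <=
      RInt (fun t => f t * Q t ^ (2 * n)) 0 (2 * PI)).
    { apply RInt_le; [lra|now apply cont_ex_RInt| |].
      - apply cont_ex_RInt. cont_tac.
      - intros t Ht. specialize (Qn n t).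
        assert (Bt := HM t ltac:(lra)). apply Rabs_le_between in Bt.
        destruct (Rlt_dec (Rabs (t - PI)) d) as [h|h].
        + specialize (Hd t h). nra.
        + assert (Q1 : Q t ^ (2 * n) <= 1).
          { rewrite pow_mult. rewrite <- (pow1 n). apply pow_incr.
            split; [apply pow2_ge_0|].
            assert (cos (Rabs (t - PI)) <= cos d).
            { assert (Rabs (t - PI) <= PI) by (apply Rabs_le; lra). apply cos_decr_1; lra. }
            assert (B1 := COS_bound t). rewrite (Cos t) in B1.
            unfold Q. rewrite (Cos t). assert (cos d <= 1) by apply COS_bound.
            set (z := cos (Rabs (t - PI))) in *. nra. }
          assert (m * Q t ^ (2 * n) <= m) by nra.
          assert (- M <= f t * Q t ^ (2 * n)); [|lra].
          assert (0 <= M) by lra. nra. }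
    rewrite (RInt_lin (fun t => Q t ^ (2 * n)) (fun _ => 1)), Z in Le; [|apply CQ|apply cont_const].
    rewrite RInt_constant in Le. lra. }
  destruct (INR_unbounded ((m + M) * (2 * PI) / (m * d * (2 * eta)))) as [n Hn].
  specialize (Low n). specialize (Up n).
  assert (B : 1 + INR (2 * n) * eta <= (1 + eta) ^ (2 * n)) by (apply poly; auto).
  rewrite mult_INR in B. change (INR 2) with 2 in B.
  assert (Md : 0 < m * d * (2 * eta)) by (repeat apply Rmult_lt_0_compat; lra).
  apply (Rmult_lt_compat_r (m * d * (2 * eta))) in Hn; auto.
  unfold Rdiv in Hn. rewrite (Rmult_assoc ((m + M) * _)), Rinv_l in Hn by lra.
  assert (m * (2 * (d / 2) * (1 + 2 * INR n * eta)) <= (m + M) * (2 * PI)).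
  { eapply Rle_trans; [|exact Up]. apply Rmult_le_compat_l; [lra|].
    eapply Rle_trans; [|exact Low]. apply Rmult_le_compat_l; lra. }
  assert (0 < m * d) by (apply Rmult_lt_0_compat; lra). lra.
Qed.

(** Cosine moments see only the part of [f] that is even about [PI], so the conclusion concerns that
    point alone; a single point is enough for [trace_matching_zero]. *)
Lemma cos_moments_zero (f : R -> R) :
  cont f -> (forall k : Z, RInt (fun t => f t * cos (IZR k * t)) 0 (2 * PI) = 0) ->
  f PI = 0.
Proof.
  intros Hf H. apply Rle_antisym; [now apply cos_moments_nonpos|].
  enough (- f PI <= 0) by lra.
  apply (cos_moments_nonpos (fun t => - f t)).
  - cont_tac.
  - intros k. transitivity (RInt (fun t => -1 * (f t * cos (IZR k * t)) + 0 * 0) 0 (2 * PI)).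
    + apply RInt_eq. intros t. ring.
    + rewrite (RInt_lin (fun t => f t * cos (IZR k * t)) (fun _ => 0)), H;
        [real_eq; ring|cont_tac|cont_tac].
Qed.

(* The real part of the Fourier coefficient of [f1 + i f2] at frequency [th]. *)
Definition fcoef (f1 f2 : R -> R) (th : R) : R :=
  RInt (fun t => f1 t * cos (th * t) + f2 t * sin (th * t)) 0 (2 * PI).

Lemma fcoef_bounded (f1 f2 : R -> R) :
  cont f1 -> cont f2 -> exists K, forall th, Rabs (fcoef f1 f2 th) <= K.
Proof.
  intros H1 H2. assert (P := PI_RGT_0).
  destruct (cont_bounded f1 0 (2 * PI)) as [M1 B1]; auto; [lra|].
  destruct (cont_bounded f2 0 (2 * PI)) as [M2 B2]; auto; [lra|].
  exists ((2 * PI - 0) * (M1 + M2)). intros th. unfold fcoef.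
  apply abs_RInt_le_const; [lra|apply cont_ex_RInt; cont_tac|].
  intros t Ht. eapply Rle_trans; [apply Rabs_triang|]. rewrite !Rabs_mult.
  specialize (B1 t Ht). specialize (B2 t Ht).
  assert (Rabs (cos (th * t)) <= 1) by (apply Rabs_le; generalize (COS_bound (th * t)); lra).
  assert (Rabs (sin (th * t)) <= 1) by (apply Rabs_le; generalize (SIN_bound (th * t)); lra).
  generalize (Rabs_pos (f1 t)) (Rabs_pos (f2 t)). intros.
  apply Rplus_le_compat.
  - rewrite <- (Rmult_1_r M1). apply Rmult_le_compat; auto using Rabs_pos.
  - rewrite <- (Rmult_1_r M2). apply Rmult_le_compat; auto using Rabs_pos.
Qed.

(** Twisting by [exp (- i s t)] reduces to integer frequencies, and the mean of the coefficients at
    [k] and [- k] is a cosine moment. The second hypothesis does the same for [i F]; at [PI] the two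
    results form a rotation of [(f1, f2)], which is inverted. *)
Lemma fcoef_zero (f1 f2 : R -> R) (s : R) :
  cont f1 -> cont f2 ->
  (forall k : Z, fcoef f1 f2 (IZR k + s) = 0) ->
  (forall k : Z, fcoef (fun t => - f2 t) f1 (IZR k + s) = 0) ->
  f1 PI = 0 /\ f2 PI = 0.
Proof.
  intros C1 C2 H1 H2.
  assert (main : forall f1 f2, cont f1 -> cont f2 ->
    (forall k : Z, fcoef f1 f2 (IZR k + s) = 0) ->
    f1 PI * cos (s * PI) + f2 PI * sin (s * PI) = 0).
  { clear f1 f2 C1 C2 H1 H2. intros f1 f2 C1 C2 H.
    apply (cos_moments_zero (fun t => f1 t * cos (s * t) + f2 t * sin (s * t))); [cont_tac|].
    intros k. set (w := fun (j : Z) t => f1 t * cos ((IZR j + s) * t) + f2 t * sin ((IZR j + s) * t)).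
    assert (Cw : forall j, cont (w j)) by (intros j; unfold w; cont_tac).
    transitivity (RInt (fun t => / 2 * w k t + / 2 * w (- k)%Z t) 0 (2 * PI)).
    - apply RInt_eq. intros t. unfold w. rewrite opp_IZR.
      replace ((IZR k + s) * t) with (s * t + IZR k * t) by ring.
      replace ((- IZR k + s) * t) with (s * t - IZR k * t) by ring.
      rewrite cos_plus, cos_minus, sin_plus, sin_minus. field.
    - rewrite RInt_lin by auto. specialize (H k) as Ha. specialize (H (- k)%Z) as Hb.
      unfold fcoef in Ha, Hb. unfold w. rewrite Ha, Hb. real_eq. ring. }
  assert (E1 := main f1 f2 C1 C2 H1).
  assert (E2 := main (fun t => - f2 t) f1 ltac:(cont_tac) C1 H2). cbv beta in E2.
  assert (S := sin2_cos2 (s * PI)). unfold Rsqr in S.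
  set (co := cos (s * PI)) in *. set (si := sin (s * PI)) in *.
  split.
  - transitivity (f1 PI * (si * si + co * co)); [rewrite S; ring|].
    transitivity (co * (f1 PI * co + f2 PI * si) + si * (- f2 PI * co + f1 PI * si)); [ring|].
    rewrite E1, E2. ring.
  - transitivity (f2 PI * (si * si + co * co)); [rewrite S; ring|].
    transitivity (si * (f1 PI * co + f2 PI * si) - co * (- f2 PI * co + f1 PI * si)); [ring|].
    rewrite E1, E2. ring.
Qed.

(* With [F = f1 + i f2], [G = g1 + i g2], [z = exp (i t)] and [D = -i d/dt] this is the
   system [D F = (l/2 + mu z) F + a G], [D G = -(l/2 + mu/z) G - a F + h exp (i th0 t)]. *)
Definition heun_system (a l mu h th0 : R) (f1 f2 g1 g2 : R -> R) : Prop :=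
  forall t,
    is_derive f1 t (- ((l / 2 + mu * cos t) * f2 t + mu * sin t * f1 t) - a * g2 t) /\
    is_derive f2 t ((l / 2 + mu * cos t) * f1 t - mu * sin t * f2 t + a * g1 t) /\
    is_derive g1 t ((l / 2 + mu * cos t) * g2 t - mu * sin t * g1 t + a * f2 t
      - h * sin (th0 * t)) /\
    is_derive g2 t (- ((l / 2 + mu * cos t) * g1 t + mu * sin t * g2 t) - a * f1 t
      + h * cos (th0 * t)).

(* [F (2 PI) = exp (i r PI) F 0] *)
Definition quasi_periodic (r : R) (f1 f2 : R -> R) : Prop :=
  f1 (2 * PI) = cos (r * PI) * f1 0 - sin (r * PI) * f2 0 /\
  f2 (2 * PI) = sin (r * PI) * f1 0 + cos (r * PI) * f2 0.

Lemma cos_sin_period (r : R) (k : Z) :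
  cos ((IZR k + r / 2) * (2 * PI)) = cos (r * PI) /\
  sin ((IZR k + r / 2) * (2 * PI)) = sin (r * PI).
Proof.
  replace ((IZR k + r / 2) * (2 * PI)) with (r * PI + 2 * (IZR k * PI)) by field.
  rewrite cos_plus, sin_plus, cos_2a_sin, sin_2a, sin_IZR_PI. split; ring.
Qed.

(** With [th = k + r / 2], [exp (2 PI i th) = exp (i r PI)], so [Im (F exp (- i th t))] takes equal
    values at both ends of the period: the boundary term of the integrations that follow. *)
Lemma quasi_periodic_boundary (r : R) (k : Z) (f1 f2 : R -> R) :
  quasi_periodic r f1 f2 ->
  f2 (2 * PI) * cos ((IZR k + r / 2) * (2 * PI)) - f1 (2 * PI) * sin ((IZR k + r / 2) * (2 * PI))
  - (f2 0 * cos ((IZR k + r / 2) * 0) - f1 0 * sin ((IZR k + r / 2) * 0)) = 0.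
Proof.
  intros [E1 E2]. destruct (cos_sin_period r k) as [-> ->].
  rewrite Rmult_0_r, cos_0, sin_0, E1, E2.
  assert (S := sin2_cos2 (r * PI)). unfold Rsqr in S.
  set (c := cos (r * PI)) in *. set (s := sin (r * PI)) in *.
  transitivity (f2 0 * (s * s + c * c) - f2 0); [ring|rewrite S; ring].
Qed.

Lemma RInt_cos_int (k : Z) :
  RInt (fun t => cos (IZR k * t)) 0 (2 * PI) = if Z.eqb k 0 then 2 * PI else 0.
Proof.
  destruct (Z.eqb_spec k 0) as [->|h].
  - transitivity (RInt (fun _ => 1) 0 (2 * PI)).
    + apply RInt_eq. intros t. now rewrite Rmult_0_l, cos_0.
    + rewrite RInt_constant. real_eq. ring.
  - assert (hk : IZR k <> 0) by now apply not_0_IZR.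
    rewrite (RInt_of_derive (fun t => sin (IZR k * t) / IZR k)).
    + replace (IZR k * (2 * PI)) with (2 * (IZR k * PI)) by ring.
      rewrite sin_2a, sin_IZR_PI, !Rmult_0_r, sin_0. real_eq. field. auto.
    + cont_tac.
    + intros t. derive_tac. field. auto.
Qed.

Lemma heun_system_cont (a l mu h th0 : R) (f1 f2 g1 g2 : R -> R) :
  heun_system a l mu h th0 f1 f2 g1 g2 -> cont f1 /\ cont f2 /\ cont g1 /\ cont g2.
Proof.
  intros H. repeat split; intros t; apply (ex_derive_continuous (V := R_NormedModule));
    destruct (H t) as [A [B [C D]]]; eexists; eassumption.
Qed.

(** Integrate the derivative of [Im (F exp (- i th t))] over a period; the factor [z = exp (i t)] of
    the system lowers the frequency by one. *)
Lemma heun_system_fcoef1 (a l mu h th0 r : R) (f1 f2 g1 g2 : R -> R) (k : Z) :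
  heun_system a l mu h th0 f1 f2 g1 g2 -> quasi_periodic r f1 f2 ->
  let A := fun k => fcoef f1 f2 (IZR k + r / 2) in
  let B := fun k => fcoef g1 g2 (IZR k + r / 2) in
  (IZR k + (r - l) / 2) * A k - mu * A (k - 1)%Z = a * B k.
Proof.
  intros H HP A B.
  destruct (heun_system_cont _ _ _ _ _ _ _ _ _ H) as [C1 [C2 [C3 C4]]].
  assert (Bd := quasi_periodic_boundary r k f1 f2 HP).
  set (th := IZR k + r / 2) in *.
  set (wf := fun th t => f1 t * cos (th * t) + f2 t * sin (th * t)).
  set (wg := fun th t => g1 t * cos (th * t) + g2 t * sin (th * t)).
  assert (Cf : forall th, cont (wf th)) by (intros; unfold wf; cont_tac).
  assert (Cg : forall th, cont (wg th)) by (intros; unfold wg; cont_tac).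
  assert (Cf0 := Cf th). assert (Cf1 := Cf (th - 1)). assert (Cg0 := Cg th).
  set (d := fun t => 1 * ((l / 2 - th) * wf th t + mu * wf (th - 1) t) + a * wg th t).
  assert (Cd : cont d) by (unfold d; cont_tac).
  assert (E : RInt d 0 (2 * PI) = 0).
  { eapply eq_trans; [|exact Bd]. apply (RInt_of_derive (fun t => f2 t * cos (th * t) - f1 t * sin (th * t))); auto.
    intros t. destruct (H t) as [D1 [D2 _]]. derive_tac.
    unfold d, wf, wg.
    replace ((th - 1) * t) with (th * t - t) by ring. rewrite cos_minus, sin_minus. ring. }
  unfold d in E.
  rewrite (RInt_lin (fun t => (l / 2 - th) * wf th t + mu * wf (th - 1) t) (wg th)) in E
    by (auto; cont_tac).
  rewrite RInt_lin in E by auto.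
  unfold A, B, fcoef. rewrite minus_IZR. fold th.
  replace (IZR k - 1 + r / 2) with (th - 1) by (unfold th; ring).
  fold (wf th) (wf (th - 1)) (wg th).
  replace (IZR k + (r - l) / 2) with (th - l / 2) by (unfold th; field). lra.
Qed.

Lemma heun_system_fcoef2 (a l mu h r : R) (f1 f2 g1 g2 : R -> R) (k k0 : Z) :
  heun_system a l mu h (IZR k0 + r / 2) f1 f2 g1 g2 -> quasi_periodic r g1 g2 ->
  let A := fun k => fcoef f1 f2 (IZR k + r / 2) in
  let B := fun k => fcoef g1 g2 (IZR k + r / 2) in
  (IZR k + (r + l) / 2) * B k + mu * B (k + 1)%Z + a * A k =
    if Z.eqb k k0 then h * (2 * PI) else 0.
Proof.
  intros H HP A B.
  destruct (heun_system_cont _ _ _ _ _ _ _ _ _ H) as [C1 [C2 [C3 C4]]].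
  assert (Bd := quasi_periodic_boundary r k g1 g2 HP).
  set (th := IZR k + r / 2) in *.
  set (wf := fun th t => f1 t * cos (th * t) + f2 t * sin (th * t)).
  set (wg := fun th t => g1 t * cos (th * t) + g2 t * sin (th * t)).
  assert (Cf : forall th, cont (wf th)) by (intros; unfold wf; cont_tac).
  assert (Cg : forall th, cont (wg th)) by (intros; unfold wg; cont_tac).
  assert (Cf0 := Cf th). assert (Cg1 := Cg (th + 1)). assert (Cg0 := Cg th).
  (* Real part of the source after multiplication by [exp (- i th t)]; its integral vanishes unless
     [k = k0]. *)
  set (e := fun t => cos (IZR (k0 - k) * t)).
  assert (Ce : cont e) by (unfold e; cont_tac).
  set (d := fun t => 1 * ((- (l / 2) - th) * wg th t + - mu * wg (th + 1) t)
     + 1 * (- a * wf th t + h * e t)).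
  assert (Cd : cont d) by (unfold d; cont_tac).
  assert (E : RInt d 0 (2 * PI) = 0).
  { eapply eq_trans; [|exact Bd]. apply (RInt_of_derive (fun t => g2 t * cos (th * t) - g1 t * sin (th * t))); auto.
    intros t. destruct (H t) as [_ [_ [D1 D2]]]. derive_tac.
    unfold d, wf, wg, e.
    replace ((th + 1) * t) with (th * t + t) by ring.
    replace (IZR (k0 - k) * t) with ((IZR k0 + r / 2) * t - th * t) by
      (rewrite minus_IZR; unfold th; ring).
    rewrite cos_plus, sin_plus, cos_minus. ring. }
  unfold d in E.
  rewrite (RInt_lin (fun t => (- (l / 2) - th) * wg th t + - mu * wg (th + 1) t)
    (fun t => - a * wf th t + h * e t)) in E by cont_tac.
  rewrite !RInt_lin in E by auto.
  unfold e in E. rewrite RInt_cos_int in E.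
  replace (Z.eqb (k0 - k) 0) with (Z.eqb k k0) in E by
    (destruct (Z.eqb_spec k k0), (Z.eqb_spec (k0 - k) 0); auto; lia).
  unfold A, B, fcoef. rewrite plus_IZR. fold th.
  replace (IZR k + 1 + r / 2) with (th + 1) by (unfold th; ring).
  fold (wf th) (wg (th + 1)) (wg th).
  replace (IZR k + (r + l) / 2) with (th + l / 2) by (unfold th; field).
  destruct (Z.eqb k k0); lra.
Qed.

(** Elimination of [B] between the two first-order relations. The coupling contributes [a^2] and the
    two opposite shifts [- mu^2], which is the origin of [lam = a^2 - mu^2]. *)
Lemma heun_system_op (a l mu h r : R) (f1 f2 g1 g2 : R -> R) (k0 : Z) :
  heun_system a l mu h (IZR k0 + r / 2) f1 f2 g1 g2 ->
  quasi_periodic r f1 f2 -> quasi_periodic r g1 g2 ->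
  let A := fun k => fcoef f1 f2 (IZR k + r / 2) in
  bounded_seq A /\
  forall k, heun_op ((r - l) / 2) ((r + l) / 2) (a ^ 2 - mu ^ 2) mu A k =
    if Z.eqb k k0 then 2 * PI * a * h else 0.
Proof.
  intros H P1 P2 A. split.
  - destruct (heun_system_cont _ _ _ _ _ _ _ _ _ H) as [C1 [C2 _]].
    destruct (fcoef_bounded f1 f2 C1 C2) as [K HK]. exists K. intros k. apply HK.
  - intros k.
    assert (E1 := heun_system_fcoef1 _ _ _ _ _ r _ _ _ _ k H P1).
    assert (E2 := heun_system_fcoef1 _ _ _ _ _ r _ _ _ _ (k + 1) H P1).
    assert (E3 := heun_system_fcoef2 _ _ _ _ r _ _ _ _ k k0 H P2).
    cbv zeta beta in E1, E2, E3.
    set (B := fun k => fcoef g1 g2 (IZR k + r / 2)).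
    replace (k + 1 - 1)%Z with k in E2 by lia.
    change (fcoef f1 f2 (IZR k + r / 2)) with (A k) in *.
    change (fcoef f1 f2 (IZR (k - 1) + r / 2)) with (A (k - 1)%Z) in *.
    change (fcoef f1 f2 (IZR (k + 1) + r / 2)) with (A (k + 1)%Z) in *.
    change (fcoef g1 g2 (IZR k + r / 2)) with (B k) in *.
    change (fcoef g1 g2 (IZR (k + 1) + r / 2)) with (B (k + 1)%Z) in *.
    rewrite plus_IZR in E2. unfold heun_op.
    transitivity ((IZR k + (r + l) / 2) * ((IZR k + (r - l) / 2) * A k - mu * A (k - 1)%Z)
      + mu * ((IZR k + 1 + (r - l) / 2) * A (k + 1)%Z - mu * A k) + a ^ 2 * A k); [ring|].
    rewrite E1, E2.
    transitivity (a * ((IZR k + (r + l) / 2) * B k + mu * B (k + 1)%Z + a * A k)); [ring|].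
    rewrite E3. destruct (Z.eqb k k0); ring.
Qed.

(* The substitution [F = exp (mu cos t) (x + i y)], [G = - i exp (mu cos t) (x - i y)] for the
   complex-valued pair [x = x1 + i x2], [y = y1 + i y2]. *)
Lemma gauge_heun_system (a l mu h th0 : R) (x1 y1 x2 y2 : R -> R) :
  let c := fun t => l / 2 + mu * cos t in
  let p := fun t => h / 2 * exp (- (mu * cos t)) * cos (th0 * t) in
  let q := fun t => h / 2 * exp (- (mu * cos t)) * sin (th0 * t) in
  (forall t, is_derive x1 t (a * x1 t - c t * y1 t - p t) /\
             is_derive y1 t (c t * x1 t - a * y1 t + q t)) ->
  (forall t, is_derive x2 t (a * x2 t - c t * y2 t - q t) /\
             is_derive y2 t (c t * x2 t - a * y2 t - p t)) ->
  heun_system a l mu h th0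
    (fun t => exp (mu * cos t) * (x1 t - y2 t)) (fun t => exp (mu * cos t) * (x2 t + y1 t))
    (fun t => exp (mu * cos t) * (x2 t - y1 t)) (fun t => exp (mu * cos t) * (- x1 t - y2 t)).
Proof.
  intros c p q H1 H2 t.
  destruct (H1 t) as [X1 Y1], (H2 t) as [X2 Y2]. clear H1 H2.
  assert (E : exp (mu * cos t) * exp (- (mu * cos t)) = 1).
  { rewrite <- exp_plus, Rplus_opp_r. apply exp_0. }
  set (e := exp (mu * cos t)) in *.
  assert (Ep : h * cos (th0 * t) = 2 * e * p t).
  { unfold p. transitivity (h * (e * exp (- (mu * cos t))) * cos (th0 * t)); [rewrite E; ring|field]. }
  assert (Eq : h * sin (th0 * t) = 2 * e * q t).
  { unfold q. transitivity (h * (e * exp (- (mu * cos t))) * sin (th0 * t)); [rewrite E; ring|field]. }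
  rewrite Ep, Eq. change (l / 2 + mu * cos t) with (c t).
  assert (D : is_derive (fun t => exp (mu * cos t)) t (- mu * sin t * e)).
  { derive_tac. unfold e. ring. }
  unfold e. split; [|split; [|split]].
  - eapply is_derive_eq; [apply (D_mult (fun t => exp (mu * cos t)) (fun t => x1 t - y2 t)); [exact D|derive_rec]|].
    unfold e, c. ring.
  - eapply is_derive_eq; [apply (D_mult (fun t => exp (mu * cos t)) (fun t => x2 t + y1 t)); [exact D|derive_rec]|].
    unfold e, c. ring.
  - eapply is_derive_eq; [apply (D_mult (fun t => exp (mu * cos t)) (fun t => x2 t - y1 t)); [exact D|derive_rec]|].
    unfold e, c. ring.
  - eapply is_derive_eq; [apply (D_mult (fun t => exp (mu * cos t)) (fun t => - x1 t - y2 t)); [exact D|derive_rec]|].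
    unfold e, c. ring.
Qed.

Lemma gauge_quasi_periodic (mu r : R) (f1 f2 : R -> R) :
  quasi_periodic r f1 f2 ->
  quasi_periodic r (fun t => exp (mu * cos t) * f1 t) (fun t => exp (mu * cos t) * f2 t).
Proof.
  intros [E1 E2]. unfold quasi_periodic. rewrite cos_2PI, cos_0, E1, E2. split; ring.
Qed.

(** * Forced systems, and the equivalence of the trace condition with the matching condition *)

Lemma forced_solution (a : R) (c p1 q1 p2 q2 f g : R -> R) (T : R) :
  fundamental a c p1 q1 p2 q2 -> cont f -> cont g ->
  exists d1 d2, forall e1 e2, exists x y : R -> R,
    (forall t, is_derive x t (a * x t - c t * y t + f t) /\
               is_derive y t (c t * x t - a * y t + g t)) /\
    x 0 = e1 /\ y 0 = e2 /\
    x T = e1 * p1 T + e2 * p2 T + d1 /\ y T = e1 * q1 T + e2 * q2 T + d2.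
Proof.
  intros HF Cf Cg. assert (Det := fundamental_det _ _ _ _ _ _ HF).
  destruct HF as [[H1 [P0 Q0]] [H2 [P0' Q0']]].
  assert (C1 : cont p1) by (apply (cont_of_derive _ _ (fun t => proj1 (H1 t)))).
  assert (C2 : cont q1) by (apply (cont_of_derive _ _ (fun t => proj2 (H1 t)))).
  assert (C3 : cont p2) by (apply (cont_of_derive _ _ (fun t => proj1 (H2 t)))).
  assert (C4 : cont q2) by (apply (cont_of_derive _ _ (fun t => proj2 (H2 t)))).
  assert (Cu : cont (fun t => f t * q2 t - g t * p2 t)) by cont_tac.
  assert (Cv : cont (fun t => p1 t * g t - q1 t * f t)) by cont_tac.
  assert (Du := cont_RInt_derive _ 0 Cu). assert (Dv := cont_RInt_derive _ 0 Cv).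
  (* Variation of constants: Cramer's rule with determinant one gives the integrands of [u] and [v].
     Neither depends on the initial data, so the period map is affine with the fixed translation
     [(d1, d2)]. *)
  set (u := fun t => RInt (fun t => f t * q2 t - g t * p2 t) 0 t) in Du.
  set (v := fun t => RInt (fun t => p1 t * g t - q1 t * f t) 0 t) in Dv.
  assert (u0 : u 0 = 0) by (unfold u; apply (RInt_point (V := R_CompleteNormedModule))).
  assert (v0 : v 0 = 0) by (unfold v; apply (RInt_point (V := R_CompleteNormedModule))).
  exists (u T * p1 T + v T * p2 T), (u T * q1 T + v T * q2 T). intros e1 e2.
  exists (fun t => (e1 + u t) * p1 t + (e2 + v t) * p2 t),
    (fun t => (e1 + u t) * q1 t + (e2 + v t) * q2 t).
  split; [|rewrite u0, v0, P0, Q0, P0', Q0'; repeat split; ring].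
  intros t. destruct (H1 t) as [A1 B1], (H2 t) as [A2 B2].
  specialize (Du t). specialize (Dv t). cbv beta in Du, Dv. specialize (Det t).
  split; derive_tac.
  - transitivity (a * ((e1 + u t) * p1 t + (e2 + v t) * p2 t)
      - c t * ((e1 + u t) * q1 t + (e2 + v t) * q2 t) + f t * (p1 t * q2 t - q1 t * p2 t));
      [ring|rewrite Det; ring].
  - transitivity (c t * ((e1 + u t) * p1 t + (e2 + v t) * p2 t)
      - a * ((e1 + u t) * q1 t + (e2 + v t) * q2 t) + g t * (p1 t * q2 t - q1 t * p2 t));
      [ring|rewrite Det; ring].
Qed.

(* [(zeta - P)^-1 = (1 - conj zeta * adj P) / (2 Re zeta - tr P)] for [|zeta| = 1, det P = 1]. *)
Lemma resolvent_system (p11 p12 p21 p22 k s a1 b1 a2 b2 : R) :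
  p11 * p22 - p21 * p12 = 1 -> s * s + k * k = 1 -> p11 + p22 <> 2 * k ->
  exists x1 y1 x2 y2,
    (x1 * p11 + y1 * p12 + a1 = k * x1 - s * x2 /\ x1 * p21 + y1 * p22 + b1 = k * y1 - s * y2) /\
    (x2 * p11 + y2 * p12 + a2 = s * x1 + k * x2 /\ x2 * p21 + y2 * p22 + b2 = s * y1 + k * y2).
Proof.
  intros D S H.
  set (w1 := p22 * a1 - p12 * b1). set (z1 := - p21 * a1 + p11 * b1).
  set (w2 := p22 * a2 - p12 * b2). set (z2 := - p21 * a2 + p11 * b2).
  set (De := 2 * k - (p11 + p22)). assert (HD : De <> 0) by (unfold De; lra).
  assert (Pw1 : w1 * p11 + z1 * p12 = a1) by
    (unfold w1, z1; transitivity ((p11 * p22 - p21 * p12) * a1); [ring|rewrite D; ring]).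
  assert (Pz1 : w1 * p21 + z1 * p22 = b1) by
    (unfold w1, z1; transitivity ((p11 * p22 - p21 * p12) * b1); [ring|rewrite D; ring]).
  assert (Pw2 : w2 * p11 + z2 * p12 = a2) by
    (unfold w2, z2; transitivity ((p11 * p22 - p21 * p12) * a2); [ring|rewrite D; ring]).
  assert (Pz2 : w2 * p21 + z2 * p22 = b2) by
    (unfold w2, z2; transitivity ((p11 * p22 - p21 * p12) * b2); [ring|rewrite D; ring]).
  exists ((a1 - (k * w1 + s * w2)) / De), ((b1 - (k * z1 + s * z2)) / De),
    ((a2 - (k * w2 - s * w1)) / De), ((b2 - (k * z2 - s * z1)) / De).
  repeat split; apply Rmult_eq_reg_r with (2 := HD); field_simplify; auto.
  - transitivity (a1 * p11 + b1 * p12 - k * (w1 * p11 + z1 * p12) - s * (w2 * p11 + z2 * p12)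
      + De * a1); [ring|]. rewrite Pw1, Pw2.
    transitivity (k * a1 - s * a2 - w1 * (s * s + k * k)); [|ring].
    rewrite S. unfold De, w1. ring.
  - transitivity (a1 * p21 + b1 * p22 - k * (w1 * p21 + z1 * p22) - s * (w2 * p21 + z2 * p22)
      + De * b1); [ring|]. rewrite Pz1, Pz2.
    transitivity (k * b1 - s * b2 - z1 * (s * s + k * k)); [|ring].
    rewrite S. unfold De, z1. ring.
  - transitivity (a2 * p11 + b2 * p12 - k * (w2 * p11 + z2 * p12) + s * (w1 * p11 + z1 * p12)
      + De * a2); [ring|]. rewrite Pw1, Pw2.
    transitivity (k * a2 + s * a1 - w2 * (s * s + k * k)); [|ring].
    rewrite S. unfold De, w2. ring.
  - transitivity (a2 * p21 + b2 * p22 - k * (w2 * p21 + z2 * p22) + s * (w1 * p21 + z1 * p22)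
      + De * b2); [ring|]. rewrite Pz1, Pz2.
    transitivity (k * b2 + s * b1 - z2 * (s * s + k * k)); [|ring].
    rewrite S. unfold De, z2. ring.
Qed.

Lemma quasi_periodic_combine (r : R) (x1 y1 x2 y2 : R -> R) :
  quasi_periodic r x1 x2 -> quasi_periodic r y1 y2 ->
  quasi_periodic r (fun t => x1 t - y2 t) (fun t => x2 t + y1 t) /\
  quasi_periodic r (fun t => x2 t - y1 t) (fun t => - x1 t - y2 t).
Proof.
  intros [A B] [C D]. unfold quasi_periodic. rewrite A, B, C, D. repeat split; ring.
Qed.

(** Multiplication by [i]. As [fcoef] is only a real part, the rotated solution supplies the
    imaginary parts of the coefficients. *)
Lemma heun_system_rotate (a l mu th r : R) (f1 f2 g1 g2 : R -> R) :
  heun_system a l mu 0 th f1 f2 g1 g2 ->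
  heun_system a l mu 0 th (fun t => - f2 t) f1 (fun t => - g2 t) g1.
Proof.
  intros H t. destruct (H t) as [A [B [C D]]].
  split; [|split; [|split]]; derive_tac; ring.
Qed.

Lemma quasi_periodic_rotate (r : R) (f1 f2 : R -> R) :
  quasi_periodic r f1 f2 -> quasi_periodic r (fun t => - f2 t) f1.
Proof. intros [A B]. unfold quasi_periodic. rewrite A, B. split; ring. Qed.

(** The coefficients of [F] vanish by uniqueness of bounded solutions; the first-order relation then
    reads [a B k = 0]. *)
Lemma heun_system_vanish (a l mu r : R) (F T : nat -> R) (f1 f2 g1 g2 : R -> R) :
  let u := (r - l) / 2 in let v := (r + l) / 2 in
  a <> 0 -> not_int u -> not_int v ->
  forward_rec u v (a ^ 2 - mu ^ 2) mu F -> backward_rec u v (a ^ 2 - mu ^ 2) mu T ->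
  matching u v mu F T <> 0 ->
  heun_system a l mu 0 (IZR 0 + r / 2) f1 f2 g1 g2 ->
  quasi_periodic r f1 f2 -> quasi_periodic r g1 g2 ->
  forall k : Z, fcoef f1 f2 (IZR k + r / 2) = 0 /\ fcoef g1 g2 (IZR k + r / 2) = 0.
Proof.
  intros u v Ha Hu Hv HF HT HD HS P1 P2.
  destruct (heun_system_op _ _ _ _ _ _ _ _ _ _ HS P1 P2) as [BA HA].
  assert (Z : forall k : Z, fcoef f1 f2 (IZR k + r / 2) = 0).
  { apply (matching_neq_0_unique u v (a ^ 2 - mu ^ 2) mu
      (fun k => fcoef f1 f2 (IZR k + r / 2)) F T); auto.
    intros k. unfold u, v. rewrite HA. destruct (Z.eqb k 0); ring. }
  intros k. split; auto.
  assert (E := heun_system_fcoef1 _ _ _ _ _ r _ _ _ _ k HS P1). cbv zeta beta in E.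
  rewrite !Z in E. apply Rmult_eq_reg_l with (2 := Ha). rewrite <- E. ring.
Qed.

Lemma trace_matching_zero (a l mu r : R) (F T : nat -> R) (p1 q1 p2 q2 : R -> R) :
  let u := (r - l) / 2 in let v := (r + l) / 2 in
  a <> 0 -> not_int u -> not_int v -> sin (r * PI) <> 0 ->
  forward_rec u v (a ^ 2 - mu ^ 2) mu F -> backward_rec u v (a ^ 2 - mu ^ 2) mu T ->
  fundamental a (fun t => l / 2 + mu * cos t) p1 q1 p2 q2 ->
  p1 (2 * PI) + q2 (2 * PI) = 2 * cos (r * PI) ->
  matching u v mu F T = 0.
Proof.
  intros u v Ha Hu Hv Hs HF HT HU Htr. apply NNPP. intros HD.
  set (c := fun t => l / 2 + mu * cos t) in HU.
  assert (Det := fundamental_det _ _ _ _ _ _ HU).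
  set (K := cos (r * PI)) in *. set (s := sin (r * PI)) in *.
  assert (SC : s * s + K * K = 1) by (generalize (sin2_cos2 (r * PI)); unfold Rsqr; auto).
  destruct HU as [[H1 [P0 Q0]] [H2 [P0' Q0']]].
  set (P11 := p1 (2 * PI)) in *. set (P12 := p2 (2 * PI)).
  (* Floquet solution starting at the eigenvector [(P12, zeta - P11)] of the monodromy,
     [zeta = K + i s]; it is nonzero even when [P12 = 0], because [s <> 0]. *)
  set (x1 := fun t => P12 * p1 t + (K - P11) * p2 t).
  set (y1 := fun t => P12 * q1 t + (K - P11) * q2 t).
  set (x2 := fun t => 0 * p1 t + s * p2 t).
  set (y2 := fun t => 0 * q1 t + s * q2 t).
  assert (L1 : lin_sol a c x1 y1) by now apply lin_sol_comb.
  assert (L2 : lin_sol a c x2 y2) by now apply lin_sol_comb.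
  assert (D := Det (2 * PI)). fold P11 P12 in D.
  assert (QX : quasi_periodic r x1 x2).
  { unfold quasi_periodic, x1, x2. fold P11 P12 K s. rewrite P0, P0'. split; ring. }
  assert (QY : quasi_periodic r y1 y2).
  { unfold quasi_periodic, y1, y2. fold K s. rewrite Q0, Q0'.
    replace (q2 (2 * PI)) with (2 * K - P11) in * by lra. split; [|ring].
    lra. }
  destruct (quasi_periodic_combine r x1 y1 x2 y2 QX QY) as [QF QG].
  apply (gauge_quasi_periodic mu) in QF, QG.
  assert (HS : heun_system a l mu 0 (IZR 0 + r / 2)
    (fun t => exp (mu * cos t) * (x1 t - y2 t)) (fun t => exp (mu * cos t) * (x2 t + y1 t))
    (fun t => exp (mu * cos t) * (x2 t - y1 t)) (fun t => exp (mu * cos t) * (- x1 t - y2 t))).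
  { apply gauge_heun_system; intros t; [destruct (L1 t) as [A B]|destruct (L2 t) as [A B]];
      (split; eapply is_derive_eq; [exact A| |exact B|]); unfold c; field. }
  set (f1 := fun t => exp (mu * cos t) * (x1 t - y2 t)) in *.
  set (f2 := fun t => exp (mu * cos t) * (x2 t + y1 t)) in *.
  set (g1 := fun t => exp (mu * cos t) * (x2 t - y1 t)) in *.
  set (g2 := fun t => exp (mu * cos t) * (- x1 t - y2 t)) in *.
  assert (N1 := heun_system_vanish a l mu r F T f1 f2 g1 g2 Ha Hu Hv HF HT HD HS QF QG).
  assert (N2 := heun_system_vanish a l mu r F T _ f1 _ g1 Ha Hu Hv HF HT HD
    (heun_system_rotate _ _ _ _ r _ _ _ _ HS)
    (quasi_periodic_rotate r f1 f2 QF) (quasi_periodic_rotate r g1 g2 QG)).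
  destruct (heun_system_cont _ _ _ _ _ _ _ _ _ HS) as [C1 [C2 [C3 C4]]].
  destruct (fcoef_zero f1 f2 (r / 2) C1 C2 (fun k => proj1 (N1 k)) (fun k => proj1 (N2 k))) as [Z1 Z2].
  destruct (fcoef_zero g1 g2 (r / 2) C3 C4 (fun k => proj2 (N1 k)) (fun k => proj2 (N2 k))) as [Z3 Z4].
  unfold f1, f2, g1, g2 in Z1, Z2, Z3, Z4.
  assert (E0 : forall w, exp (mu * cos PI) * w = 0 -> w = 0).
  { intros w Hw. apply Rmult_integral in Hw. destruct Hw as [Hw|]; auto.
    generalize (exp_pos (mu * cos PI)). lra. }
  apply E0 in Z1, Z2, Z3, Z4.
  (* The imaginary part of the Floquet solution is [s (p2, q2)]; its vanishing at [PI] contradicts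
     the determinant one. *)
  assert (X2 : s * p2 PI = 0) by (unfold x2 in *; lra).
  assert (Y2 : s * q2 PI = 0) by (unfold y2 in *; lra).
  apply Rmult_integral in X2, Y2.
  destruct X2 as [|X2]; [contradiction|]. destruct Y2 as [|Y2]; [contradiction|].
  specialize (Det PI). rewrite X2, Y2 in Det. lra.
Qed.

Lemma trace_matching_nonzero (a l mu r : R) (F T : nat -> R) (p1 q1 p2 q2 : R -> R) :
  let u := (r - l) / 2 in let v := (r + l) / 2 in
  a <> 0 -> not_int u -> not_int v ->
  forward_rec u v (a ^ 2 - mu ^ 2) mu F -> backward_rec u v (a ^ 2 - mu ^ 2) mu T ->
  fundamental a (fun t => l / 2 + mu * cos t) p1 q1 p2 q2 ->
  p1 (2 * PI) + q2 (2 * PI) <> 2 * cos (r * PI) ->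
  matching u v mu F T <> 0.
Proof.
  intros u v Ha Hu Hv HF HT HU Htr HD. assert (P := PI_RGT_0).
  set (c := fun t => l / 2 + mu * cos t) in HU.
  destruct (matching_eq_0_obstruction u v _ mu F T Hu Hv HF HT HD) as [k0 Ob].
  (* Makes the source term [2 PI a h] of the recurrence equal to one. *)
  set (h := / (2 * PI * a)).
  set (th0 := IZR k0 + r / 2).
  set (p := fun t => h / 2 * exp (- (mu * cos t)) * cos (th0 * t)).
  set (q := fun t => h / 2 * exp (- (mu * cos t)) * sin (th0 * t)).
  assert (Cp : cont (fun t => - p t)) by (unfold p; cont_tac).
  assert (Cq : cont q) by (unfold q; cont_tac).
  assert (Cq' : cont (fun t => - q t)) by (unfold q; cont_tac).
  (* Real and imaginary parts of one complex system, with forcing [(- p, q)] and [(- q, - p)];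
     [resolvent_system] then selects the initial data that make the solution quasi-periodic. *)
  destruct (forced_solution a c _ _ _ _ _ _ (2 * PI) HU Cp Cq) as [a1 [b1 S1]].
  destruct (forced_solution a c _ _ _ _ _ _ (2 * PI) HU Cq' Cp) as [a2 [b2 S2]].
  assert (SC := sin2_cos2 (r * PI)). unfold Rsqr in SC.
  destruct (resolvent_system _ _ _ _ (cos (r * PI)) (sin (r * PI)) a1 b1 a2 b2
    (fundamental_det _ _ _ _ _ _ HU (2 * PI)) SC Htr) as [e1 [e2 [e3 [e4 [[R1 R2] [R3 R4]]]]]].
  destruct (S1 e1 e2) as [x1 [y1 [D1 [X10 [Y10 [X1 Y1]]]]]].
  destruct (S2 e3 e4) as [x2 [y2 [D2 [X20 [Y20 [X2 Y2]]]]]].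
  assert (QX : quasi_periodic r x1 x2).
  { unfold quasi_periodic. rewrite X1, X2, X10, X20, R1, R3. split; ring. }
  assert (QY : quasi_periodic r y1 y2).
  { unfold quasi_periodic. rewrite Y1, Y2, Y10, Y20, R2, R4. split; ring. }
  destruct (quasi_periodic_combine r x1 y1 x2 y2 QX QY) as [QF QG].
  apply (gauge_quasi_periodic mu) in QF, QG.
  assert (HS := gauge_heun_system a l mu h th0 x1 y1 x2 y2 D1 D2).
  destruct (heun_system_op _ _ _ _ _ _ _ _ _ _ HS QF QG) as [BA HA].
  apply (Ob _ BA). intros k. unfold u, v. rewrite HA.
  destruct (Z.eqb k k0); auto. unfold h. field. lra.
Qed.

(** * The products [R_k] and [T_m] as solutions of the recurrences, and the conclusion *)

Lemma partial_prod_ext (X X' : nat -> @matrix R 2 2) (k n : nat) :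
  (forall j, X j = X' j) -> partial_prod X k n = partial_prod X' k n.
Proof. intros H. induction n as [|n IH]; simpl; auto. now rewrite IH, H. Qed.

Lemma entry_inf_prod_ext (X X' : nat -> @matrix R 2 2) (k i j : nat) :
  (forall m, X m = X' m) -> (1 <= i <= 2)%nat -> (1 <= j <= 2)%nat ->
  entry (inf_prod X k) i j = entry (inf_prod X' k) i j.
Proof.
  intros H Hi Hj. unfold entry, inf_prod. rewrite !coeff_mat_bij by lia.
  f_equal. apply Lim_seq_ext. intros n. now rewrite (partial_prod_ext X X').
Qed.

Lemma Rmat_forward (r l mu lam : R) :
  not_int ((r - l) / 2) -> not_int ((r + l) / 2) ->
  exists F, forward_rec ((r - l) / 2) ((r + l) / 2) lam mu F /\
    entry (Rmat r l mu lam 1) 1 1 = F 1%nat /\ entry (Rmat r l mu lam 1) 2 1 = F 2%nat.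
Proof.
  set (u := (r - l) / 2). set (v := (r + l) / 2). intros Hu Hv.
  set (p := fun n : nat => lam / ((INR n + u) * (INR n + v))).
  set (q := fun n : nat => mu ^ 2 / ((INR n + u) * (INR n + v))).
  destruct (M_bound u v lam mu Hu Hv) as [K HK].
  destruct (inf_prod_companion p q K HK) as [E21 [Rec Lim]].
  assert (X : forall n, Mmat r l mu lam n = companion p q n).
  { intros n. unfold Mmat, companion, p, q.
    replace ((INR n + r / 2) ^ 2 - l ^ 2 / 4) with ((INR n + u) * (INR n + v)) by
      (unfold u, v; field). reflexivity. }
  exists (fun k => entry (inf_prod (companion p q) k) 1 1). split; [split; [exact Lim|]|].
  - intros n. rewrite Rec at 1. unfold p, q. rewrite INR_IZR_INZ.
    field. split; now apply not_int_neq_0.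
  - unfold Rmat. rewrite !(entry_inf_prod_ext _ _ _ _ _ X) by lia. split; auto.
Qed.

Lemma Tmat_backward (r l mu lam : R) :
  not_int ((r - l) / 2) -> not_int ((r + l) / 2) ->
  exists T, backward_rec ((r - l) / 2) ((r + l) / 2) lam mu T /\
    entry (Tmat r l mu lam 0) 1 1 = T 0%nat /\ entry (Tmat r l mu lam 0) 2 1 = T 1%nat.
Proof.
  intros Hu Hv. destruct (S_bound _ _ (lam - l + 1) mu Hu Hv) as [K HK].
  set (u := (r - l) / 2) in *. set (v := (r + l) / 2) in *.
  set (p := fun m : nat => (lam - l + 1) / ((u - INR m + 1) * (v - INR m - 1))).
  set (q := fun m : nat => mu ^ 2 * (v - INR m)
    / ((u - INR m + 1) * (v - INR m - 1) * (v - INR m - 2))).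
  destruct (inf_prod_companion p q K HK) as [E21 [Rec Lim]].
  assert (X : forall n, Smat r l mu lam n = companion p q n) by reflexivity.
  exists (fun k => entry (inf_prod (companion p q) k) 1 1). split; [split; [exact Lim|]|].
  - intros m. rewrite Rec at 1. unfold p, q.
    destruct (backward_denominators u v m Hu Hv) as [N1 [N2 N3]].
    replace l with (v - u) by (unfold u, v; field).
    field. auto.
  - unfold Tmat. rewrite !(entry_inf_prod_ext _ _ _ _ _ X) by lia. split; auto.
Qed.

Lemma not_Sigma_not_int (omega r B A : R) :
  ~ Sigma_pm omega r (B, A) ->
  not_int ((r - ell omega B) / 2) /\ not_int ((r + ell omega B) / 2).
Proof.
  intros H. unfold ell. split; intros n E; apply H.
  - left. exists (- n)%Z. rewrite opp_IZR. simpl. lra.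
  - right. exists n. simpl. lra.
Qed.

Theorem theorem5p10 :
  forall (omega r : R), 0 < omega -> (forall n : Z, r <> IZR n) ->
  forall B A : R,
    (L_pm omega r (B, A) /\ ~ Sigma_pm omega r (B, A)) <->
    (~ Sigma_pm omega r (B, A) /\
     let l := ell omega B in
     let m := mu omega A in
     let lam := lambda omega A in
     ((r - l) / 2 + 1) * ((r + l) / 2 - 1)
       * entry (Rmat r l m lam 1) 1 1 * entry (Tmat r l m lam 0) 1 1
     + m ^ 2 * entry (Rmat r l m lam 1) 2 1 * entry (Tmat r l m lam 0) 2 1 = 0).
Proof.
  intros omega r Ho Hr B A. cbv zeta. rewrite (and_comm (L_pm _ _ _)).
  set (l := ell omega B). set (m := mu omega A).
  set (a := 1 / (2 * omega)).
  assert (Hl : lambda omega A = a ^ 2 - m ^ 2) by (unfold lambda, a; fold m; field; lra).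
  rewrite Hl.
  assert (Ha : a <> 0).
  { unfold a. apply Rgt_not_eq. apply Rdiv_lt_0_compat; lra. }
  assert (Hs : sin (r * PI) <> 0).
  { intros E. destruct (sin_eq_0_0 _ E) as [n Hn]. apply (Hr n).
    apply Rmult_eq_reg_r with PI; auto. apply PI_neq0. }
  destruct (fundamental_exists a _ (drive omega B A) (drive_cont omega B A)
    (drive_bounded omega B A)) as [p1 [q1 [p2 [q2 HU]]]].
  rewrite (L_pm_trace omega r B A p1 q1 p2 q2 Ho Hr HU).
  (* Both sides contain [~ Sigma_pm]; under it [(r - l) / 2] and [(r + l) / 2] are not integers, and
     only the trace condition remains to be compared with the matching condition. *)
  enough (M : ~ Sigma_pm omega r (B, A) ->
    (p1 (2 * PI) + q2 (2 * PI) = 2 * cos (r * PI) <->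
     ((r - l) / 2 + 1) * ((r + l) / 2 - 1)
       * entry (Rmat r l m (a ^ 2 - m ^ 2) 1) 1 1 * entry (Tmat r l m (a ^ 2 - m ^ 2) 0) 1 1
     + m ^ 2 * entry (Rmat r l m (a ^ 2 - m ^ 2) 1) 2 1
       * entry (Tmat r l m (a ^ 2 - m ^ 2) 0) 2 1 = 0)) by tauto.
  intros HS. destruct (not_Sigma_not_int omega r B A HS) as [Hu Hv]. fold l in Hu, Hv.
  destruct (Rmat_forward r l m (a ^ 2 - m ^ 2) Hu Hv) as [F [HF [-> ->]]].
  destruct (Tmat_backward r l m (a ^ 2 - m ^ 2) Hu Hv) as [T [HT [-> ->]]].
  split.
  - intros E. exact (trace_matching_zero a l m r F T _ _ _ _ Ha Hu Hv Hs HF HT HU E).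
  - intros E. apply NNPP. intros N.
    exact (trace_matching_nonzero a l m r F T _ _ _ _ Ha Hu Hv HF HT HU N E).
Qed.
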